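(* Let $n\ge1$, let $a_1,\dots,a_n\in\mathbb{Q}$, and let $r$ be a positive integer with $ra_i\in\mathbb{Z}$ for all $i$. The $H^\bullet(T(1,n),\mathbb{C})$-module $H^\bullet(T(1,n),\mathcal{L}_{\sum a_i\omega_i})$ is generated by the images (cohomology classes) of those $\overline{\beta}(F)$ for which $F\in\mathcal{F}(1,n;a_i)^\circ$ has no closed roots and no breakable edges. In particular, for $s\in\mathbb{Z}$, the module $H^\bullet(T(1,n),\mathcal{L}_{\frac{s}{n}\sum\omega_i})$ is generated by $H^{n-\gcd(s,n)}(T(1,n),\mathcal{L}_{\frac{s}{n}\sum\omega_i})$.
   Context: Space and forms. $T(1,n)=\{(z_1,\dots,z_n)\in\mathbb{C}^n\mid z_i\ne0\ \forall i,\ z_i\neq z_j\ \forall i\ne j\}$. $\Omega^\bullet(T(1,n))$ is the graded algebra of regular (algebraic) differential forms on $T(1,n)$, with differential $d$; $\omega_i=dz_i/z_i$, $\omega_{i,j}=(dz_i-dz_j)/(z_i-z_j)$. For a 1-form $\omega$, $\ell_\omega(\alpha)=\omega\wedge\alpha$. $\mathcal{L}_\omega$ is the rank-one local system on $T(1,n)$ whose local sections are the solutions of $df+f\omega=0$; there is a natural isomorphism, used as an identification, $H^p(T(1,n),\mathcal{L}_\omega)\cong\ker(d+\ell_\omega|_{\Omega^p(T(1,n))})/\mathrm{im}(d+\ell_\omega|_{\Omega^{p-1}(T(1,n))})$; the case $\omega=0$ gives $H^p(T(1,n),\mathbb{C})$. The wedge product of differential forms makes $H^\bullet(T(1,n),\mathbb{C})$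 a ring and $H^\bullet(T(1,n),\mathcal{L}_\omega)$ a module over it. Forests. A directed tree on a nonempty finite set is a directed graph with that vertex set, without loops or cycles, with exactly one vertex (the root) of out-degree $0$ and all others of out-degree $1$. A directed forest on $\{1,\dots,n\}$ is a directed graph on this vertex set each of whose connected components is a directed tree. $\mathcal{F}(1,n)$ is the set of directed forests on $\{1,\dots,n\}$ equipped with a partition of the set of roots into open and closed roots; $i\to j$ means there is an edge from $i$ to $j$. $\mathcal{F}(1,n;a_i)$ is the set of $F\in\mathcal{F}(1,n)$ such that $\sum_{i\in T}a_i\in\mathbb{Z}$ for every tree $T$ of $F$ (sum over vertices of $T$). $\mathcal{F}(1,n;a_i)^\circ$ is its subset of rectified forests, i.e. those in which $i\to j$ implies $i<j$. Let $\preceq$ be the partial order generated by $\to$ (so $i\preceq j$ iff there is a directed path, possibly of length $0$, from $i$ to $j$). An edge $i\to j$ of $F\in\mathcal{F}(1,n;a_i)$ is breakable if the new trees formed by deleting it still have integral sums $\sum a_i$ over their vertices, equivalently if $\sum_{k\preceq i}a_k\in\mathbb{Z}$. The forms $\overline{\beta}(F)$. For $F\in\mathcal{F}(1,n;a_i)$ put $\varepsilon_i(F)=(-1)^{i-1-|\{\text{open roots of }F\text{ which are }<i\}|}$, $b_j(F)=-\lfloor\sum_{k\preceq j}a_k\rfloor+\sum_{i\to j}\lceil\sum_{k\preceq i}a_k\rceil$ (outer sum over all $i$ with $i\to j$ in $F$), and $\overline{\beta}(F)=\big(\prod_{j=1}^n z_j^{b_j(F)}\big)\,\overline{\beta}_1(F)\wedge\cdots\wedge\overline{\beta}_n(F)$,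 where $\overline{\beta}_i(F)=\varepsilon_i(F)\,r$ if $i$ is an open root of $F$; $\overline{\beta}_i(F)=\omega_i$ if $i$ is a closed root; $\overline{\beta}_i(F)=\omega_{i,j}$ if $i\to j$ in $F$ and $\sum_{k\preceq i}a_k\in\mathbb{Z}$; $\overline{\beta}_i(F)=(z_i-z_j)^{-1}(\omega_i-\omega_j)$ if $i\to j$ in $F$ and $\sum_{k\preceq i}a_k\notin\mathbb{Z}$. Each $\overline{\beta}(F)$ lies in $\ker(d+\ell_{\sum a_i\omega_i})$, so has a class in $H^\bullet(T(1,n),\mathcal{L}_{\sum a_i\omega_i})$. *)

(* Defs.v *)
From HB Require Import structures.
From mathcomp Require Import all_boot all_order all_algebra.
From mathcomp Require Import fraction ring_quotient complex mpoly.
From mathcomp Require Import boolp reals.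
From mathcomp Require Import ring.

Set Implicit Arguments.
Unset Strict Implicit.
Unset Printing Implicit Defensive.

Import Order.TTheory GRing.Theory Num.Theory.

Local Open Scope ring_scope.
Local Open Scope quotient_scope.

(* ext K n is the exterior algebra over K on generators e_0, ..., e_(n-1):
   alpha I is the coordinate of alpha on the product of the e_i (i in I)
   taken in increasing order. *)
Definition ext (K : comNzRingType) (n : nat) := {ffun {set 'I_n} -> K}.

HB.instance Definition _ (K : comNzRingType) (n : nat) :=
  GRing.Lmodule.copy (ext K n) {ffun {set 'I_n} -> K^o}.

Section Exterior.
Variables (K : comNzRingType) (n : nat).
Local Notation E := (ext K n).
Implicit Types (A B D I : {set 'I_n}) (x y t : E).

Definition ninv A B : nat := \sum_(i in A) \sum_(j in B) (j < i)%N.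

Definition wedge x y : E :=
  [ffun I : {set 'I_n} => \sum_(A : {set 'I_n} | A \subset I)
     (-1) ^+ ninv A (I :\: A) * x A * y (I :\: A)].

Definition ext1 : E := [ffun I : {set 'I_n} => (I == set0)%:R].

Definition ext_gen (i : 'I_n) : E := [ffun I : {set 'I_n} => (I == [set i])%:R].

(* The parity involution, equal to (-1)^p in degree p. *)
Definition parity x : E := [ffun I : {set 'I_n} => (-1) ^+ #|I| * x I].

Definition homogeneous (p : nat) x := forall I, #|I| != p -> x I = 0.

Lemma ninv0l B : ninv set0 B = 0%N.
Proof. by rewrite /ninv big_set0. Qed.

Lemma ninv0r A : ninv A set0 = 0%N.
Proof. by rewrite /ninv big1 // => i _; rewrite big_set0. Qed.

Lemma ninvUl A B D : [disjoint A & B] ->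
  ninv (A :|: B) D = (ninv A D + ninv B D)%N.
Proof.
by move=> dAB; rewrite /ninv -bigU //=; apply: eq_bigl => i; rewrite !inE.
Qed.

Lemma ninvUr A B D : [disjoint B & D] ->
  ninv A (B :|: D) = (ninv A B + ninv A D)%N.
Proof.
move=> dBD; rewrite /ninv -big_split /=; apply: eq_bigr => i _.
by rewrite -bigU //=; apply: eq_bigl => j; rewrite !inE.
Qed.

Lemma wedgeA : associative wedge.
Proof.
move=> x y t; apply/ffunP => I; rewrite !ffunE.
under eq_bigr => A sAI do rewrite ffunE mulr_sumr.
under [RHS]eq_bigr => D sDI do rewrite ffunE mulr_sumr mulr_suml.
rewrite [RHS](exchange_big_dep (fun A => A \subset I)) /=; last first.
  by move=> D A sDI sAD; exact: subset_trans sAD sDI.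
apply: eq_bigr => A sAI.
rewrite [RHS](reindex_onto (fun B => A :|: B) (fun D => D :\: A)) /=; last first.
  by move=> D /andP[_ sAD]; rewrite setDE setUIr setUCr setIT; apply/setUidPr.
have cond B : (B \subset I :\: A) =
    (A :|: B \subset I) && (A \subset A :|: B) && ((A :|: B) :\: A == B).
  rewrite subsetUl subUset sAI andbT /= subsetD setDUl setDv set0U; congr andb.
  by apply/idP/eqP => [/setDidPl//|/setDidPl].
rewrite (eq_bigl _ _ cond); apply: eq_bigr => B; rewrite -cond => sB.
move: (sB); rewrite subsetD => /andP[sBI dBA].
have eB : (A :|: B) :\: A = B by rewrite setDUl setDv set0U; apply/setDidPl.
rewrite eB setDDl.
set G := I :\: (A :|: B).
have dBG : [disjoint B & G].
  by rewrite disjoint_sym disjoints_subset /G setDE setCU subIset // orbC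
     subsetIr.
have eIA : I :\: A = B :|: G.
  rewrite /G -setDDl; apply/setP => k; rewrite !inE.
  case: (boolP (k \in B)) => [kB|_] //=.
  by move/subsetP: sB => /(_ k kB); rewrite inE.
have dAB : [disjoint A & B] by rewrite disjoint_sym.
rewrite eIA ninvUr // ninvUl // !exprD; ring.
Qed.

Lemma wedge1l : left_id ext1 wedge.
Proof.
move=> x; apply/ffunP => I; rewrite ffunE (bigD1 set0) ?sub0set //= big1 => [|A].
  by rewrite addr0 setD0 ninv0l !ffunE eqxx expr0 !mul1r.
by case/andP=> _ nA; rewrite ffunE (negPf nA) mulr0 mul0r.
Qed.

Lemma wedge1r : right_id ext1 wedge.
Proof.
move=> x; apply/ffunP => I; rewrite ffunE (bigD1 I) //= big1 => [|A].
  by rewrite addr0 setDv ninv0r !ffunE eqxx expr0 mul1r mulr1.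
case/andP=> sAI nA; rewrite ffunE setD_eq0 (_ : I \subset A = false) ?mulr0 //.
by apply/negP => sIA; rewrite eqEsubset sAI sIA in nA.
Qed.

Lemma wedgeDl : left_distributive wedge +%R.
Proof.
move=> x y t; apply/ffunP => I; rewrite !ffunE -big_split /=.
by apply: eq_bigr => A _; rewrite ffunE; ring.
Qed.

Lemma wedgeDr : right_distributive wedge +%R.
Proof.
move=> x y t; apply/ffunP => I; rewrite !ffunE -big_split /=.
by apply: eq_bigr => A _; rewrite ffunE; ring.
Qed.

Lemma ext1_neq0 : ext1 != 0.
Proof. by apply/eqP => /ffunP/(_ set0)/eqP; rewrite !ffunE eqxx oner_eq0. Qed.

HB.instance Definition _ := GRing.Zmodule_isNzRing.Build E
  wedgeA wedge1l wedge1r wedgeDl wedgeDr ext1_neq0.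

Lemma wedgeE x y I : (x * y) I = \sum_(A : {set 'I_n} | A \subset I)
     (-1) ^+ ninv A (I :\: A) * x A * y (I :\: A).
Proof. by rewrite ffunE. Qed.

Lemma ext_scaleE (c : K) x I : (c *: x) I = c * x I.
Proof. by rewrite ffunE. Qed.

Lemma ext_addE x y I : (x + y) I = x I + y I. Proof. by rewrite ffunE. Qed.

Lemma ext_oppE x I : (- x) I = - x I. Proof. by rewrite ffunE. Qed.

Lemma ext_zeroE I : (0 : E) I = 0. Proof. by rewrite ffunE. Qed.

Lemma ext_scaleAl (c : K) x y : c *: (x * y) = (c *: x) * y.
Proof.
apply/ffunP => I; rewrite ext_scaleE !wedgeE mulr_sumr.
by apply: eq_bigr => A _; rewrite ext_scaleE; ring.
Qed.

HB.instance Definition _ := GRing.Lmodule_isLalgebra.Build K E ext_scaleAl.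

Lemma ext_scaleAr (c : K) x y : c *: (x * y) = x * (c *: y).
Proof.
apply/ffunP => I; rewrite ext_scaleE !wedgeE mulr_sumr.
by apply: eq_bigr => A _; rewrite ext_scaleE; ring.
Qed.

HB.instance Definition _ := GRing.Lalgebra_isAlgebra.Build K E ext_scaleAr.

Lemma parityE x I : parity x I = (-1) ^+ #|I| * x I.
Proof. by rewrite ffunE. Qed.

Lemma parityB x y : parity (x - y) = parity x - parity y.
Proof.
by apply/ffunP => I; rewrite !(ffunE, ext_addE, ext_oppE) mulrBr.
Qed.

Lemma ext_gen_wedge i x I :
  (ext_gen i * x) I =
  if i \in I then (-1) ^+ ninv [set i] (I :\ i) * x (I :\ i) else 0.
Proof.
rewrite wedgeE; case: ifP => iI.
  rewrite (bigD1 [set i]) ?sub1set //= big1 => [|A /andP[_ nA]].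
    by rewrite ffunE eqxx mulr1 addr0.
  by rewrite ffunE (negPf nA) mulr0 mul0r.
rewrite big1 // => A sAI; rewrite ffunE; case: eqP => [eA|]; last by rewrite mulr0 mul0r.
by rewrite eA sub1set iI in sAI.
Qed.

Lemma wedge_ext_gen i x I :
  (x * ext_gen i) I =
  if i \in I then (-1) ^+ ninv (I :\ i) [set i] * x (I :\ i) else 0.
Proof.
rewrite wedgeE; case: ifP => iI.
  have eI : I :\: (I :\ i) = [set i] by rewrite setDDr setDv set0U; apply/setIidPr; rewrite sub1set.
  rewrite (bigD1 (I :\ i)) ?subsetDl //= big1 => [|A /andP[sAI nA]].
    by rewrite eI ffunE eqxx mulr1 addr0.
  rewrite ffunE; case: eqP => [eA|]; last by rewrite mulr0.
  case/eqP: nA; rewrite -eA setDDr setDv set0U; apply/esym/setIidPr => //.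
rewrite big1 // => A sAI; rewrite ffunE; case: eqP => [eA|]; last by rewrite mulr0.
by have := set11 i; rewrite -eA inE iI andbF.
Qed.

Lemma ext_gen_parity i x : ext_gen i * x = parity x * ext_gen i.
Proof.
apply/ffunP => I; rewrite ext_gen_wedge wedge_ext_gen; case: ifP => // iI.
rewrite ffunE mulrA -exprD; congr (_ * _).
apply/eqP; rewrite -signr_odd -[X in _ == X]signr_odd; apply/eqP; congr (_ ^+ (nat_of_bool _)).
have -> : #|I :\ i| = (ninv [set i] (I :\ i) + ninv (I :\ i) [set i])%N.
  rewrite /ninv big_set1 -big_split /= -sum1_card; apply: eq_bigr => j.
  rewrite big_set1 !inE -val_eqE /= => /andP[nij _].
  by case: ltngtP nij => // /eqP ->.
by rewrite addnA addnAC addnn oddD odd_double.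
Qed.

End Exterior.

(* Extension of a derivation D of R to the fraction field by the quotient
   rule. *)
Section FractionDerivation.
Variables (R : idomainType) (D : R -> R).
Local Notation F := {fraction R}.
Local Notation "x %:F" := (@FracField.tofrac R x).

Definition frac_deriv (f : F) : F :=
  let p := \n_(repr f) in let q := \d_(repr f) in
  (D p * q - p * D q)%:F / (q%:F ^+ 2).

Hypothesis DD : {morph D : p q / p + q}.
Hypothesis DM : forall p q, D (p * q) = D p * q + p * D q.

Lemma frac_repr (f : F) : f * (\d_(repr f))%:F = (\n_(repr f))%:F.
Proof.
rewrite -[f in f * _]reprK; unlock FracField.tofrac.
rewrite -[LHS]FracField.pi_mul; apply/eqmodP; rewrite /= FracField.equivfE.
rewrite /FracField.mulf !numden_Ratio ?mulr1 ?oner_eq0 ?denom_ratioP //.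
by rewrite mulrC.
Qed.

Lemma frac_derivE (f : F) (p q : R) : q != 0 -> f * q%:F = p%:F ->
  frac_deriv f * q%:F = (D p)%:F - f * (D q)%:F.
Proof.
move=> q0 fq; have := frac_repr f; rewrite /frac_deriv /=.
have := denom_ratioP (repr f).
move: (\n_(repr f)) (\d_(repr f)) => n d d0 fd.
have dF0 : d%:F != 0 by rewrite tofrac_eq0.
have qF0 : q%:F != 0 by rewrite tofrac_eq0.
have /(congr1 D) : n * q = p * d.
  by apply/eqP; rewrite -tofrac_eq !tofracM -fd -fq; apply/eqP; ring.
rewrite !DM => /(congr1 (@FracField.tofrac R)).
rewrite tofracB !tofracD !tofracM -fd -fq.
move: (D n)%:F (D p)%:F (D d)%:F (D q)%:F q%:F d%:F dF0 => n' p' d' q' x y y0 e.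
have {}e : n' * x = (p' - f * q') * y + f * x * d'.
  by rewrite mulrBl -[LHS](addrK (f * y * q')) e; ring.
apply: (mulIf y0).
have -> : (n' * y - f * y * d') / y ^+ 2 = (n' - f * d') / y.
  by rewrite [f * y * d']mulrAC -mulrBl expr2 invfM mulrA mulfK.
rewrite mulrAC divfK //.
by rewrite mulrBl e; ring.
Qed.

Lemma frac_derivD : {morph frac_deriv : f g / f + g}.
Proof.
move=> f g.
have := frac_repr f; have := denom_ratioP (repr f).
move: (\n_(repr f)) (\d_(repr f)) => p q q0 fq.
have := frac_repr g; have := denom_ratioP (repr g).
move: (\n_(repr g)) (\d_(repr g)) => u v v0 gv.
have qF0 : q%:F != 0 by rewrite tofrac_eq0.
have vF0 : v%:F != 0 by rewrite tofrac_eq0.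
have qv0 : q * v != 0 by rewrite mulf_neq0.
have h : (f + g) * (q * v)%:F = (p * v + u * q)%:F.
  by rewrite tofracD !tofracM -fq -gv; ring.
have h1 := frac_derivE q0 fq; have h2 := frac_derivE v0 gv.
have h3 := frac_derivE qv0 h.
apply: (mulIf (_ : (q * v)%:F != 0)); first by rewrite tofrac_eq0.
rewrite h3 DD !DM !tofracD !tofracM.
transitivity (frac_deriv f * q%:F * v%:F + frac_deriv g * v%:F * q%:F); last by ring.
by rewrite h1 h2 -fq -gv; ring.
Qed.

Lemma frac_derivM f g :
  frac_deriv (f * g) = frac_deriv f * g + f * frac_deriv g.
Proof.
have := frac_repr f; have := denom_ratioP (repr f).
move: (\n_(repr f)) (\d_(repr f)) => p q q0 fq.
have := frac_repr g; have := denom_ratioP (repr g).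
move: (\n_(repr g)) (\d_(repr g)) => u v v0 gv.
have qv0 : q * v != 0 by rewrite mulf_neq0.
have h : (f * g) * (q * v)%:F = (p * u)%:F.
  by rewrite !tofracM -fq -gv; ring.
have h1 := frac_derivE q0 fq; have h2 := frac_derivE v0 gv.
have h3 := frac_derivE qv0 h.
apply: (mulIf (_ : (q * v)%:F != 0)); first by rewrite tofrac_eq0.
rewrite h3 !DM !tofracD !tofracM.
transitivity (frac_deriv f * q%:F * (g * v%:F) + frac_deriv g * v%:F * (f * q%:F));
  last by ring.
by rewrite h1 h2 -fq -gv; ring.
Qed.

End FractionDerivation.

(* Regular differential forms on T(1,n) and their twisted cohomology. Regular
   forms are handled as forms with coefficients in the field of rational
   functions C(z_1, ..., z_n), the coefficients being required to lie in the
   coordinate ring of T(1,n). *)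
Section TwistedDeRham.
Variables (R : realType) (n : nat).

Local Notation P := {mpoly R[i][n]}.
Local Notation "p %:F" := (@FracField.tofrac P p).

Definition ratfun : fieldType := {fraction P}.

Definition z (i : 'I_n) : ratfun := ('X_i : P)%:F.

Definition pderiv (i : 'I_n) : ratfun -> ratfun := frac_deriv (@mderiv n R[i] i).

Definition braid_poly : P :=
  (\prod_(i < n) 'X_i) * \prod_(i < n) \prod_(j < n | (i < j)%N) ('X_i - 'X_j).

(* T(1,n) is the complement in C^n of the zero locus of braid_poly, so that its
   coordinate ring is C[z_1, ..., z_n][1 / braid_poly]. *)
Definition regular_fun : {pred ratfun} :=
  fun f => `[< exists (p : P) (N : nat), f = p%:F / braid_poly%:F ^+ N >].

Definition dform := ext ratfun n.
HB.instance Definition _ := GRing.Algebra.on dform.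

Definition dz (i : 'I_n) : dform := ext_gen ratfun i.

Definition regular_form : {pred dform} :=
  fun alpha => [forall I, alpha I \in regular_fun].

Definition form_pderiv (i : 'I_n) (alpha : dform) : dform :=
  [ffun I => pderiv i (alpha I)].

Definition ext_d (alpha : dform) : dform := \sum_i dz i * form_pderiv i alpha.

Definition dlog (i : 'I_n) : dform := (z i)^-1 *: dz i.

Definition dlog2 (i j : 'I_n) : dform := (z i - z j)^-1 *: (dz i - dz j).

Definition omega (a : 'I_n -> rat) : dform := \sum_i ratr (a i) *: dlog i.

(* d + l_omega for omega = sum_i a_i omega_i *)
Definition nabla (a : 'I_n -> rat) (alpha : dform) : dform :=
  ext_d alpha + omega a * alpha.

Lemma mpolyXB_neq0 (i j : 'I_n) : i != j -> 'X_i - 'X_j != 0 :> P.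
Proof.
move=> nij; rewrite subr_eq0; apply/eqP => /(congr1 (mcoeff U_(i))).
rewrite !mcoeffX eqxx; case: eqP => [e _|_ /eqP]; last by rewrite oner_eq0.
have := congr1 (fun m : 'X_{1..n} => m i) e.
by rewrite !mnm1E eqxx eq_sym (negPf nij).
Qed.

Lemma braid_poly_neq0 : braid_poly != 0.
Proof.
rewrite mulf_neq0 //; apply/prodf_neq0 => i _.
  by rewrite -msize_poly_eq0 msizeX.
by apply/prodf_neq0 => j ij; apply: mpolyXB_neq0; rewrite -val_eqE /= ltn_eqF.
Qed.

Lemma regular_fun_subring : subring_closed regular_fun.
Proof.
have D0 N : braid_poly%:F ^+ N != 0 by rewrite expf_neq0 // tofrac_eq0 braid_poly_neq0.
split=> [|f g|f g].
- by apply/asboolP; exists 1, 0%N; rewrite tofrac1 expr0 divr1.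
- move=> /asboolP[p [N ->]] /asboolP[q [M ->]]; apply/asboolP.
  exists (p * braid_poly ^+ M - q * braid_poly ^+ N), (N + M)%N.
  move: braid_poly D0 => d D0.
  by rewrite tofracB !tofracM !tofracXn exprD -!mulNr addf_div.
- move=> /asboolP[p [N ->]] /asboolP[q [M ->]]; apply/asboolP.
  exists (p * q), (N + M)%N.
  move: braid_poly D0 => d D0.
  by rewrite tofracM exprD invfM mulrACA.
Qed.
HB.instance Definition _ := GRing.isSubringClosed.Build ratfun regular_fun
  regular_fun_subring.

Lemma regular_formP (alpha : dform) :
  reflect (forall I, alpha I \in regular_fun) (alpha \in regular_form).
Proof. exact: forallP. Qed.

Lemma regular_form_subring : subring_closed regular_form.
Proof.
split=> [|x y /regular_formP hx /regular_formP hy|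
          x y /regular_formP hx /regular_formP hy]; apply/regular_formP => I.
- by rewrite ffunE rpred_nat.
- by rewrite ext_addE ext_oppE rpredB.
- rewrite wedgeE rpred_sum // => A _.
  by rewrite !rpredM // rpredX // rpredN rpred1.
Qed.
HB.instance Definition _ := GRing.isSubringClosed.Build dform regular_form
  regular_form_subring.

Lemma parity_regular x : x \in regular_form -> (parity x : dform) \in regular_form.
Proof.
move=> /regular_formP hx; apply/regular_formP => I.
by rewrite ffunE rpredM // rpredX // rpredN rpred1.
Qed.

Lemma pderivD i : {morph pderiv i : f g / f + g}.
Proof. by apply: frac_derivD; [exact: mderivD | exact: mderivM]. Qed.

Lemma pderivM i f g : pderiv i (f * g) = pderiv i f * g + f * pderiv i g.
Proof. by apply: frac_derivM; exact: mderivM. Qed.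

Lemma pderiv_is_zmod_morphism i : zmod_morphism (pderiv i).
Proof.
have D0 : pderiv i 0 = 0.
  by apply: (addrI (pderiv i 0)); rewrite -pderivD !addr0.
have DN f : pderiv i (- f) = - pderiv i f.
  by apply: (addrI (pderiv i f)); rewrite -pderivD !subrr.
by move=> f g; rewrite pderivD DN.
Qed.
HB.instance Definition _ i := GRing.isZmodMorphism.Build ratfun ratfun (pderiv i)
  (pderiv_is_zmod_morphism i).

Lemma pderiv1 i : pderiv i 1 = 0.
Proof.
apply: (addrI (pderiv i 1)); rewrite addr0 -[X in _ = pderiv i X]mulr1 pderivM.
by rewrite mulr1 mul1r.
Qed.

Lemma pderiv_sign i m f : pderiv i ((-1) ^+ m * f) = (-1) ^+ m * pderiv i f.
Proof.
elim: m f => [|m ih] f; first by rewrite !mul1r.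
by rewrite exprS -!mulrA !mulN1r raddfN /= ih.
Qed.

Lemma form_pderiv_is_zmod_morphism i : zmod_morphism (form_pderiv i).
Proof.
by move=> x y; apply/ffunP => I; rewrite !(ffunE, ext_addE, ext_oppE) raddfB.
Qed.
HB.instance Definition _ i := GRing.isZmodMorphism.Build dform dform (form_pderiv i)
  (form_pderiv_is_zmod_morphism i).

Lemma form_pderivM i x y :
  form_pderiv i (x * y) = form_pderiv i x * y + x * form_pderiv i y.
Proof.
apply/ffunP => I; rewrite ext_addE !wedgeE ffunE wedgeE raddf_sum -big_split /=.
apply: eq_bigr => A _; rewrite -mulrA pderiv_sign pderivM !ffunE; ring.
Qed.

Lemma form_pderiv_parity i x : form_pderiv i (parity x) = parity (form_pderiv i x).
Proof. by apply/ffunP => I; rewrite !ffunE pderiv_sign. Qed.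

Lemma ext_d_is_zmod_morphism : zmod_morphism ext_d.
Proof.
move=> x y; rewrite /ext_d -sumrB; apply: eq_bigr => i _.
by rewrite raddfB mulrBr.
Qed.
HB.instance Definition _ := GRing.isZmodMorphism.Build dform dform ext_d
  ext_d_is_zmod_morphism.

Lemma ext_dM (x y : dform) :
  ext_d (x * y) = ext_d x * y + (parity x : dform) * ext_d y.
Proof.
rewrite /ext_d mulr_suml mulr_sumr -big_split /=; apply: eq_bigr => i _.
rewrite form_pderivM mulrDr !mulrA; congr (_ + _ * _).
exact: ext_gen_parity.
Qed.

Lemma ext_d_parity (x : dform) : ext_d (parity x) = - parity (ext_d x).
Proof.
have pS (I : finType) (f : I -> dform) :
    parity (\sum_i f i) = \sum_i (parity (f i) : dform).
  apply: (big_morph (fun u : dform => parity u : dform)) => [u v|].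
    by apply/ffunP => J; rewrite !(parityE, ext_addE) mulrDr.
  by apply/ffunP => J; rewrite parityE !ext_zeroE mulr0.
rewrite /ext_d pS -sumrN; apply: eq_bigr => i _.
rewrite form_pderiv_parity; apply/ffunP => I.
rewrite ext_oppE parityE /dz !ext_gen_wedge; case: ifP => iI;
  last by rewrite mulr0 oppr0.
rewrite parityE (cardsD1 i I) iI exprS mulN1r !mulNr opprK.
by rewrite mulrCA.
Qed.

Lemma omega_parity a (x : dform) : omega a * x = (parity x : dform) * omega a.
Proof.
rewrite /omega mulr_suml mulr_sumr; apply: eq_bigr => i _.
by rewrite /dlog !scalerA -scalerAl -scalerAr ext_gen_parity.
Qed.

Lemma nabla_is_zmod_morphism a : zmod_morphism (nabla a).
Proof. by move=> x y; rewrite /nabla raddfB mulrBr addrACA -opprD. Qed.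
HB.instance Definition _ a := GRing.isZmodMorphism.Build dform dform (nabla a)
  (nabla_is_zmod_morphism a).

Definition a_triv : 'I_n -> rat := fun=> 0.

Lemma nabla0 x : nabla a_triv x = ext_d x.
Proof.
rewrite /nabla /omega big1 ?mul0r ?addr0 // => i _.
by rewrite [ratr _](ratr_int _ 0) scale0r.
Qed.

Lemma nablaM a (c x : dform) :
  nabla a (c * x) = ext_d c * x + (parity c : dform) * nabla a x.
Proof.
by rewrite /nabla ext_dM mulrDr !mulrA omega_parity -addrA.
Qed.

Definition is_cocycle (a : 'I_n -> rat) : {pred dform} :=
  fun alpha => (alpha \in regular_form) && (nabla a alpha == 0).

Lemma is_cocycle_zmod a : zmod_closed (is_cocycle a).
Proof.
split=> [|x y /andP[rx /eqP dx] /andP[ry /eqP dy]]; apply/andP; split.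
- exact: rpred0.
- by rewrite raddf0.
- exact: rpredB.
- by rewrite raddfB /= dx dy subrr.
Qed.
HB.instance Definition _ a := GRing.isZmodClosed.Build dform (is_cocycle a)
  (is_cocycle_zmod a).

Record cocycle (a : 'I_n -> rat) :=
  Cocycle { cocycle_form :> dform; _ : is_cocycle a cocycle_form }.
HB.instance Definition _ a := [isSub for @cocycle_form a].
HB.instance Definition _ a := [Choice of cocycle a by <:].
HB.instance Definition _ a := [SubChoice_isSubZmodule of cocycle a by <:].

Definition is_coboundary (a : 'I_n -> rat) : {pred cocycle a} :=
  fun c => `[< exists2 g : dform, g \in regular_form & val c = nabla a g >].

Lemma is_coboundary_zmod a : zmod_closed (@is_coboundary a).
Proof.
split=> [|x y /asboolP[g rg dg] /asboolP[h rh dh]]; apply/asboolP.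
  by exists 0; rewrite ?rpred0 ?raddf0.
exists (g - h); first exact: rpredB.
by apply: etrans (esym (nabla_is_zmod_morphism a g h)); rewrite -dg -dh raddfB.
Qed.
HB.instance Definition _ a := GRing.isZmodClosed.Build (cocycle a)
  (@is_coboundary a) (is_coboundary_zmod a).

(* The total cohomology H^*(T(1,n), L_omega), omega = sum_i a_i omega_i; as
   nabla is homogeneous of degree 1 and of square zero, it is the direct sum of the H^p, where
   H^p is identified with the classes of cocycles of degree p. *)
Definition cohomology (a : 'I_n -> rat) := Quotient.quot (@is_coboundary a).
HB.instance Definition _ a := Quotient.on (cohomology a).
HB.instance Definition _ a := GRing.Zmodule.on (cohomology a).

Definition cocycle_class a (c : cocycle a) : cohomology a := \pi c.

Lemma cocycle_class_eq a (c c' : cocycle a) :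
  reflect (exists2 g : dform, g \in regular_form & val c - val c' = nabla a g)
          (cocycle_class c == cocycle_class c').
Proof.
apply: (iffP idP) => [|[g rg e]].
  by rewrite /cocycle_class -Quotient.idealrBE => /asboolP[g rg e]; exists g.
by rewrite /cocycle_class -Quotient.idealrBE; apply/asboolP; exists g.
Qed.

Lemma cocycle_classB a (c c' : cocycle a) :
  cocycle_class (c - c') = cocycle_class c - cocycle_class c'.
Proof. by rewrite /cocycle_class raddfB. Qed.

Lemma cocycle_classD a (c c' : cocycle a) :
  cocycle_class (c + c') = cocycle_class c + cocycle_class c'.
Proof. by rewrite /cocycle_class raddfD. Qed.

Lemma cocycle_classW a (Q : cohomology a -> Prop) :
  (forall c, Q (cocycle_class c)) -> forall x, Q x.
Proof. by move=> h x; rewrite -[x]reprK; exact: h. Qed.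

Lemma cocycle_wedge_subproof a (c : cocycle a_triv) (x : cocycle a) :
  is_cocycle a (val c * val x).
Proof.
have /andP[rc /eqP dc] := valP c; have /andP[rx /eqP dx] := valP x.
apply/andP; split; first exact: rpredM.
by rewrite nablaM dx -nabla0 dc mul0r mulr0 addr0.
Qed.

Definition cocycle_wedge a (c : cocycle a_triv) (x : cocycle a) : cocycle a :=
  Cocycle (cocycle_wedge_subproof c x).

Definition cup a (c : cohomology a_triv) (x : cohomology a) : cohomology a :=
  cocycle_class (cocycle_wedge (repr c) (repr x)).

Lemma cupE a (c : cocycle a_triv) (x : cocycle a) :
  cup (cocycle_class c) (cocycle_class x) = cocycle_class (cocycle_wedge c x).
Proof.
rewrite /cup; set c' := repr _; set x' := repr _.
have /eqP/cocycle_class_eq[g rg eg] : cocycle_class c' = cocycle_class c.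
  by rewrite /cocycle_class reprK.
have /eqP/cocycle_class_eq[h rh eh] : cocycle_class x' = cocycle_class x.
  by rewrite /cocycle_class reprK.
apply/eqP/cocycle_class_eq.
have /andP[rc' /eqP dc'] := valP c'; have /andP[rx /eqP dx] := valP x.
exists ((parity (val c') : dform) * h + g * val x).
  by rewrite rpredD // rpredM // parity_regular.
have pp (y : dform) : parity (parity y : dform) = y.
  by apply/ffunP => I; rewrite !parityE mulrA -exprMn mulrNN mulr1 expr1n mul1r.
rewrite raddfD /= !nablaM pp ext_d_parity -[ext_d (val c')]nabla0 dc' dx.
have -> : parity (0 : dform) = 0 :> dform.
  by apply/ffunP => I; rewrite parityE ext_zeroE mulr0.
by rewrite oppr0 mul0r add0r mulr0 addr0 -[ext_d g]nabla0 -eg -eh mulrBr mulrBl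
  addrA subrK.
Qed.

Lemma one_cocycle_subproof : is_cocycle a_triv 1.
Proof.
apply/andP; split; first exact: rpred1.
apply/eqP; rewrite nabla0 /ext_d big1 // => i _.
rewrite [form_pderiv _ _](_ : _ = 0) ?mulr0 //; apply/ffunP => I.
rewrite ffunE [(1 : dform) I]ffunE ext_zeroE.
by case: eqP; rewrite ?pderiv1 ?raddf0.
Qed.

Definition cohomology_one : cohomology a_triv :=
  cocycle_class (Cocycle one_cocycle_subproof).

Lemma cupA a (c d : cohomology a_triv) (x : cohomology a) :
  cup c (cup d x) = cup (cup c d) x.
Proof.
elim/cocycle_classW: c => c; elim/cocycle_classW: d => d.
elim/cocycle_classW: x => x; rewrite !cupE; congr cocycle_class.
by apply: val_inj; rewrite /= mulrA.
Qed.

Lemma cup1l a : left_id cohomology_one (@cup a).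
Proof.
elim/cocycle_classW => x; rewrite cupE; congr cocycle_class.
by apply: val_inj; rewrite /= mul1r.
Qed.

Lemma cup1r : right_id cohomology_one (@cup a_triv).
Proof.
elim/cocycle_classW => x; rewrite cupE; congr cocycle_class.
by apply: val_inj; rewrite /= mulr1.
Qed.

Lemma cupDl a (x : cohomology a) : {morph (@cup a)^~ x : c d / c + d}.
Proof.
elim/cocycle_classW => c; elim/cocycle_classW => d.
elim/cocycle_classW: x => x; rewrite [X in cup X _](esym (cocycle_classD c d)).
rewrite [LHS]cupE [X in _ = X + _]cupE [X in _ = _ + X]cupE.
rewrite [RHS](esym (cocycle_classD _ _)).
by congr cocycle_class; apply: val_inj; rewrite /= mulrDl.
Qed.

Lemma cupDr a : right_distributive (@cup a) +%R.
Proof.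
elim/cocycle_classW => c; elim/cocycle_classW => x; elim/cocycle_classW => y.
rewrite [X in cup _ X](esym (cocycle_classD x y)).
rewrite [LHS]cupE [X in _ = X + _]cupE [X in _ = _ + X]cupE.
rewrite [RHS](esym (cocycle_classD _ _)).
by congr cocycle_class; apply: val_inj; rewrite /= mulrDr.
Qed.

(* H^*(T(1,n), C) with its ring structure *)
Definition cohomology_ring := cohomology a_triv.
HB.instance Definition _ := GRing.Zmodule.on cohomology_ring.
HB.instance Definition _ := GRing.Zmodule_isPzRing.Build cohomology_ring
  (@cupA a_triv) (@cup1l a_triv) cup1r (fun c d x => cupDl x c d) (@cupDr a_triv).

HB.instance Definition _ a := GRing.Zmodule_isLmodule.Build cohomology_ring
  (cohomology a) (@cupA a) (@cup1l a) (@cupDr a) (@cupDl a).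

Definition has_class a (alpha : dform) (x : cohomology a) : Prop :=
  exists c : cocycle a, val c = alpha /\ x = cocycle_class c.

(* the image of H^p(T(1,n), L_omega) in the total cohomology *)
Definition cohomology_deg a (p : nat) : cohomology a -> Prop :=
  fun x => exists2 alpha : dform, homogeneous p alpha & has_class alpha x.

End TwistedDeRham.

Definition generates (A : pzRingType) (M : lmodType A) (S : M -> Prop) : Prop :=
  forall x : M, exists s : seq (A * M),
    (forall u, u \in s -> S u.2) /\ x = \sum_(u <- s) u.1 *: u.2.

Section Forests.
Variable n : nat.
Implicit Types (e : rel 'I_n) (i j : 'I_n) (T : {set 'I_n}).

Definition is_root e i : bool := [forall j, ~~ e i j].

Definition component e i : {set 'I_n} :=
  [set j | connect (fun k l => e k l || e l k) i j].

(* T is meant to be a connected component of e, so that no edge leaves T. Since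
   out-degrees are at most 1, every cycle of the underlying undirected graph is
   a directed one, hence the absence of loops and cycles means that no edge
   i -> j can be followed by a path from j back to i. *)
Definition is_directed_tree e T : Prop :=
  [/\ T != set0,
      forall i j, i \in T -> e i j -> ~~ connect e j i
    & exists2 rt, rt \in T &
        forall i, i \in T -> #|[set j | e i j]| = (i != rt)].

Record forest := Forest {
  edge :> rel 'I_n;
  open_roots : {set 'I_n};
  _ : forall i, is_directed_tree edge (component edge i);
  _ : forall i, i \in open_roots -> is_root edge i
}.

Definition closed_roots (F : forest) : {set 'I_n} :=
  [set i | is_root F i] :\: open_roots F.

Definition delete_edge e i j : rel 'I_n :=
  fun k l => e k l && ((k, l) != (i, j)).

Variable a : 'I_n -> rat.

Definition integral_sum T : bool := (\sum_(i in T) a i) \is a Num.int.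

Definition integral_forest (F : forest) : Prop :=
  forall i, integral_sum (component F i).

Definition rectified (F : forest) : Prop := forall i j, F i j -> (i < j)%N.

Definition breakable (F : forest) i j : Prop :=
  [/\ F i j, integral_sum (component (delete_edge F i j) i)
    & integral_sum (component (delete_edge F i j) j)].

(* the sum of the a_k over k preceding or equal to i in the order generated
   by the edges *)
Definition down_sum (F : forest) i : rat := \sum_(k | connect F k i) a k.

Definition bexp (F : forest) j : int :=
  - Num.floor (down_sum F j) + \sum_(i | F i j) Num.ceil (down_sum F i).

Variables (R : realType) (r : nat).

(* The vertices are numbered from 0 here: i stands for the vertex i + 1. *)
Definition eps (F : forest) i : dform R n :=
  (-1) ^+ (i - #|[set k in open_roots F | (k < i)%N]|).

Definition beta_factor (F : forest) i : dform R n :=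
  match [pick j | F i j] with
  | Some j =>
      if down_sum F i \is a Num.int then dlog2 R i j
      else (z R i - z R j)^-1 *: (dlog R i - dlog R j)
  | None => if i \in open_roots F then eps F i * r%:R else dlog R i
  end.

Definition beta_form (F : forest) : dform R n :=
  (\prod_(j < n) z R j ^ bexp F j) *: \prod_(i < n) beta_factor F i.

End Forests.

(* Main.v *)
Require Import Defs.
From HB Require Import structures.
From mathcomp Require Import all_boot all_order all_algebra.
From mathcomp Require Import fraction complex mpoly.
From mathcomp Require Import boolp reals.
From mathcomp Require Import ring zify.

Set Implicit Arguments.
Unset Strict Implicit.
Unset Printing Implicit Defensive.

Import Order.TTheory GRing.Theory Num.Theory.
Local Open Scope ring_scope.

(** Vertices are removed one at a time.  For a set S of coordinates, T(1,S)
    projects onto T(1,S \ j) with fibre the complex line minus 0 and the z_k,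
    k in S \ j, and the Leray argument for this projection can be carried out
    inside the algebra of regular forms.  On the coefficients, the connection
    restricts to the operator D = d/dz_j + a_j / z_j on the regular functions
    of z_j over the ring of T(1,S \ j).  These functions are the combinations
    of powers of z_j and of powers of the 1/(z_j - p), p = 0 or z_k, and this decides the
    kernel and the cokernel of D:
    - if a_j is not an integer, D is injective, and its cokernel is spanned by
      the 1/(z_j - z_k);
    - if a_j = 0, the kernel consists of the functions of T(1,S \ j), and the
      cokernel is spanned by the 1/(z_j - z_k) and 1/z_j;
    - any other integral a_j is reduced to 0 by multiplication with a power of
      z_j, which changes the connection by the corresponding multiple of
      omega_j.
    These statements are [fibre_cokernel] and [fibre_kernel].  They rest on
    partial fractions on the one hand, and on a comparison of orders of poles
    on the other: D raises the order of every pole away from 0, so that D f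
    cannot have simple poles only.

    The cokernel classes are lifted to closed one-forms e_k with polar part
    dz_j / (z_j - z_k).  When a_j = 0 they are omega_j and the omega_{j,k}.
    Otherwise e_k = omega_{j,k} - omega_k is proportional to
    omega_j - omega_k, so that wedging with e_k turns the connection with
    weights a into minus the connection in which the weight of j has been
    added to that of k.  The lemma [leray] concludes that every cocycle is,
    up to a coboundary, r + sum e_k c_k with r and the c_k cocycles on
    T(1,S \ j), for these new weights.

    For the module structure this reads as follows.  If a_j is integral, the
    e_k are closed forms, that is scalars, so generators for S are obtained
    from generators for S \ j by multiplication with a power of z_j
    ([generated_forget_integral]): j becomes the root of a finished tree.
    If a_j is not integral, generators for S are the products of e_k with
    generators for the weights moved from j to k
    ([generated_join_nonintegral]): this is an edge from j to k.  The edge is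
    not breakable, since the weight a_j that is moved is the sum of the original
    weights over the vertices below j, and it is not integral.

    Removing the vertices in increasing order makes all edges increasing, and
    the products that arise are the forms of the statement, up to nonzero
    constants.  The exponents come from gauge transformations by the ceiling of
    a_j, at j and at the vertex k which receives its weight, and from the factor
    z_j between e_k and (z_j - z_k)^-1 (omega_j - omega_k)
    ([generated_by_forest_forms], [beta_form_par]).

    If all weights equal s/n, one may instead always remove next the vertex
    whose weight was just enlarged.  After t - 1 such steps its weight is
    t s / n, which is integral exactly when d = n / gcd(s, n) divides t.
    The forests obtained consist of gcd(s, n) paths with d vertices each, and
    each edge contributes one to the degree, so that all generators have degree
    n - gcd(s, n) ([generated_uniform_weight]). *)

(** * Algebraic identities *)

(** The equation is the Leibniz rule for f * f^-1 = 1, with a and b the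
    derivatives of f and f^-1. *)
Lemma quotient_rule_inv (F : fieldType) (f a b : F) :
  f != 0 -> a / f + f * b = 0 -> b = - (a / f ^+ 2).
Proof.
move=> f0 e; apply: (mulfI f0); apply: (addrI (a / f)); rewrite e.
by field.
Qed.

(** For f = p / q: derivations which commute on p and q commute on f, since
    both second derivatives of f are determined by those of f * q = p. *)
Lemma derivations_commute (F : fieldType) (d e : F -> F) (f p q : F) :
  {morph d : u v / u + v} -> {morph e : u v / u + v} ->
  (forall u v, d (u * v) = d u * v + u * d v) ->
  (forall u v, e (u * v) = e u * v + u * e v) ->
  q != 0 -> f * q = p -> d (e p) = e (d p) -> d (e q) = e (d q) ->
  d (e f) = e (d f).
Proof.
move=> dD eD dM eM q0 <- + deq; rewrite dM eM dD eD !dM !eM deq => h.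
apply: (mulIf q0); apply: (addIr (d f * e q + (e f * d q + f * e (d q)))).
by apply: etrans (etrans _ h) _; ring.
Qed.

(** Curvature of a connection whose coefficients v and w depend on separate
    variables. *)
Lemma twisted_derivations_commute (F : comPzRingType) (d e : F -> F) (f v w : F) :
  {morph d : x y / x + y} -> {morph e : x y / x + y} ->
  (forall x y, d (x * y) = d x * y + x * d y) ->
  (forall x y, e (x * y) = e x * y + x * e y) ->
  d v = 0 -> e w = 0 -> d (e f) = e (d f) ->
  d (e f + v * f) + w * (e f + v * f) = e (d f + w * f) + v * (d f + w * f).
Proof. by move=> dD eD dM eM dv ew def; rewrite dD eD dM eM dv ew def; ring. Qed.

(** Subtracting a coboundary and the lifted cokernel classes from a form, and
    collecting what remains in a new first summand. *)
Lemma regroup (V : zmodType) (p v s q t : V) :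
  p + (q + t) = p - v - s + (s + t) + (v + q).
Proof.
have -> : p - v - s + (s + t) = p - v + t by rewrite addrA subrK.
by rewrite -[RHS]addrA [t + _]addrCA [RHS]addrA subrK [t + q]addrC.
Qed.

Lemma log_derivative_sym (F : fieldType) (p q g : F) : - (p / g) * q = - (q / g) * p.
Proof. by ring. Qed.

Lemma oneform_connection_change (A : pzRingType) (u w1 w2 d v : A) :
  u * w1 = u * w2 -> (- u) * (d + w1 * v) = - (u * (d + w2 * v)).
Proof. by move=> e; rewrite mulNr !mulrDr !mulrA e. Qed.

Lemma derivation_exprz (F : fieldType) (d : F -> F) (x : F) (m : int) :
  (forall u v, d (u * v) = d u * v + u * d v) -> x != 0 ->
  d (x ^ m) = m%:~R / x * d x * x ^ m.
Proof.
move=> dM x0.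
have d1 : d 1 = 0 by apply: (addrI (d 1)); rewrite addr0 -[RHS](congr1 d (mulr1 1)) dM mulr1 mul1r.
have dX (p : nat) : d (x ^+ p) = p%:R / x * d x * x ^+ p.
  elim: p => [|p ih]; first by rewrite d1 !mul0r.
  by rewrite exprS dM ih -natr1; field.
case: m => p; first by rewrite -!exprnP dX.
rewrite NegzE -!exprnN mulrNz.
have y0 : x ^+ p.+1 != 0 by rewrite expf_neq0.
have := dM (x ^+ p.+1) (x ^- p.+1); rewrite divff // d1 dX => /esym e.
apply: (mulfI y0); apply: (addrI (p.+1%:R / x * d x * x ^+ p.+1 / x ^+ p.+1)); rewrite e.
by move: (x ^+ p.+1) y0 => y y0; field; apply/andP.
Qed.

Lemma gauge_derivation (A : comPzRingType) (g h w f df : A) :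
  h * g * f + g * df + w * (g * f) = g * (df + (w + h) * f).
Proof. by ring. Qed.

(** With p = z_j, q = z_k, x = dz_j and y = dz_k, this is
    omega_{j,k} - omega_k = z_j (z_j - z_k)^-1 (omega_j - omega_k). *)
Lemma dlog_difference (F : fieldType) (V : lmodType F) (p q : F) (x y : V) :
  p != 0 -> q != 0 -> p - q != 0 ->
  (p - q)^-1 *: (x - y) - q^-1 *: y = p *: ((p - q)^-1 *: (p^-1 *: x - q^-1 *: y)).
Proof.
move=> p0 q0 pq; rewrite !scalerBr !scalerA -addrA -opprD -scalerDl.
by congr (_ *: _ - _ *: _); field; rewrite ?p0 ?q0 ?pq.
Qed.

(** Adding the coefficient of x j to that of x k changes a linear combination
    by a multiple of x j - x k only; with the weights as coefficients of the
    logarithmic forms, this is why weights can be moved along an edge. *)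
Lemma sum_move_coefficient (F : pzRingType) (V : lmodType F) (J : finType)
    (c c' : J -> F) (x : J -> V) (j k : J) : j != k ->
  c' j = 0 -> c' k = c k + c j -> (forall i, i != j -> i != k -> c' i = c i) ->
  \sum_i c i *: x i = \sum_i c' i *: x i + c j *: (x j - x k).
Proof.
move=> jk cj ck ci; have kj : k != j by rewrite eq_sym.
rewrite (bigD1 j) // [X in _ = X + _](bigD1 j) //= cj scale0r add0r.
rewrite (bigD1 k) // [X in _ = X + _](bigD1 k) //= ck.
rewrite (eq_bigr (fun i => c' i *: x i)) => [|i /andP[ij ik]]; last by rewrite ci.
rewrite scalerDl scalerBr; move: (\sum_(_ | _) _) => s.
have -> : c k *: x k + c j *: x k + s = c j *: x k + (c k *: x k + s).
  by rewrite addrA [c j *: _ + _]addrC.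
by rewrite [RHS]addrC [RHS]addrA subrK.
Qed.

Lemma square_zero_absorb (F : pzRingType) (A : algType F) (c e : F) (w v : A) :
  v * v = 0 -> (c *: v) * (w + e *: v) = (c *: v) * w.
Proof.
move=> v2; rewrite mulrDr; have -> : c *: v * (e *: v) = 0; last by rewrite addr0.
by rewrite -scalerAl -scalerAr v2 !scaler0.
Qed.

Lemma mul0_add_mul0 (A : pzRingType) (u v : A) : 0 * u + v * 0 = 0.
Proof. by rewrite mul0r mulr0 addr0. Qed.

Lemma mul0_add (A : pzRingType) (u v : A) : 0 * u + v = v.
Proof. by rewrite mul0r add0r. Qed.

Lemma mulr_swap (A : pzRingType) (u v w p : A) : u * v = p * u -> u * (v * w) = p * (u * w).
Proof. by move=> e; rewrite !mulrA e. Qed.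

Lemma joining_split (F : pzRingType) (W : lmodType F) (p : F) (x y w : W) :
  p *: (x - y) - w = - (p *: y) - w + p *: x.
Proof. by rewrite scalerBr addrAC [RHS]addrC addrA addrAC. Qed.

(** The factors need not commute: F' j is the first factor different from 1,
    so it comes out on the left. *)
Lemma prod_ord_first (A : pzRingType) (n : nat) (F F' : 'I_n -> A) (j : 'I_n) :
  (forall i : 'I_n, (i < j)%N -> F' i = 1) -> (forall i : 'I_n, (i <= j)%N -> F i = 1) ->
  (forall i : 'I_n, (j < i)%N -> F' i = F i) ->
  \prod_i F' i = F' j * \prod_i F i.
Proof.
move=> F'1 F1 F'F.
pose G (H : 'I_n -> A) m := oapp H 1 (insub m).
have GE H : \prod_i H i = \prod_(0 <= m < n) G H m.
  by rewrite big_mkord; apply: eq_bigr => i _; rewrite /G valK.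
have Gsmall H m : (forall i : 'I_n, (i < m)%N -> H i = 1) -> \prod_(0 <= l < m) G H l = 1.
  move=> h; rewrite big_nat big1 // => l lm; rewrite /G.
  by case: insubP => //= i _ il; apply: h; rewrite il.
rewrite !GE (big_cat_nat (n := j)) //=; last exact: ltnW.
rewrite Gsmall // mul1r big_ltn // {1}/G valK /=; congr (_ * _).
rewrite [RHS](big_cat_nat (n := j.+1)) //= Gsmall ?mul1r //.
by apply: eq_big_nat => m /andP[jm _]; rewrite /G; case: insubP => //= i _ im; apply: F'F; rewrite im.
Qed.

Lemma prod_exprz_update (F : fieldType) (J : finType) (x : J -> F) (b b' : J -> int)
    (j : J) (p q : int) (o : option J) :
  (forall i, x i != 0) ->
  (forall i, b' i = b i + (if i == j then p else 0) + (if o == Some i then q else 0)) ->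
  \prod_i x i ^ b' i =
    x j ^ p * (if o is Some k then x k ^ q else 1) * \prod_i x i ^ b i.
Proof.
move=> x0 b'E; rewrite (eq_bigr (fun i => x i ^ b i * x i ^ (if i == j then p else 0)
    * x i ^ (if o == Some i then q else 0))); last first.
  by move=> i _; rewrite b'E !expfzDr.
have one k s : \prod_i x i ^ (if k == i then s else 0) = x k ^ s.
  by rewrite (bigD1 k) //= eqxx big1 ?mulr1 // => i; rewrite eq_sym => /negPf ->.
rewrite !big_split /=.
have -> : \prod_i x i ^ (if i == j then p else 0) = x j ^ p.
  by rewrite -(one j); apply: eq_bigr => i _; rewrite eq_sym.
have -> : \prod_i x i ^ (if o == Some i then q else 0) = if o is Some k then x k ^ q else 1.
  by case: o {b'E} => [k|]; [rewrite -(one k)|rewrite big1].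
by rewrite -mulrA mulrC.
Qed.

Lemma scale_collect (F : fieldType) (A : algType F) (p q r s : F) (v w : A) :
  p *: ((q *: v) * (r *: (s *: w))) = (p * q * r * s) *: (v * w).
Proof. by rewrite [r *: _]scalerA -scalerAl -scalerAr !scalerA mulrA. Qed.

Lemma scale_sign_nat (F : fieldType) (A : algType F) (k r : nat) :
  (-1) ^+ k * r%:R = ((-1) ^+ k * r%:R) *: 1 :> A.
Proof. by rewrite -[RHS]/(in_alg A _) rmorphM rmorph_sign rmorph_nat. Qed.

Lemma scale_connection (F : fieldType) (A : algType F) (c : F) (w d u : A) :
  c *: d + w * (c *: u) = c *: (d + w * u).
Proof. by rewrite -scalerAr scalerDr. Qed.

Lemma rescale_product (F : fieldType) (A : algType F) (c d : F) (w v : A) :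
  c * d = 1 -> w * v = (c *: w) * (d *: v).
Proof. by move=> cd; rewrite -scalerAl -scalerAr scalerA cd scale1r. Qed.

Lemma scale_scaleC (F : fieldType) (V : lmodType F) (c d : F) (v : V) :
  c *: (d *: v) = d *: (c *: v).
Proof. by rewrite !scalerA mulrC. Qed.

(** * Partial fractions and residues *)

Section Subfield.
Variables (F : fieldType) (S : divringClosed F).

(** The constants of a derivation form a field, over which the functions on a
    fibre are to be seen as rational functions of one variable. *)
Record subfield_of := Subfield { subfield_val :> F; _ : subfield_val \in S }.
HB.instance Definition _ := [isSub for subfield_val].
HB.instance Definition _ := [Choice of subfield_of by <:].
HB.instance Definition _ := [SubChoice_isSubUnitRing of subfield_of by <:].
HB.instance Definition _ := [SubNzRing_isSubComNzRing of subfield_of by <:].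
HB.instance Definition _ := [SubComUnitRing_isSubIntegralDomain of subfield_of by <:].
HB.instance Definition _ := [SubIntegralDomain_isSubField of subfield_of by <:].

End Subfield.

Section RationalFunctions.
Variables (K F : fieldType) (iota : {rmorphism K -> F}) (x : F) (d : F -> F).
Hypothesis char0 : forall m, m.+1%:R != 0 :> K.
Hypothesis dD : {morph d : u v / u + v}.
Hypothesis dM : forall u v, d (u * v) = d u * v + u * d v.
Hypothesis d_iota : forall c, d (iota c) = 0.
Hypothesis dx : d x = 1.

(** F is a differential field with d x = 1, and K a field of constants of d.
    This forces x to be transcendental over K, so that elements of F of the
    form P(x) / Q(x) behave as rational functions. *)
Definition ev (P : {poly K}) : F := (map_poly iota P).[x].

Lemma evM P Q : ev (P * Q) = ev P * ev Q.
Proof. by rewrite /ev rmorphM hornerM. Qed.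

Lemma evD P Q : ev (P + Q) = ev P + ev Q.
Proof. by rewrite /ev rmorphD hornerD. Qed.

Lemma evB P Q : ev (P - Q) = ev P - ev Q.
Proof. by rewrite /ev rmorphB hornerD hornerN. Qed.

Lemma evC c : ev c%:P = iota c.
Proof. by rewrite /ev map_polyC hornerC. Qed.

Lemma evX : ev 'X = x.
Proof. by rewrite /ev map_polyX hornerX. Qed.

Lemma ev0 : ev 0 = 0.
Proof. by rewrite /ev rmorph0 horner0. Qed.

Lemma ev1 : ev 1 = 1.
Proof. by rewrite /ev rmorph1 hornerC. Qed.

Lemma d0 : d 0 = 0.
Proof. by rewrite -(rmorph0 iota) d_iota rmorph0. Qed.

Lemma ev_deriv P : d (ev P) = ev P^`().
Proof.
elim/poly_ind: P => [|P c ih].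
  by rewrite deriv0 ev0 d0.
rewrite evD evM evX evC dD dM dx d_iota ih addr0 mulr1.
by rewrite derivD derivM derivX derivC mulr1 addr0 evD evM evX.
Qed.

(** A polynomial relation satisfied by x can be differentiated, because
    d x = 1, and in characteristic 0 this lowers the degree until a constant
    remains. *)
Lemma ev_eq0 P : (ev P == 0) = (P == 0).
Proof.
apply/eqP/eqP => [|->]; last exact: ev0.
have [m] := ubnP (size P); elim: m P => // m ih P ltPm evP.
have P'0 : P^`() = 0.
  have [->|P0] := eqVneq P 0; first by rewrite deriv0.
  apply: (ih _ (leq_trans (lt_size_deriv P0) ltPm)).
  by rewrite -ev_deriv evP d0.
have PC : P = (P`_0)%:P.
  apply/polyP => -[|i]; rewrite coefC //=.
  have /eqP := congr1 (fun q : {poly K} => q`_i) P'0.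
  rewrite coef_deriv coef0 -mulr_natr mulf_eq0 (negPf (char0 i)) orbF.
  by move/eqP.
by move: evP; rewrite PC evC => /eqP; rewrite fmorph_eq0 => /eqP ->.
Qed.

Lemma ev_inj : injective ev.
Proof. by move=> P Q /eqP; rewrite -subr_eq0 -evB ev_eq0 subr_eq0 => /eqP. Qed.

Definition rational f := exists P Q, [/\ Q != 0, coprimep P Q & f * ev Q = ev P].

Lemma rationalP f P Q : Q != 0 -> f * ev Q = ev P -> rational f.
Proof.
move=> Q0 e; exists (P %/ gcdp P Q), (Q %/ gcdp P Q).
have g0 : gcdp P Q != 0 by rewrite gcdp_eq0 (negPf Q0) andbF.
split.
- by rewrite dvdp_div_eq0 // dvdp_gcdr.
- by rewrite coprimep_div_gcd // Q0 orbT.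
apply: (mulIf (_ : ev (gcdp P Q) != 0)); first by rewrite ev_eq0.
by rewrite -mulrA -!evM !divpK ?dvdp_gcdl ?dvdp_gcdr.
Qed.

(** The hypothesis is the equation f' + (U / V) f = N / ((X - p) H) for
    f = P / Q, cleared of denominators.  If f has a pole of order m > 0 at p,
    the left side has one of order m + 1 > 1, whereas the right side has at
    most a simple pole; if f has no pole, neither side has one.  So the
    residue, which is N(p) up to a nonzero factor, vanishes. *)
Lemma residue_poly (p : K) (P Q U V H N : {poly K}) :
  coprimep P Q -> Q != 0 -> H.[p] != 0 -> V.[p] != 0 ->
  V * ('X - p%:P) * H * (P^`() * Q - P * Q^`()) + U * ('X - p%:P) * H * P * Q
    = V * Q ^+ 2 * N ->
  N.[p] = 0.
Proof.
move=> cPQ Q0 Hp Vp e.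
have [m [Q1]] := multiplicity_XsubC Q p.
rewrite Q0 /= rootE => Q1p eQ.
(* Q(p) is not 0 when the multiplicity m vanishes: evaluation at p suffices. *)
case: m eQ => [|m] eQ.
  move: e => /(congr1 (horner^~ p)) /eqP.
  rewrite !(hornerD, hornerM, hornerN, hornerX, hornerC, horner_exp).
  rewrite subrr !(mulr0, mul0r) addr0 eq_sym !mulf_eq0 (negPf Vp) /=.
  have -> : (Q.[p] == 0) = false by apply/negbTE; rewrite eQ expr0 mulr1.
  by move=> /eqP.
have Pp : P.[p] != 0.
  apply/negP => rP; move: (coprimep_root cPQ rP).
  by rewrite eQ hornerM horner_exp hornerD hornerN hornerX hornerC subrr expr0n mulr0 eqxx.
suff /(congr1 (horner^~ p)) /eqP : V * H * (P^`() * ('X - p%:P) * Q1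
      - P * (m.+1%:R * Q1 + ('X - p%:P) * Q1^`())) + U * ('X - p%:P) * H * P * Q1
    = V * ('X - p%:P) ^+ m.+1 * Q1 ^+ 2 * N.
  rewrite !(hornerD, hornerM, hornerN, hornerX, hornerC, horner_exp).
  rewrite subrr expr0n !(mulr0, mul0r, addr0, add0r) !(mulrN, oppr_eq0) !mulf_eq0.
  by rewrite -polyC_natr hornerC (negPf Vp) (negPf Hp) (negPf Pp) (negPf Q1p) (negPf (char0 m)).
(* Otherwise the relation is divisible by (X - p)^(m + 1), and the quotient
   takes a nonzero value at p. *)
apply: (mulIf (_ : ('X - p%:P) ^+ m.+1 != 0)).
  by rewrite expf_neq0 // polyXsubC_eq0.
have dQ : Q^`() = ('X - p%:P) ^+ m * (m.+1%:R * Q1 + ('X - p%:P) * Q1^`()).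
  rewrite eQ derivM deriv_exp derivXsubC mul1r /= exprS -mulr_natl; ring.
move: e; rewrite dQ eQ !exprS.
move: (('X - p%:P) ^+ m) (m.+1%:R : {poly K}) ('X - p%:P) P^`() Q1^`() => Y c X P' Q1' e.
by apply: etrans (etrans _ e) _; ring.
Qed.

Lemma ev_derivation_quotient f P Q :
  f * ev Q = ev P -> d f * ev Q ^+ 2 = ev (P^`() * Q - P * Q^`()).
Proof.
move=> e; have := congr1 d e; rewrite dM !ev_deriv evB !evM -e => <-.
ring.
Qed.

(** Independence of simple poles modulo the image of the operator
    d + U / V, at places where U / V has no pole. *)
Lemma simple_pole_free (I : finType) (A : {set I}) (p : I -> K) (c : I -> K)
    (U V : {poly K}) f :
  {in A &, injective p} -> {in A, forall k, V.[p k] != 0} -> rational f ->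
  d f + ev U / ev V * f = \sum_(k in A) iota (c k) / (x - iota (p k)) ->
  {in A, forall k, c k = 0}.
Proof.
move=> p_inj Vp [P [Q [Q0 cPQ fE]]] e k kA.
have V0 : V != 0 by apply: contraNneq (Vp k kA) => ->; rewrite horner0.
(* N / ((X - p k) H) is the sum of the simple poles over a common
   denominator, and N takes the value c k * H (p k) at p k. *)
pose H := \prod_(l in A :\ k) ('X - (p l)%:P).
pose N := (c k)%:P * H + ('X - (p k)%:P) *
   \sum_(l in A :\ k) (c l)%:P * \prod_(m in A :\ k :\ l) ('X - (p m)%:P).
have Hpk : H.[p k] != 0.
  rewrite /H horner_prod; apply/prodf_neq0 => l; rewrite inE => /andP[].
  rewrite inE => lk lA; rewrite hornerXsubC subr_eq0.
  by apply: contra_neq lk => /p_inj ->.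
suff : N.[p k] = 0.
  rewrite /N !(hornerD, hornerM, hornerN, hornerX, hornerC) subrr mul0r addr0.
  by move=> /eqP; rewrite mulf_eq0 (negPf Hpk) orbF => /eqP.
apply: (residue_poly (U := U) cPQ Q0 Hpk (Vp k kA)).
apply: ev_inj.
have xp l : ev ('X - (p l)%:P) = x - iota (p l) by rewrite evB evX evC.
have xp0 l : x - iota (p l) != 0 by rewrite -xp ev_eq0 polyXsubC_eq0.
have evprod (B : {set I}) : ev (\prod_(l in B) ('X - (p l)%:P)) = \prod_(l in B) (x - iota (p l)).
  by rewrite (big_morph ev evM ev1); apply: eq_bigr.
have evV0 : ev V != 0 by rewrite ev_eq0.
have evH : (x - iota (p k)) * ev H = \prod_(l in A) (x - iota (p l)).
  by rewrite evprod [RHS](big_setD1 k kA).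
have evN : ev N = \prod_(l in A) (x - iota (p l)) * (d f + ev U / ev V * f).
  rewrite e [X in _ = _ * X](big_setD1 k kA) /= mulrDr -evH /N evD !evM evC xp.
  congr (_ + _); first by rewrite [RHS]mulrC -mulrA mulKf.
  rewrite -mulrA; congr (_ * _).
  rewrite (big_morph ev evD ev0) mulr_sumr.
  apply: eq_bigr => l lA; rewrite evM evC evprod.
  have -> : ev H = (x - iota (p l)) * \prod_(m in A :\ k :\ l) (x - iota (p m)).
    by rewrite evprod (big_setD1 l lA).
  by rewrite [RHS]mulrC -mulrA mulKf.
rewrite evD !evM -(ev_derivation_quotient fE) -!fE xp evN -evH.
move: (ev V) evV0 => v v0; field; exact: v0.
Qed.

Lemma exact_pole_free (I : finType) (A : {set I}) (p : I -> K) (c : I -> K) f :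
  {in A &, injective p} -> rational f ->
  d f = \sum_(k in A) iota (c k) / (x - iota (p k)) ->
  {in A, forall k, c k = 0}.
Proof.
move=> p_inj rf e.
apply: (simple_pole_free (U := 0) (V := 1) (f := f) p_inj) => // [k _|].
  by rewrite hornerC oner_neq0.
by rewrite ev0 !mul0r addr0.
Qed.

(** The solution would be a multiple of x ^ (- alpha).  Concretely, if f has
    order m - n at 0, the leading coefficient of x f' + alpha f there is
    alpha + m - n times that of f. *)
Lemma no_rational_exponential (alpha : K) f :
  (forall m n : nat, alpha + m%:R - n%:R != 0) -> rational f ->
  d f + iota alpha / x * f = 0 -> f = 0.
Proof.
move=> alphaP [P [Q [Q0 _ fE]]] e.
have x0 : x != 0 by rewrite -evX ev_eq0 polyX_eq0.
have evQ0 : ev Q != 0 by rewrite ev_eq0.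
apply/eqP; apply: contraT => f0.
have P0 : P != 0 by rewrite -ev_eq0 -fE mulf_neq0.
have eP : 'X * (P^`() * Q - P * Q^`()) + alpha%:P * P * Q = 0.
  apply: ev_inj; rewrite ev0 evD !evM evC evX -(ev_derivation_quotient fE) -fE.
  transitivity (x * ev Q ^+ 2 * (d f + iota alpha / x * f)); last by rewrite e mulr0.
  by field.
have [m [P1]] := multiplicity_XsubC P 0; rewrite P0 rootE subr0 /= => P10 EP.
have [n [Q1]] := multiplicity_XsubC Q 0; rewrite Q0 rootE subr0 /= => Q10 EQ.
have dX k (S : {poly K}) : 'X * (S * 'X^k)^`() = (k%:R * S + 'X * S^`()) * 'X^k.
  rewrite derivM derivXn; case: k => [|k]; first by rewrite mulr0n; ring.
  by rewrite /= exprS -mulr_natl; ring.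
have : 'X^m * 'X^n * ((alpha%:P + m%:R - n%:R) * P1 * Q1
    + 'X * (P1^`() * Q1 - P1 * Q1^`())) = 0.
  rewrite -[RHS]eP.
  have -> : 'X * (P^`() * Q - P * Q^`()) = 'X * P^`() * Q - P * ('X * Q^`()) by ring.
  rewrite [in 'X * P^`()]EP [in 'X * Q^`()]EQ !dX EP EQ.
  by move: 'X^m 'X^n => Xm Xn; ring.
move/eqP; rewrite !mulf_eq0 !expf_eq0 polyX_eq0 !andbF /= => /eqP.
move/(congr1 (horner^~ 0))/eqP.
rewrite !(hornerD, hornerM, hornerN, hornerX, hornerC) mul0r addr0.
rewrite -!polyC_natr !hornerC !mulf_eq0 (negPf P10) (negPf Q10) !orbF.
by rewrite (negPf (alphaP m n)).
Qed.

Lemma rationalC c : rational (iota c).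
Proof.
by apply: (@rationalP _ c%:P 1); rewrite ?oner_eq0 // ev1 mulr1 evC.
Qed.

Lemma rationalX : rational x.
Proof. by apply: (@rationalP _ 'X 1); rewrite ?oner_eq0 // ev1 mulr1 evX. Qed.

Lemma rationalD f g : rational f -> rational g -> rational (f + g).
Proof.
move=> [P [Q [Q0 _ fE]]] [P1 [Q1 [Q10 _ gE]]].
apply: (@rationalP _ (P * Q1 + P1 * Q) (Q * Q1)); first by rewrite mulf_neq0.
by rewrite evD !evM -fE -gE; ring.
Qed.

Lemma rationalM f g : rational f -> rational g -> rational (f * g).
Proof.
move=> [P [Q [Q0 _ fE]]] [P1 [Q1 [Q10 _ gE]]].
apply: (@rationalP _ (P * P1) (Q * Q1)); first by rewrite mulf_neq0.
by rewrite !evM -fE -gE; ring.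
Qed.

Lemma rationalV f : rational f -> rational f^-1.
Proof.
move=> rf; have [->|f0] := eqVneq f 0; first by rewrite invr0 -(rmorph0 iota); exact: rationalC.
case: rf => P [Q [Q0 _ fE]].
apply: (@rationalP _ Q P); last by rewrite -fE mulKf.
by rewrite -ev_eq0 -fE mulf_neq0 // ev_eq0.
Qed.

Lemma derivX u m : d (u ^+ m.+1) = m.+1%:R * u ^+ m * d u.
Proof.
elim: m => [|m ih]; first by rewrite !expr1 expr0 !mul1r.
by rewrite exprS dM ih [u ^+ m.+1]exprS -[m.+2%:R]natr1; ring.
Qed.

Lemma deriv1 : d 1 = 0. Proof. by rewrite -(rmorph1 iota) d_iota. Qed.

Lemma derivN u : d (- u) = - d u.
Proof. by apply: (addrI (d u)); rewrite -dD !subrr d0. Qed.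

(** The coefficients are now restricted to a subring R0 of K, the ring of the
    base, in which the differences of the punctures p k are invertible. *)
Variables (R0 : subringClosed K) (I : finType) (A : {set I}) (p : I -> K).
Hypothesis p_R0 : {in A, forall k, p k \in R0}.
Hypothesis p_inj : {in A &, injective p}.
Hypothesis pBV_R0 : {in A &, forall k l, (p k - p l)^-1 \in R0}.
Hypothesis natV_R0 : forall m, m.+1%:R^-1 \in R0.

Definition pole k := (x - iota (p k))^-1.

(** The span over R0 of the powers of x and of the negative powers of the
    x - p k. *)
Inductive partial_fraction : F -> Prop :=
| pfrac_X m : partial_fraction (x ^+ m)
| pfrac_pole k m : k \in A -> partial_fraction (pole k ^+ m.+1)
| pfrac_add f g : partial_fraction f -> partial_fraction g -> partial_fraction (f + g)
| pfrac_scale c f : c \in R0 -> partial_fraction f -> partial_fraction (iota c * f).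

Lemma subX_neq0 c : x - iota c != 0.
Proof. by rewrite -evX -evC -evB ev_eq0 polyXsubC_eq0. Qed.

Lemma X_pole k : x * pole k = 1 + iota (p k) * pole k.
Proof. by have h := subX_neq0 (p k); rewrite /pole; field. Qed.

(** Resolving a product of two different poles is the step of the partial
    fraction decomposition in which p k - p l has to be invertible in R0. *)
Lemma pole_pole k l : p k != p l ->
  pole k * pole l = iota (p k - p l)^-1 * (pole k - pole l).
Proof.
rewrite -subr_eq0 -(fmorph_eq0 iota) rmorphB /pole fmorphV rmorphB => h.
by have := subX_neq0 (p k); have := subX_neq0 (p l) => h1 h2; field; apply/and3P.
Qed.

Lemma d_pole k m : d (pole k ^+ m.+1) = - (iota m.+1%:R * pole k ^+ m.+2).
Proof.
have dp : d (pole k) = - pole k ^+ 2.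
  have h := subX_neq0 (p k).
  have := congr1 d (divff h); rewrite dM dD derivN d_iota dx deriv1 subr0 mul1r.
  move=> /eqP; rewrite addr_eq0 => /eqP e; apply: (mulfI h).
  by rewrite -[LHS]opprK -e /pole; field.
by rewrite derivX dp rmorph_nat [pole k ^+ m.+2]exprS [pole k ^+ m.+1]exprS expr2; ring.
Qed.

Lemma pfrac0 : partial_fraction 0.
Proof. by rewrite -(mul0r (x ^+ 0)) -(rmorph0 iota); apply/pfrac_scale/pfrac_X/rpred0. Qed.

Lemma pfrac_opp f : partial_fraction f -> partial_fraction (- f).
Proof.
by move=> h; rewrite -mulN1r -(rmorphN1 iota); apply: pfrac_scale => //; rewrite rpredN rpred1.
Qed.

Lemma pfrac_sub f g : partial_fraction f -> partial_fraction g -> partial_fraction (f - g).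
Proof. by move=> hf hg; apply/pfrac_add/pfrac_opp. Qed.

Lemma pfracXM f : partial_fraction f -> partial_fraction (x * f).
Proof.
elim=> {f} [m|k m kA|f g _ hf _ hg|c f c0 _ hf].
- by rewrite -exprS; exact: pfrac_X.
- rewrite exprS mulrA X_pole mulrDl mul1r -mulrA -exprS.
  apply: pfrac_add; last exact/pfrac_scale/pfrac_pole/kA/p_R0.
  by case: m => [|m]; [exact: (pfrac_X 0)|exact: pfrac_pole].
- by rewrite mulrDr; exact: pfrac_add.
- by rewrite mulrCA; exact: pfrac_scale.
Qed.

Lemma pfrac_poleM k f : k \in A -> partial_fraction f -> partial_fraction (pole k * f).
Proof.
move=> kA; elim=> {f} [m|l m lA|f g _ hf _ hg|c f c0 _ hf].
- elim: m => [|m ih]; first by rewrite mulr1; exact: (pfrac_pole 0 kA).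
  rewrite exprS mulrA [pole k * x]mulrC X_pole mulrDl mul1r -mulrA.
  by apply/pfrac_add/pfrac_scale => //; [exact: pfrac_X|exact: p_R0].
- have [->|lk] := eqVneq k l; first by rewrite -exprS; exact: pfrac_pole.
  have pkl : p k != p l by apply: contra_neq lk => /p_inj ->.
  elim: m => [|m ih]; first rewrite expr1.
    rewrite pole_pole //; apply: pfrac_scale; first exact: pBV_R0.
    by apply/pfrac_sub; [exact: (pfrac_pole 0 kA)|exact: (pfrac_pole 0 lA)].
  rewrite exprS mulrA pole_pole // -mulrA; apply: pfrac_scale; first exact: pBV_R0.
  by rewrite mulrBl -exprS; apply/pfrac_sub => //; exact: pfrac_pole.
- by rewrite mulrDr; exact: pfrac_add.
- by rewrite mulrCA; exact: pfrac_scale.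
Qed.

(** The class of f in the cokernel of D is an R0-combination of the classes of
    the simple poles in B. *)
Definition reducible (D : F -> F) (B : {set I}) f := exists eta (c : I -> K),
  [/\ partial_fraction eta, forall k, c k \in R0 &
      f = D eta + \sum_(k in B) pole k * iota (c k)].

Section Reducible.
Variables (D : F -> F) (B : {set I}).
Hypothesis DD : {morph D : f g / f + g}.
Hypothesis DZ : forall c f, D (iota c * f) = iota c * D f.

Lemma reducible_add f g : reducible D B f -> reducible D B g -> reducible D B (f + g).
Proof.
move=> [eta [c [he hc ->]]] [eta' [c' [he' hc' ->]]].
exists (eta + eta'), (fun k => c k + c' k); split.
- exact: pfrac_add.
- by move=> k; rewrite rpredD.
- rewrite DD addrACA -big_split /=; congr (_ + _).
  by apply: eq_bigr => k _; rewrite rmorphD mulrDr.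
Qed.

Lemma reducible_scale c f : c \in R0 -> reducible D B f -> reducible D B (iota c * f).
Proof.
move=> c0 [eta [c' [he hc ->]]].
exists (iota c * eta), (fun k => c * c' k); split.
- exact: pfrac_scale.
- by move=> k; rewrite rpredM.
- rewrite DZ mulrDr mulr_sumr; congr (_ + _).
  by apply: eq_bigr => k _; rewrite rmorphM mulrCA.
Qed.

Lemma reducible_opp f : reducible D B f -> reducible D B (- f).
Proof.
by move=> h; rewrite -mulN1r -(rmorphN1 iota); apply: reducible_scale => //; rewrite rpredN rpred1.
Qed.

Lemma reducible_D f : partial_fraction f -> reducible D B (D f).
Proof.
exists f, (fun=> 0); split=> // [k|]; first exact: rpred0.
by rewrite big1 ?addr0 // => k _; rewrite rmorph0 mulr0.
Qed.

Lemma reducible_pole k : k \in B -> reducible D B (pole k).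
Proof.
move=> kB; exists 0, (fun l => (l == k)%:R); split=> [|l|]; first exact: pfrac0.
  exact: rpred_nat.
have := DZ 0 0; rewrite rmorph0 !mul0r => ->.
rewrite add0r (bigD1 k) //= eqxx rmorph1 mulr1.
by rewrite big1 ?addr0 // => l /andP[_ /negPf ->]; rewrite rmorph0 mulr0.
Qed.

Lemma reducible_pfrac f :
  (forall m, reducible D B (x ^+ m)) ->
  (forall k m, k \in A -> reducible D B (pole k ^+ m.+1)) ->
  partial_fraction f -> reducible D B f.
Proof.
move=> hX hp; elim=> {f} // [f g _ hf _ hg|c f c0 _ hf].
  exact: reducible_add.
exact: reducible_scale.
Qed.

End Reducible.

Lemma dZ c f : d (iota c * f) = iota c * d f.
Proof. by rewrite dM d_iota mul0r add0r. Qed.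

Lemma scale_div c f : c != 0 -> f = iota c^-1 * (iota c * f).
Proof. by move=> c0; rewrite fmorphV mulKf // fmorph_eq0. Qed.

(** Every basis element is the derivative of one, up to an invertible integer,
    except the simple poles. *)
Lemma pfrac_primitive f : partial_fraction f -> reducible d A f.
Proof.
apply: reducible_pfrac => [|c g|m|k m kA]; [exact: dD|exact: dZ| |].
  rewrite (_ : x ^+ m = iota m.+1%:R^-1 * d (x ^+ m.+1)).
    by apply: reducible_scale => //; [exact: dZ|exact/reducible_D/pfrac_X].
  rewrite derivX dx mulr1 -(rmorph_nat iota m.+1).
  exact: scale_div.
case: m => [|m]; first by apply: reducible_pole => //; exact: dZ.
rewrite (_ : pole k ^+ m.+2 = iota m.+1%:R^-1 * - d (pole k ^+ m.+1)).
  apply: reducible_scale => //; first exact: dZ.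
  by apply: reducible_opp; [exact: dZ|exact/reducible_D/pfrac_pole].
by rewrite d_pole opprK; exact: scale_div.
Qed.

Section Twisted.
Variables (j : I) (alpha : K).
Hypotheses (jA : j \in A) (pj : p j = 0).
Hypothesis alphaN0 : forall m n : nat, alpha + m%:R - n%:R != 0.
Hypothesis alphaV_R0 : forall m n : nat, (alpha + m%:R - n%:R)^-1 \in R0.
Hypothesis alpha_R0 : alpha \in R0.

Definition twisted_d f := d f + iota alpha / x * f.

Lemma twisted_dD : {morph twisted_d : f g / f + g}.
Proof. by move=> f g; rewrite /twisted_d dD mulrDr addrACA. Qed.

Lemma twisted_dZ c f : twisted_d (iota c * f) = iota c * twisted_d f.
Proof. by rewrite /twisted_d dZ mulrDr mulrCA. Qed.

Lemma pole0 : pole j = x^-1. Proof. by rewrite /pole pj rmorph0 subr0. Qed.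

Lemma X_neq0 : x != 0. Proof. by have := subX_neq0 0; rewrite rmorph0 subr0. Qed.

(** The operator is x ^ (- alpha) d x ^ alpha.  It multiplies the powers of x,
    including the negative ones, by the shifts of alpha, which are invertible:
    this removes the puncture at 0 altogether.  At another puncture, a pole of
    order m + 2 is traded for the product of x^-1 with one of order m + 1,
    which the product formula for poles brings back to lower order. *)
Lemma pfrac_twisted_primitive f : partial_fraction f -> reducible twisted_d (A :\ j) f.
Proof.
have add := reducible_add (B := A :\ j) twisted_dD.
have scale := reducible_scale (B := A :\ j) twisted_dZ.
have opp := reducible_opp (B := A :\ j) twisted_dZ.
have red := reducible_D twisted_d (A :\ j).
have x0 := X_neq0.
have hX m : reducible twisted_d (A :\ j) (x ^+ m).
  rewrite (_ : x ^+ m = iota (alpha + m.+1%:R - 0%:R)^-1 * twisted_d (x ^+ m.+1)).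
    by apply: scale => //; exact/red/pfrac_X.
  rewrite -[RHS]mulr1 [LHS](scale_div _ (alphaN0 m.+1 0)) mulr1; congr (_ * _).
  rewrite /twisted_d derivX dx subr0 rmorphD rmorph_nat mulr1 exprS.
  by field.
have hj m : reducible twisted_d (A :\ j) (pole j ^+ m.+1).
  rewrite (_ : pole j ^+ m.+1 = iota (alpha + 0%:R - m%:R)^-1 * twisted_d (pole j ^+ m)).
    apply: scale => //; apply: red.
    by case: m => [|m]; [exact: (pfrac_X 0)|exact: pfrac_pole].
  rewrite [LHS](scale_div _ (alphaN0 0 m)); congr (_ * _).
  rewrite /twisted_d; case: m => [|m].
    by rewrite !expr0 deriv1 add0r mulr1 expr1 pole0 addr0 subr0.
  by rewrite d_pole addr0 rmorphB pole0 [_ ^+ m.+2]exprS; ring.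
apply: (reducible_pfrac twisted_dD twisted_dZ hX) => k m kA.
have [->|kj] := eqVneq k j; first exact: hj.
have pkj : p j != p k by apply: contra_neq kj => /p_inj ->.
(* The two statements are proved together by induction on the order: each
   needs the other in the preceding order. *)
suff [//] : reducible twisted_d (A :\ j) (pole k ^+ m.+1) /\
            reducible twisted_d (A :\ j) (pole j * pole k ^+ m.+1).
have pk : reducible twisted_d (A :\ j) (pole k).
  by apply: reducible_pole; [exact: twisted_dZ|rewrite !inE kj].
elim: m => [|m [ih1 ih2]].
  rewrite expr1; split=> //; rewrite pole_pole //; apply: scale; first exact: pBV_R0.
  by apply: add; [exact: (hj 0)|exact: opp].
have step : reducible twisted_d (A :\ j) (pole k ^+ m.+2).
  rewrite (_ : pole k ^+ m.+2 = iota m.+1%:R^-1 *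
      (iota alpha * (pole j * pole k ^+ m.+1) - twisted_d (pole k ^+ m.+1))).
    apply: (scale) => //; apply: add; first exact: scale.
    exact/opp/red/pfrac_pole.
  rewrite [LHS](scale_div _ (char0 m)); congr (_ * _).
  by rewrite /twisted_d d_pole pole0; ring.
split=> //; rewrite exprS mulrA pole_pole // -mulrA; apply: scale; first exact: pBV_R0.
by rewrite mulrBl -exprS; apply: add => //; exact: opp.
Qed.

End Twisted.

Lemma pfrac_rational f : partial_fraction f -> rational f.
Proof.
have rX f' m : rational f' -> rational (f' ^+ m).
  move=> h; elim: m => [|m ih]; first by rewrite expr0 -(rmorph1 iota); exact: rationalC.
  by rewrite exprS; exact: rationalM.
elim=> {f} [m|k m kA|f g _ hf _ hg|c f c0 _ hf].
- exact/rX/rationalX.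
- apply/rX/rationalV/rationalD; first exact: rationalX.
  by rewrite -rmorphN; exact: rationalC.
- exact: rationalD.
- by apply: rationalM => //; exact: rationalC.
Qed.

Lemma pfrac_monic_denominator f : partial_fraction f -> exists P Q,
  [/\ P \is a polyOver R0, Q \is a polyOver R0, Q \is monic & f * ev Q = ev P].
Proof.
elim=> {f} [m|k m kA|f g _ [P [Q [hP hQ mQ e]]] _ [P' [Q' [hP' hQ' mQ' e']]]|c f c0 _ [P [Q [hP hQ mQ e]]]].
- exists ('X^m), 1; split; rewrite ?rpred1 ?rpredX ?polyOverX ?monic1 //.
  rewrite ev1 mulr1; elim: m => [|m ih]; first by rewrite ev1.
  by rewrite !exprS evM evX ih.
- exists 1, (('X - (p k)%:P) ^+ m.+1); split.
  + exact: rpred1.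
  + by rewrite rpredX // rpredB ?polyOverX ?polyOverC ?p_R0.
  + by rewrite rpredX // monicXsubC.
  + have -> l : ev (('X - (p k)%:P) ^+ l) = (x - iota (p k)) ^+ l.
      by elim: l => [|l ih]; rewrite ?ev1 // !exprS evM ih evB evX evC.
    by rewrite ev1 -exprMn /pole mulVf ?expr1n ?subX_neq0.
- exists (P * Q' + P' * Q), (Q * Q'); split.
  + by rewrite rpredD ?rpredM.
  + by rewrite rpredM.
  + by rewrite rpredM.
  + by rewrite evD !evM -e -e'; ring.
- exists (c%:P * P), Q; split=> //; first by rewrite rpredM ?polyOverC.
  by rewrite evM evC -e mulrA.
Qed.

(** A regular function of x with a constant value c can be written P / Q with
    P and Q over R0 and Q monic; then c Q = P and c is the leading coefficient
    of P, so that c lies in R0 and not only in K. *)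
Lemma pfrac_constant c : partial_fraction (iota c) -> c \in R0.
Proof.
move=> /pfrac_monic_denominator[P [Q [hP hQ mQ]]].
rewrite -evC -evM => /ev_inj e.
have := polyOverP hP (size Q).-1; rewrite -e coefCM.
by move: mQ; rewrite monicE /lead_coef => /eqP ->; rewrite mulr1.
Qed.

End RationalFunctions.

(** * Generated submodules *)

Section Generation.
Variable A : pzRingType.

(** Representatives of the submodule of the cohomology of D generated by the
    classes of X, the ring of scalars being represented by Z; F is the set of
    cochains.  Stability under scalars is not imposed, because it follows
    when Z is closed under products ([generated_closed_mul]). *)
Inductive generated (Z X F : A -> Prop) (D : A -> A) : A -> Prop :=
| generated_mul c v : Z c -> X v -> generated Z X F D (c * v)
| generated_add u v : generated Z X F D u -> generated Z X F D v -> generated Z X F D (u + v)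
| generated_boundary v : F v -> generated Z X F D (D v).

(** How generators are transported along a map of complexes which is
    semilinear: scalars may be changed on the way, for instance by a sign. *)
Lemma generated_map Z X F D Z' X' F' D' (phi : A -> A) u :
  {morph phi : x y / x + y} ->
  (forall c, Z' c -> exists2 c', Z c' & forall v, phi (c * v) = c' * phi v) ->
  (forall v, X' v -> X (phi v)) ->
  (forall v, F' v -> exists2 w, F w & phi (D' v) = D w) ->
  generated Z' X' F' D' u -> generated Z X F D (phi u).
Proof.
move=> phiD hZ hX hF; elim=> {u} [c v Zc Xv|u v _ hu _ hv|v Fv].
- by have [c' Zc' ->] := hZ c Zc; apply: generated_mul => //; exact: hX.
- by rewrite phiD; exact: generated_add.
- by have [w Fw ->] := hF v Fv; exact: generated_boundary.
Qed.

Lemma generated_closed_mul (Z X F : A -> Prop) (D : A -> A) c u :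
  (forall c', Z c' -> Z (c * c')) -> (forall v, F v -> exists2 w, F w & c * D v = D w) ->
  generated Z X F D u -> generated Z X F D (c * u).
Proof.
move=> hZ hF; elim=> {u} [c' v Zc Xv|u v _ hu _ hv|v Fv].
- by rewrite mulrA; apply: generated_mul => //; exact: hZ.
- by rewrite mulrDr; exact: generated_add.
- by have [w Fw ->] := hF v Fv; exact: generated_boundary.
Qed.

Lemma generated_sum Z X (F : A -> Prop) (D : A -> A) (J : finType) (B : {set J}) (u : J -> A) :
  F 0 -> D 0 = 0 -> (forall k, k \in B -> generated Z X F D (u k)) ->
  generated Z X F D (\sum_(k in B) u k).
Proof.
move=> F0 D0 h; elim/big_ind: _ => [|v w hv hw|k kB]; last exact: h.
- by rewrite -D0; exact: generated_boundary.
- exact: generated_add.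
Qed.

End Generation.

(** * Forests given by a parent function *)

Section ParentFunctions.
Variable n : nat.
Implicit Types (par : 'I_n -> option 'I_n) (i j k l : 'I_n) (a sigma : 'I_n -> rat).

Definition par_edge par : rel 'I_n := fun i j => par i == Some j.

(** A rectified forest without closed roots is the same as a parent function
    [par] with par i > i whenever par i is defined. *)
Definition increasing par := forall i j, par i = Some j -> (i < j)%N.

Section Increasing.
Variable par : 'I_n -> option 'I_n.
Hypothesis par_inc : increasing par.
Local Notation e := (par_edge par).

Definition up i := odflt i (par i).

(** The value of [up] exceeds that of its argument until a root is reached, so
    n steps suffice. *)
Definition root_of i := iter n up i.

Lemma par_root i : par (root_of i) = None.
Proof.
have h m : par (iter m up i) = None \/ (m <= iter m up i)%N.
  elim: m => [|m [h|h]]; first by right.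
    by left; rewrite iterS {1}/up h.
  rewrite iterS {1 3}/up; case E : (par (iter m up i)) => [j|]; last by left.
  by right; exact: leq_ltn_trans h (par_inc E).
by have [//|] := h n; rewrite leqNgt ltn_ord.
Qed.

Lemma root_fix i : par i = None -> root_of i = i.
Proof. by move=> h; apply: iter_fix; rewrite /up h. Qed.

Lemma root_edge i j : e i j -> root_of j = root_of i.
Proof.
move=> /eqP h; have -> : j = up i by rewrite /up h.
by rewrite /root_of -iterSr iterS -/(root_of i) /up par_root.
Qed.

Lemma connect_root i : connect e i (root_of i).
Proof.
suff h m : connect e i (iter m up i) by exact: h.
elim: m => [|m ih] /=; first exact: connect0.
apply: connect_trans ih _; rewrite {2}/up.
case E : (par _) => [j|] /=; last exact: connect0.
by apply: connect1; rewrite /par_edge E.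
Qed.

Lemma connect_same_root i k : connect e i k -> root_of i = root_of k.
Proof.
case/connectP => p; elim: p i => [|l p ih] i /=; first by move=> _ ->.
by case/andP => il lp kE; rewrite -(root_edge il); exact: ih.
Qed.

Lemma connect_leq i k : connect e i k -> (i <= k)%N.
Proof.
case/connectP => p; elim: p i => [|l p ih] i /=; first by move=> _ ->.
case/andP => /eqP il lp kE; apply: leq_trans (ih l lp kE).
exact: ltnW (par_inc il).
Qed.

Lemma connect_to_root k r : par r = None -> connect e k r = (root_of k == r).
Proof.
move=> hr; apply/idP/eqP => [/connect_same_root ->|<-]; first exact: root_fix.
exact: connect_root.
Qed.

(** Two vertices in the same component have the same root, because moving along
    an edge does not change the root. *)
Lemma component_root i : component e i = [set k | root_of k == root_of i].
Proof.
pose f k l := e k l || e l k.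
have fs : connect_sym f by apply: sym_connect_sym => k l; rewrite /f orbC.
have ef k l : connect e k l -> connect f k l.
  by apply: connect_sub => {}k {}l kl; apply: connect1; rewrite /f kl.
apply/setP => k; rewrite !inE; apply/idP/eqP => [/connectP[p]|h].
  elim: p i => [|l p ih] i /=; first by move=> _ ->.
  case/andP => il lp kE; rewrite (ih l lp kE).
  by case/orP: il => /root_edge.
apply: connect_trans (ef _ _ (connect_root i)) _.
by rewrite -h -/f fs; exact/ef/connect_root.
Qed.

Lemma par_directed_tree i : is_directed_tree e (component e i).
Proof.
rewrite component_root; split.
- by apply/set0Pn; exists i; rewrite inE.
- move=> k j _ /eqP kj; apply/negP => /connect_leq.
  by rewrite leqNgt (par_inc kj).
- exists (root_of i); first by rewrite inE (root_fix (par_root i)).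
  move=> k; rewrite inE => /eqP ki; case E : (par k) => [l|].
    have -> : [set j | e k j] = [set l].
      by apply/setP => j; rewrite !inE /par_edge E; apply/eqP/eqP => [[->]|->].
    rewrite cards1; case: eqP => // kr.
    by have := par_root i; rewrite -kr E.
  have -> : [set j | e k j] = set0 by apply/setP => j; rewrite !inE /par_edge E.
  by rewrite cards0 -ki (root_fix E) eqxx.
Qed.

Lemma par_open_root i : i \in [set i | par i == None] -> is_root e i.
Proof. by rewrite inE => /eqP h; apply/forallP => j; rewrite /par_edge h. Qed.

Definition par_forest : forest n := Forest par_directed_tree par_open_root.

Lemma par_forest_closed_roots : closed_roots par_forest = set0.
Proof.
apply/setP => i; rewrite !inE /=; case E : (par i) => [j|] //=.
by apply/negP => /forallP/(_ j); rewrite /par_edge E eqxx.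
Qed.

Lemma connect_below i j : connect e i j = (i == j) || (if par i is Some k then connect e k j else false).
Proof.
apply/idP/orP => [/connectP[[|l p] /=]|[/eqP ->|]]; first by move=> _ ->; left.
- by case/andP => /eqP -> lp ->; right; apply/connectP; exists p.
- exact: connect0.
- case E : (par i) => [k|] // kj; apply: connect_trans (connect1 _) kj.
  by rewrite /par_edge E.
Qed.

(** The recursion, from a vertex to its children, determines the sums of a
    over the vertices below: in the telescoping sum of
    sigma k - sum of sigma over the children of k, over all k below i, every
    vertex below i cancels with its occurrence as a child, except i. *)
Lemma down_sumE a sigma :
  (forall i, sigma i = a i + \sum_(k | par k == Some i) sigma k) ->
  forall i, \sum_(k | connect e k i) a k = sigma i.
Proof.
move=> h i.
transitivity (\sum_(k | connect e k i) sigma k -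
    \sum_(k | connect e k i) \sum_(l | par l == Some k) sigma l).
  by rewrite -sumrB; apply: eq_bigr => k _; rewrite {1}h addrK.
rewrite (exchange_big_dep predT) //=.
rewrite (bigID (pred1 i)) /= (big_pred1 i); last first.
  by move=> k /=; case: eqVneq => [->|]; rewrite ?connect0 ?andbF.
rewrite -addrA [X in _ + (X - _)]big_mkcond -sumrB big1 ?addr0 // => l _.
rewrite connect_below; case E : (par l) => [k|]; last first.
  by rewrite big1 => [|k]; rewrite ?andbF // orbF andbN subr0.
rewrite (eq_bigl (fun k' => (k' == k) && connect e k i)); last first.
  move=> k'; rewrite andbC; case: (eqVneq k' k) => [->|kk']; first by rewrite eqxx.
  by rewrite (_ : _ == _ = false) //; apply: contraNF kk' => /eqP[->].
have [kc|kc] := boolP (connect e k i).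
  rewrite orbT (eq_bigl (pred1 k)) => [|k']; last by rewrite andbT.
  rewrite big_pred1_eq (_ : (l != i)) ?subrr //.
  apply: contraTneq (connect_leq kc) => li; rewrite -ltnNge -li; exact: par_inc.
by rewrite orbF andbN big1 ?subr0 // => k'; rewrite andbF.
Qed.

End Increasing.

Definition cut par i : 'I_n -> option 'I_n := fun k => if k == i then None else par k.

Lemma cut_increasing par i : increasing par -> increasing (cut par i).
Proof. by move=> h k l; rewrite /cut; case: eqP => // _; exact: h. Qed.

(** After deletion of the edge from i, the vertex i is a root, so that its
    component consists of the vertices below it; these are the same with or
    without the edge. *)
Lemma component_delete par i j : increasing par -> par i = Some j ->
  component (delete_edge (par_edge par) i j) i = [set k | connect (par_edge par) k i].
Proof.
move=> inc ij; have inc' : increasing (cut par i) := cut_increasing inc.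
have cuti : cut par i i = None by rewrite /cut eqxx.
transitivity (component (par_edge (cut par i)) i).
  apply/setP => k; rewrite !inE; apply: eq_connect => {}k l.
  have h k' l' : delete_edge (par_edge par) i j k' l' = par_edge (cut par i) k' l'.
    rewrite /delete_edge /par_edge /cut xpair_eqE.
    have [->|_] := eqVneq k' i; last by rewrite andbT.
    rewrite ij; apply: negbTE; rewrite negb_and negbK /= -[Some j == Some l']/(j == l') eq_sym.
    by case: (l' == j).
  by rewrite !h.
rewrite component_root // (root_fix cuti); apply/setP => k; rewrite !inE.
rewrite -(connect_to_root inc' k cuti); apply/idP/idP.
  apply: connect_sub => {}k l kl; apply: connect1.
  by move: kl; rewrite /par_edge /cut; case: (k == i).
case/connectP => p; elim: p k => [|l p ih] k /=; first by move=> _ ->.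
case/andP => kl lp iE; apply: connect_trans (connect1 _) (ih l lp iE).
rewrite /par_edge /cut (_ : (k == i) = false) //; apply/negbTE.
have li : connect (par_edge par) l i by apply/connectP; exists p.
apply: contraTneq (connect_leq inc li) => ki; rewrite -ltnNge.
by apply: inc; rewrite -ki; apply/eqP.
Qed.

(** The parent functions are built by giving a parent to the vertices, or
    making them roots, in decreasing order. *)
Definition attach par j o : 'I_n -> option 'I_n := fun i => if i == j then o else par i.

Definition relabel sigma j (q : rat) : 'I_n -> rat := fun i => if i == j then q else sigma i.

Lemma sum_attach (V : nmodType) par j o (f f' : 'I_n -> V) i : par j = None ->
  (forall l, l != j -> f' l = f l) ->
  \sum_(l | attach par j o l == Some i) f' l =
    (if o == Some i then f' j else 0) + \sum_(l | par l == Some i) f l.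
Proof.
move=> pj ff'; rewrite big_mkcond [X in _ + X]big_mkcond /=.
rewrite (bigD1 j) //= {1}/attach eqxx; congr (_ + _).
rewrite [RHS](bigD1 j) //= pj /= add0r; apply: eq_bigr => l lj.
by rewrite /attach (negPf lj) ff'.
Qed.

(** The invariant of the construction: [par] is the parent function of an
    integral forest without breakable edges, and [sigma] gives the sums of the
    weights below its vertices.  Both integrality conditions are contained in
    [admissible_integral], since a sum below a root is a sum over a tree.  The
    vertices smaller than m have not been treated, so they are isolated and of
    weight 0. *)
Record admissible a par sigma (m : nat) : Prop := Admissible {
  admissible_increasing : increasing par;
  admissible_balance : forall i, sigma i = a i + \sum_(k | par k == Some i) sigma k;
  admissible_integral : forall i, (sigma i \is a Num.int) = (par i == None);
  admissible_trivial : forall i, (i < m)%N -> par i = None /\ sigma i = 0 }.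

Lemma admissible_empty : admissible (fun=> 0) (fun=> None) (fun=> 0) n.
Proof.
by split=> // i; rewrite big1 // addr0.
Qed.

(** For the weights b, in which the weight of j has been moved to its future
    parent, or dropped when it is integral, j is isolated.  Attaching j
    restores the weights a without changing the sums at other vertices, and the
    sum at j is a j because j has no children yet. *)
Lemma admissible_attach a b par sigma j o :
  admissible b par sigma j.+1 -> (forall k, o = Some k -> (j < k)%N) ->
  (a j \is a Num.int) = (o == None) -> (forall i, (i < j)%N -> a i = 0) ->
  (forall i, b i = if i == j then 0 else a i + (if o == Some i then a j else 0)) ->
  admissible a (attach par j o) (relabel sigma j (a j)) j.
Proof.
move=> [inc bal int triv] jo aj a0 bE; have [pj sj] := triv j (ltnSn j).
have no_child i : (i <= j)%N -> \sum_(l | par l == Some i) sigma l = 0.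
  move=> ij; rewrite big1 // => l /eqP li.
  by have [] := triv l (leq_trans (inc _ _ li) (leqW ij)).
have ojj : (o == Some j) = false.
  by apply/negP => /eqP/jo; rewrite ltnn.
split.
- by move=> i k; rewrite /attach; case: eqVneq => [-> /jo|_ /inc].
- move=> i; rewrite (@sum_attach _ par j o sigma _ i) // => [|l lj]; last first.
    by rewrite /relabel (negPf lj).
  rewrite {2}/relabel eqxx addrA /relabel; case: eqVneq => [->|ij].
    by rewrite ojj addr0 no_child // addr0.
  by rewrite {1}bal bE (negPf ij).
- by move=> i; rewrite /relabel /attach; case: eqVneq.
- move=> i ij; rewrite /relabel /attach; case: eqVneq => [iE|_]; first by rewrite iE ltnn in ij.
  by apply: triv; exact: ltnW.
Qed.

(** The exponents b_j of the forms of the statement, with the sums over the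
    vertices below replaced by [sigma]. *)
Definition par_bexp par sigma j : int :=
  - Num.floor (sigma j) + \sum_(i | par i == Some j) Num.ceil (sigma i).

Lemma par_bexp_attach a par sigma m j o q i : admissible a par sigma m -> (j < m)%N ->
  par_bexp (attach par j o) (relabel sigma j q) i =
  par_bexp par sigma i + (if i == j then - Num.floor q else 0)
    + (if o == Some i then Num.ceil q else 0).
Proof.
move=> [_ _ _ triv] jm; have [pj sj] := triv j jm.
rewrite /par_bexp (@sum_attach _ par j o (fun l => Num.ceil (sigma l)) _ i) // => [|l lj]; last first.
  by rewrite /relabel (negPf lj).
rewrite {2}/relabel eqxx /relabel; case: eqVneq => [->|ij].
  by rewrite sj floor0 oppr0 add0r; case: (o == _); ring.
by case: (o == _); ring.
Qed.

Section AdmissibleForest.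
Variables (a : 'I_n -> rat) (par : 'I_n -> option 'I_n) (sigma : 'I_n -> rat).
Hypothesis adm : admissible a par sigma 0.
Local Notation F := (par_forest (admissible_increasing adm)).

Lemma admissible_down_sum i : down_sum a F i = sigma i.
Proof. by rewrite -(down_sumE (admissible_increasing adm) (admissible_balance adm)). Qed.

Lemma admissible_integral_forest : integral_forest a F.
Proof.
move=> i; have inc := admissible_increasing adm.
rewrite /integral_sum /= component_root //; set r := root_of par i.
have pr : par r = None := par_root inc i.
rewrite (eq_bigl (fun k => connect (par_edge par) k r)) => [|k]; last first.
  by rewrite inE connect_to_root.
by rewrite (down_sumE inc (admissible_balance adm)) (admissible_integral adm) pr.
Qed.

Lemma admissible_rectified : rectified F.
Proof. by move=> i j /eqP; exact: admissible_increasing adm _ _. Qed.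

Lemma admissible_unbreakable i j : ~ breakable a F i j.
Proof.
have inc := admissible_increasing adm.
case=> /eqP ij; rewrite /integral_sum /= component_delete // => h _; move: h.
rewrite (eq_bigl (fun k => connect (par_edge par) k i)) => [|k]; last by rewrite inE.
by rewrite (down_sumE inc (admissible_balance adm)) (admissible_integral adm) ij.
Qed.

Lemma admissible_bexp j : bexp a F j = par_bexp par sigma j.
Proof.
rewrite /bexp /par_bexp admissible_down_sum; congr (_ + _).
by apply: eq_bigr => i _; rewrite admissible_down_sum.
Qed.

End AdmissibleForest.

End ParentFunctions.

(** * Integral multiples of a fraction *)

Lemma multiple_integral (s : int) (n t : nat) : (0 < n)%N ->
  (t%:R * (s%:~R / n%:R) \is a @Num.int rat) = (n %/ gcdn `|s| n %| t)%N.
Proof.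
move=> n0; set g := gcdn _ _; have g0 : (0 < g)%N by rewrite gcdn_gt0 n0 orbT.
have nR : n%:R != 0 :> rat by rewrite pnatr_eq0 -lt0n.
have -> : (n %/ g %| t)%N = (n %| t * `|s|)%N.
  have ne : n = (n %/ g * g)%N by rewrite divnK // dvdn_gcdr.
  have se : `|s|%N = (`|s| %/ g * g)%N by rewrite divnK // dvdn_gcdl.
  rewrite [in RHS]ne [in RHS]se mulnA dvdn_pmul2r // Gauss_dvdl //.
  rewrite /coprime -(eqn_pmul2r g0) muln_gcdl mul1n -ne -se.
  by rewrite gcdnC.
apply/idP/idP.
  move=> /intrP[m e].
  have e' : (t%:R * s%:~R : rat) = m%:~R * n%:R by rewrite -e mulrA divfK.
  have {e'} : (t%:Z * s)%R = m * n%:Z :> int.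
    by apply/eqP; rewrite -(eqr_int rat) !rmorphM /= -!pmulrn e'.
  move/(congr1 absz); rewrite !abszM /= => ->.
  exact: dvdn_mull.
have dvd (q : nat) : (n %| q)%N -> (q%:R / n%:R : rat) \is a Num.int.
  by case/dvdnP => k ->; rewrite natrM mulfK // rpred_nat.
move=> /dvd; rewrite natrM -mulrA => h.
rewrite [s]intEsign rmorphM /= rmorph_sign -mulrA mulrCA rpredM // ?rpredX ?rpredN1 //.
Qed.

(** * The function field and its derivations *)

Section TwistedForms.
Variables (R : realType) (n : nat).
Local Notation P := {mpoly R[i][n]}.
Local Notation K := (ratfun R n).
Local Notation E := (dform R n).
Local Notation "p %:F" := (@FracField.tofrac P p).
Local Notation z := (@z R n).
Local Notation dz := (@dz R n).
Local Notation dlog := (@dlog R n).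
Local Notation dlog2 := (@dlog2 R n).
Local Notation pderiv := (@pderiv R n).
Local Notation form_pderiv := (@form_pderiv R n).
Local Notation ext_d := (@ext_d R n).
Local Notation omega := (@omega R n).
Local Notation nabla := (@nabla R n).
Local Notation weight := ('I_n -> rat).

Definition cst (c : R[i]) : K := (c%:MP)%:F.

Lemma cst_is_zmod_morphism : zmod_morphism cst.
Proof. by move=> c d; rewrite /cst mpolyCB tofracB. Qed.

Lemma cst_is_monoid_morphism : monoid_morphism cst.
Proof. by split=> [|c d]; rewrite /cst ?mpolyC1 ?tofrac1 // mpolyCM tofracM. Qed.

HB.instance Definition _ := GRing.isZmodMorphism.Build R[i] K cst cst_is_zmod_morphism.
HB.instance Definition _ := GRing.isMonoidMorphism.Build R[i] K cst cst_is_monoid_morphism.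

Lemma ratr_cst (a : rat) : ratr a = cst (ratr a).
Proof. by rewrite fmorph_rat. Qed.

Lemma natr_neq0 m : m.+1%:R != 0 :> K.
Proof. by rewrite -(rmorph_nat cst) fmorph_eq0 pnatr_eq0. Qed.

Lemma z_neq0 i : z i != 0.
Proof. by rewrite tofrac_eq0 -msize_poly_eq0 msizeX. Qed.

Lemma zB_neq0 i j : i != j -> z i - z j != 0.
Proof. by move=> ij; rewrite -tofracB tofrac_eq0 mpolyXB_neq0. Qed.

Lemma pderiv_tofrac i (p : P) : pderiv i p%:F = (p^`M(i))%:F.
Proof.
have := @frac_derivE _ _ (@mderivM n R[i] i) p%:F p 1 (oner_neq0 _).
rewrite tofrac1 !mulr1 /Defs.pderiv => /(_ erefl) ->.
by rewrite -[1]mpolyC1 mderivC rmorph0 mulr0 subr0.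
Qed.

Opaque Defs.pderiv.

Lemma pderiv_cst i c : pderiv i (cst c) = 0.
Proof. by rewrite /cst pderiv_tofrac mderivC rmorph0. Qed.

Lemma pderiv_z i j : pderiv i (z j) = (i == j)%:R.
Proof.
rewrite /z pderiv_tofrac mderivX mnm1E; case: eqVneq => [->|_].
  by rewrite scale1r (_ : (_ - _)%MM = 0%MM) ?mpolyX0 ?rmorph1 //; apply/mnmP => k; rewrite mnmBE subnn mnm0E.
by rewrite scale0r rmorph0.
Qed.

Lemma pderivV i f : f != 0 -> pderiv i f^-1 = - (pderiv i f / f ^+ 2).
Proof.
move=> f0; apply: (quotient_rule_inv f0).
by rewrite -pderivM divff // pderiv1.
Qed.

(** The derivatives commute on polynomials, hence on their fractions. *)
Lemma pderivC i j f : pderiv i (pderiv j f) = pderiv j (pderiv i f).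
Proof.
have := frac_repr f; have := denom_ratioP (repr f).
move: (\n_(repr f)) (\d_(repr f)) => p q q0 e.
apply: (@derivations_commute K (pderiv i) (pderiv j) f p%:F q%:F).
- exact: pderivD.
- exact: pderivD.
- exact: pderivM.
- exact: pderivM.
- by rewrite tofrac_eq0.
- exact: e.
- by rewrite (pderiv_tofrac j p) (pderiv_tofrac i p) (pderiv_tofrac i) (pderiv_tofrac j) mderiv_comm.
- by rewrite (pderiv_tofrac j q) (pderiv_tofrac i q) (pderiv_tofrac i) (pderiv_tofrac j) mderiv_comm.
Qed.

(** These are the rational functions in the variables other than z_j; only
    the fact that they form a field is needed. *)
Definition constants (j : 'I_n) : {pred K} := fun f => pderiv j f == 0.

Lemma constantsP j f : reflect (pderiv j f = 0) (f \in constants j).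
Proof. exact: eqP. Qed.

Lemma constants_divring j : divring_closed (constants j).
Proof.
split=> [|f g /eqP df /eqP dg|f g /eqP df /eqP dg].
- by apply/constantsP; rewrite pderiv1.
- by apply/constantsP; rewrite raddfB /= df dg subrr.
- apply/constantsP; have [->|g0] := eqVneq g 0; first by rewrite invr0 mulr0 raddf0.
  by rewrite pderivM pderivV // df dg !mul0r oppr0 mulr0 addr0.
Qed.
HB.instance Definition _ j := GRing.isDivringClosed.Build K (constants j) (constants_divring j).

Definition constant_field j := subfield_of (constants j).
HB.instance Definition _ j := GRing.Field.on (constant_field j).

Lemma pderiv_constant j (c : constant_field j) : pderiv j (val c) = 0.
Proof. exact/constantsP/valP. Qed.

(** The ring of T(1,S), by generators, so that for j in S the ring of
    T(1,S \ j) is visibly a subring.  In [regular_zBV] the indices may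
    coincide: the inverse of 0 is 0. *)
Inductive regular_rec (S : {set 'I_n}) : K -> Prop :=
| regular_cst c : regular_rec S (cst c)
| regular_z i : i \in S -> regular_rec S (z i)
| regular_zV i : i \in S -> regular_rec S (z i)^-1
| regular_zBV i j : i \in S -> j \in S -> regular_rec S (z i - z j)^-1
| regular_add f g : regular_rec S f -> regular_rec S g -> regular_rec S (f + g)
| regular_mul f g : regular_rec S f -> regular_rec S g -> regular_rec S (f * g).

Definition regular (S : {set 'I_n}) : {pred K} := fun f => `[< regular_rec S f >].

Lemma regularP S f : reflect (regular_rec S f) (f \in regular S).
Proof. exact: asboolP. Qed.

Lemma regular_subring S : subring_closed (regular S).
Proof.
split=> [|f g /regularP Sf /regularP Sg|f g /regularP Sf /regularP Sg]; apply/regularP.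
- by rewrite -(rmorph1 cst); exact: regular_cst.
- apply: regular_add => //; rewrite -mulN1r; apply: regular_mul => //.
  by rewrite -(rmorphN1 cst); exact: regular_cst.
- exact: regular_mul.
Qed.
HB.instance Definition _ S := GRing.isSubringClosed.Build K (regular S) (regular_subring S).

Lemma regular_fun_tofrac (p : P) : p%:F \in regular [set: 'I_n].
Proof.
elim/mpolyind: p => [|c m p _ _ ih]; first by rewrite rmorph0 rpred0.
rewrite -mul_mpolyC rmorphD rmorphM rpredD // rpredM //.
  by apply/regularP; exact: regular_cst.
rewrite mpolyXE_id rmorph_prod rpred_prod // => i _.
by rewrite rmorphXn rpredX //; apply/regularP/regular_z; rewrite inE.
Qed.

(** On the full set of coordinates the localisation at the product of all z_i
    and z_i - z_j is generated by the inverses of the factors: the inverse of a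
    divisor of the product is the cofactor divided by the product. *)
Lemma regular_funE f : (f \in @regular_fun R n) = (f \in regular [set: 'I_n]).
Proof.
apply/idP/idP.
  move=> /asboolP[p [N ->]]; rewrite rpredM ?regular_fun_tofrac //.
  rewrite -exprVn rpredX // /braid_poly rmorphM rmorph_prod invfM -prodfV.
  rewrite rpredM // ?rpred_prod // => [i _|].
    by apply/regularP/regular_zV; rewrite inE.
  rewrite rmorph_prod -prodfV rpred_prod // => i _.
  rewrite rmorph_prod -prodfV rpred_prod // => j _.
  by rewrite rmorphB; apply/regularP/regular_zBV; rewrite inE.
have tofrac_regular (p : P) : p%:F \in @regular_fun R n.
  by apply/asboolP; exists p, 0%N; rewrite expr0 divr1.
have inv_regular (p q : P) : p * q = @braid_poly R n -> p%:F^-1 \in @regular_fun R n.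
  move=> e; apply/asboolP; exists q, 1%N; rewrite expr1 -e rmorphM invfM mulrCA divff ?mulr1 //.
  by rewrite tofrac_eq0; apply: contraNneq (@braid_poly_neq0 R n) => q0; rewrite -e q0 mulr0.
move=> /regularP; elim=> {f} [c|i _|i _|i j _ _|f g _ ihf _ ihg|f g _ ihf _ ihg].
- exact: tofrac_regular.
- exact: tofrac_regular.
- apply: (inv_regular _ ((\prod_(k < n | k != i) 'X_k) *
    \prod_(i < n) \prod_(j < n | (i < j)%N) ('X_i - 'X_j))).
  by rewrite mulrA /braid_poly [in RHS](bigD1 i).
- wlog ij : i j / (i < j)%N.
    move=> h; have [ij|ji|/val_inj ->] := ltngtP i j; first exact: h.
      by rewrite -opprB invrN rpredN h.
    by rewrite subrr invr0 rpred0.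
  rewrite -tofracB.
  apply: (inv_regular _ ((\prod_(k < n) 'X_k) *
    ((\prod_(l < n | (i < l)%N && (l != j)) ('X_i - 'X_l)) *
    \prod_(k < n | k != i) \prod_(l < n | (k < l)%N) ('X_k - 'X_l)))).
  rewrite /braid_poly mulrCA; congr (_ * _).
  by rewrite [RHS](bigD1 i) //= [X in _ = X * _](bigD1 j) //= mulrA.
- exact: rpredD.
- exact: rpredM.
Qed.

Implicit Types (S T : {set 'I_n}) (i j k : 'I_n) (f g : K).

(** * Functions on the fibre of a coordinate projection *)

Opaque ratfun Defs.z cst.

Lemma regular_cstP S c : cst c \in regular S.
Proof. exact/regularP/regular_cst. Qed.

Lemma regular_ratr S (a : rat) : ratr a \in regular S.
Proof. by rewrite ratr_cst regular_cstP. Qed.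

Lemma regular_zP S i : i \in S -> z i \in regular S.
Proof. by move=> iS; exact/regularP/regular_z. Qed.

Lemma regular_zVP S i : i \in S -> (z i)^-1 \in regular S.
Proof. by move=> iS; exact/regularP/regular_zV. Qed.

Lemma regular_zBVP S i j : i \in S -> j \in S -> (z i - z j)^-1 \in regular S.
Proof. by move=> iS jS; exact/regularP/regular_zBV. Qed.

Lemma regular_zX S i (m : int) : i \in S -> z i ^ m \in regular S.
Proof.
move=> iS; case: m => m; first by rewrite -exprnP rpredX // regular_zP.
by rewrite NegzE -exprnN -exprVn rpredX // regular_zVP.
Qed.

Lemma regularS S T f : S \subset T -> f \in regular S -> f \in regular T.
Proof.
move=> /subsetP ST /regularP; elim=> {f} [c|i iS|i iS|i j iS jS|f g _ hf _ hg|f g _ hf _ hg].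
- exact: regular_cstP.
- exact/regular_zP/ST.
- exact/regular_zVP/ST.
- by apply: regular_zBVP; exact: ST.
- exact: rpredD.
- exact: rpredM.
Qed.

Lemma pderiv_inv_regular S i f : f != 0 -> f^-1 \in regular S ->
  pderiv i f \in regular S -> pderiv i f^-1 \in regular S.
Proof.
by move=> f0 h1 h2; rewrite pderivV // rpredN -exprVn rpredM // rpredX.
Qed.

Lemma regular_pderiv S i f : f \in regular S -> pderiv i f \in regular S.
Proof.
have dz j : pderiv i (z j) \in regular S by rewrite pderiv_z rpred_nat.
move=> /regularP; elim=> {f} [c|j iS|j jS|k j kS jS|f g hf0 hf hg0 hg|f g hf0 hf hg0 hg].
- by rewrite pderiv_cst rpred0.
- exact: dz.
- by apply: pderiv_inv_regular; rewrite ?z_neq0 ?regular_zVP.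
- have [->|kj] := eqVneq k j; first by rewrite subrr invr0 raddf0 rpred0.
  apply: pderiv_inv_regular; [exact: zB_neq0|exact: regular_zBVP|].
  by rewrite raddfB rpredB // dz.
- by rewrite pderivD rpredD.
- by rewrite pderivM rpredD // rpredM //; exact/regularP.
Qed.

Lemma pderiv_notin S i f : i \notin S -> f \in regular S -> pderiv i f = 0.
Proof.
move=> iS /regularP.
have dz j : j \in S -> pderiv i (z j) = 0.
  move=> jS; rewrite pderiv_z (_ : (i == j) = false) ?mulr0n //.
  by apply: contraNF iS => /eqP ->.
elim=> {f} [c|j jS|j jS|k j kS jS|f g _ hf _ hg|f g _ hf _ hg].
- exact: pderiv_cst.
- exact: dz.
- by rewrite pderivV ?z_neq0 // dz // mul0r oppr0.
- have [->|kj] := eqVneq k j; first by rewrite subrr invr0 raddf0.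
  by rewrite pderivV ?zB_neq0 // raddfB /= dz // dz // subrr mul0r oppr0.
- by rewrite pderivD hf hg addr0.
- by rewrite pderivM hf hg mul0r mulr0 addr0.
Qed.

Section Fibre.
Variables (S : {set 'I_n}) (j : 'I_n).
Hypothesis jS : j \in S.
Local Notation S' := (S :\ j).
Local Notation C := (constant_field j).
Local Notation iota := (val : {rmorphism C -> K}).

(** The ring of the base T(1,S \ j) inside the field of constants of the
    derivative along z_j. *)
Definition regular_constants : {pred C} := fun c => val c \in regular S'.

Lemma regular_constants_subring : subring_closed regular_constants.
Proof.
split=> [|u v hu hv|u v hu hv].
- by change (iota 1 \in regular S'); rewrite rmorph1 rpred1.
- by change (iota (u - v) \in regular S'); rewrite rmorphB rpredB.
- by change (iota (u * v) \in regular S'); rewrite rmorphM rpredM.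
Qed.
HB.instance Definition _ := GRing.isSubringClosed.Build C regular_constants
  regular_constants_subring.

Lemma regular_constant f : f \in regular S' -> exists2 c : C, c \in regular_constants & val c = f.
Proof.
move=> hf; have h : f \in constants j.
  by apply/constantsP; apply: (pderiv_notin (S := S')) => //; rewrite !inE eqxx.
by exists (Sub f h); rewrite // unfold_in /= /regular_constants SubK.
Qed.

(** The points removed from the fibre are 0 and the z_k, k in S \ j, so that
    the index j itself is free to stand for 0. *)
Definition puncture (k : 'I_n) : K := if k == j then 0 else z k.

Lemma puncture_constant k : puncture k \in constants j.
Proof.
apply/constantsP; rewrite /puncture; case: eqVneq => [_|kj]; first exact: raddf0.
by rewrite pderiv_z eq_sym (negPf kj).
Qed.

Definition cpuncture k : C := Sub (puncture k) (puncture_constant k).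

Lemma cpunctureE k : val (cpuncture k) = puncture k. Proof. exact: SubK. Qed.

Lemma puncture_inj : {in S &, injective puncture}.
Proof.
move=> k l _ _; rewrite /puncture; case: (eqVneq k j) => [->|kj]; case: (eqVneq l j) => [->|lj] //.
- by move/esym/eqP; rewrite (negPf (z_neq0 _)).
- by move/eqP; rewrite (negPf (z_neq0 _)).
- by move=> e; apply/eqP; apply: contraT => /zB_neq0; rewrite e subrr eqxx.
Qed.

Lemma regular_puncture k : k \in S -> puncture k \in regular S'.
Proof.
move=> kS; rewrite /puncture; case: eqVneq => [_|kj]; first exact: rpred0.
by apply: regular_zP; rewrite !inE kj.
Qed.

Lemma regular_punctureBV : {in S &, forall k l, (puncture k - puncture l)^-1 \in regular S'}.
Proof.
move=> k l kS lS; rewrite /puncture; case: (eqVneq k j) => [_|kj]; case: (eqVneq l j) => [_|lj].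
- by rewrite subrr invr0 rpred0.
- by rewrite sub0r invrN rpredN regular_zVP // !inE lj.
- by rewrite subr0 regular_zVP // !inE kj.
- by rewrite regular_zBVP // !inE ?kj ?lj.
Qed.

Definition polar k : K := (z j - puncture k)^-1.

Lemma regular_polar k : k \in S -> polar k \in regular S.
Proof.
move=> kS; rewrite /polar /puncture; case: eqVneq => [_|kj]; first by rewrite subr0 regular_zVP.
exact: regular_zBVP.
Qed.

(** The component of the connection along z_j, acting on coefficients. *)
Definition fibre_d (a : rat) f : K := pderiv j f + ratr a / z j * f.

Local Notation R0 := (regular_constants : subringClosed C).
Local Notation pfrac := (@partial_fraction C K iota (z j) R0 _ S cpuncture).

Lemma iota_cpuncture k : iota (cpuncture k) = puncture k.
Proof. exact: cpunctureE. Qed.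

Lemma poleE k : pole iota (z j) cpuncture k = polar k.
Proof. by rewrite /pole /polar iota_cpuncture. Qed.

Lemma char0C m : m.+1%:R != 0 :> C.
Proof. by rewrite -(fmorph_eq0 iota) rmorph_nat natr_neq0. Qed.

Lemma pderiv_iota c : pderiv j (iota c) = 0.
Proof. exact: pderiv_constant. Qed.

Lemma pderiv_zz : pderiv j (z j) = 1.
Proof. by rewrite pderiv_z eqxx. Qed.

Lemma cpuncture_inj : {in S &, injective cpuncture}.
Proof.
move=> k l kS lS /(congr1 iota); rewrite !iota_cpuncture; exact: puncture_inj.
Qed.

Lemma cpuncture_R0 : {in S, forall k, cpuncture k \in R0}.
Proof.
by move=> k kS; change (iota (cpuncture k) \in regular S'); rewrite iota_cpuncture regular_puncture.
Qed.

Lemma cpunctureBV_R0 : {in S &, forall k l, (cpuncture k - cpuncture l)^-1 \in R0}.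
Proof.
move=> k l kS lS; change (iota (cpuncture k - cpuncture l)^-1 \in regular S').
by rewrite fmorphV rmorphB !iota_cpuncture regular_punctureBV.
Qed.

Lemma ratr_R0 (a : rat) : ratr a \in R0.
Proof. by change (iota (ratr a) \in regular S'); rewrite fmorph_rat regular_ratr. Qed.

Lemma natV_R0 m : m.+1%:R^-1 \in R0.
Proof.
change (iota m.+1%:R^-1 \in regular S').
by rewrite fmorphV rmorph_nat -(rmorph_nat cst) -fmorphV regular_cstP.
Qed.

(** The partial fractions are stable under multiplication by each generator of
    the ring: z_j and its inverse, the 1/(z_j - z_k), and the generators that do
    not involve z_j, which are scalars. *)
Lemma regular_pfrac f : f \in regular S -> pfrac f.
Proof.
have XM := pfracXM char0C (pderivD j) (pderivM j) pderiv_iota pderiv_zz cpuncture_R0.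
have poleM := pfrac_poleM char0C (pderivD j) (pderivM j) pderiv_iota pderiv_zz
  cpuncture_R0 cpuncture_inj cpunctureBV_R0.
have scale g h : g \in regular S' -> pfrac h -> pfrac (g * h).
  by move=> /regular_constant[c c0 <-] ph; exact: pfrac_scale.
suff stable g h : regular_rec S g -> pfrac h -> pfrac (g * h).
  move=> /regularP hf; rewrite -[f]mulr1 -(expr0 (z j)).
  by apply: stable hf _; exact: pfrac_X.
move=> hg; elim: hg h => {f g} [c|i iS|i iS|i k iS kS|f g _ hf _ hg|f g _ hf _ hg] h ph.
- by apply: scale => //; exact: regular_cstP.
- have [->|ij] := eqVneq i j; first exact: XM.
  by apply: scale => //; rewrite regular_zP // !inE ij.
- have [->|ij] := eqVneq i j; last by apply: scale; rewrite // regular_zVP // !inE ij.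
  have := poleM j h jS ph; rewrite poleE /polar /puncture eqxx subr0; exact.
- have [->|ik] := eqVneq i k; first by rewrite subrr invr0; apply: scale => //; exact: rpred0.
  have pole_k l : l \in S -> l != j -> pfrac ((z j - z l)^-1 * h).
    by move=> lS lj; have := poleM l h lS ph; rewrite poleE /polar /puncture (negPf lj); exact.
  have [ij|ij] := eqVneq i j; first by rewrite ij; apply: pole_k => //; rewrite -ij eq_sym.
  have [kj|kj] := eqVneq k j; last by apply: scale; rewrite // regular_zBVP // !inE ?ij ?kj.
  by rewrite kj -opprB invrN mulNr; apply/pfrac_opp/pole_k.
- by rewrite mulrDl; apply: pfrac_add; [exact: hf|exact: hg].
- by rewrite -mulrA; apply/hf/hg.
Qed.

Lemma pfrac_regular f : pfrac f -> f \in regular S.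
Proof.
elim=> {f} [m|k m kS|f g _ hf _ hg|c f c0 _ hf].
- by rewrite rpredX // regular_zP.
- by rewrite rpredX // poleE regular_polar.
- exact: rpredD.
- apply: rpredM => //; apply: (regularS (subsetDl S [set j])).
  exact: c0.
Qed.

Lemma reducible_fibre D B f : @reducible C K iota (z j) R0 _ S cpuncture D B f ->
  exists eta (c : 'I_n -> K), [/\ eta \in regular S, forall k, c k \in regular S' &
    f = D eta + \sum_(k in B) polar k * c k].
Proof.
move=> [eta [c [he hc ->]]]; exists eta, (fun k => iota (c k)); split.
- exact: pfrac_regular.
- by move=> k; exact: hc.
- by congr (_ + _); apply: eq_bigr => k _; rewrite poleE.
Qed.

(** The punctures that contribute to the cokernel: 0 does so only for the
    trivial connection. *)
Definition poles (a : rat) : {set 'I_n} := if a == 0 then S else S :\ j.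

Lemma fibre_d0 f : fibre_d 0 f = pderiv j f.
Proof. by rewrite /fibre_d [ratr _](ratr_int _ 0) !mul0r addr0. Qed.

Lemma iota_ratr a (m k : nat) : iota (ratr a + m%:R - k%:R) = cst (ratr (a + m%:R - k%:R)).
Proof.
rewrite rmorphB rmorphD fmorph_rat !rmorph_nat ratr_cst.
have -> : ratr (a + m%:R - k%:R) = ratr a + m%:R - k%:R :> R[i].
  by rewrite rmorphB rmorphD /= !ratr_nat.
by rewrite (rmorphB cst) (rmorphD cst) !(rmorph_nat cst).
Qed.

(** These are the factors by which the connection multiplies the powers of
    z_j. *)
Lemma nonint_shift a (m k : nat) : a \isn't a Num.int -> a + m%:R - k%:R != 0 :> rat.
Proof.
apply: contraNneq => e; rewrite (_ : a = k%:R - m%:R) ?rpredB ?rpred_nat //.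
by apply/eqP; rewrite -subr_eq0 opprB addrA e.
Qed.

(** For a nonzero integer a the operator would kill or miss a power of z_j, and
    neither reduction of partial fractions applies; hence the two cases. *)
Lemma fibre_cokernel a f : (a == 0) || (a \isn't a Num.int) -> f \in regular S ->
  exists eta (c : 'I_n -> K), [/\ eta \in regular S, forall k, c k \in regular S' &
    f = fibre_d a eta + \sum_(k in poles a) polar k * c k].
Proof.
move=> ha /regular_pfrac pf; apply: (@reducible_fibre (fibre_d a)).
have [a0|a0] := eqVneq a 0.
  have [eta [c [h1 h2 ->]]] := pfrac_primitive char0C (pderivD j) (pderivM j)
    pderiv_iota pderiv_zz natV_R0 pf.
  by exists eta, c; rewrite /poles a0 eqxx fibre_d0.
rewrite (negPf a0) /= in ha.
have pj0 : cpuncture j = 0.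
  by apply: val_inj; rewrite cpunctureE /puncture eqxx rmorph0.
have alphaN0 (m k : nat) : ratr a + m%:R - k%:R != 0 :> C.
  by rewrite -(fmorph_eq0 iota) iota_ratr fmorph_eq0 fmorph_eq0 nonint_shift.
have alphaV (m k : nat) : (ratr a + m%:R - k%:R)^-1 \in R0.
  change (iota (ratr a + m%:R - k%:R)^-1 \in regular S').
  by rewrite fmorphV iota_ratr -fmorphV regular_cstP.
have := pfrac_twisted_primitive char0C (pderivD j) (pderivM j)
  pderiv_iota pderiv_zz cpuncture_inj cpunctureBV_R0 natV_R0 jS pj0 alphaN0 alphaV (ratr_R0 a) pf.
move=> [eta [c [h1 h2 ->]]]; exists eta, c; rewrite /poles (negPf a0); split=> //.
by rewrite /twisted_d /fibre_d fmorph_rat.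
Qed.

(** The simple poles are independent in the cokernel, and the kernel comes from
    the base.  Both are needed at once: the Leray argument produces an equation
    between an image and a combination of poles. *)
Lemma fibre_kernel a f (c : 'I_n -> K) : (a == 0) || (a \isn't a Num.int) ->
  f \in regular S -> (forall k, c k \in regular S') ->
  fibre_d a f = \sum_(k in poles a) polar k * c k ->
  [/\ forall k, k \in poles a -> c k = 0, f \in regular S' & a != 0 -> f = 0].
Proof.
move=> ha /regular_pfrac pf hc e.
have [c' c'E] : exists c' : 'I_n -> C, forall k, c k = iota (c' k).
  have /choice[c' h] : forall k, exists u : C, c k = iota u.
    by move=> k; have [u _ <-] := regular_constant (hc k); exists u.
  by exists c'.
have rf := pfrac_rational char0C (pderivD j) (pderivM j) pderiv_iota pderiv_zz pf.
have sub : poles a \subset S by rewrite /poles; case: ifP; rewrite // subsetDl.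
have inj : {in poles a &, injective cpuncture}.
  by move=> k l /(subsetP sub) kS /(subsetP sub) lS; exact: cpuncture_inj.
have e' : fibre_d a f = \sum_(k in poles a) iota (c' k) / (z j - iota (cpuncture k)).
  by rewrite e; apply: eq_bigr => k _; rewrite c'E iota_cpuncture mulrC.
have [a0|a0] := eqVneq a 0.
  have c0 : forall k, k \in poles a -> c' k = 0.
    apply: (exact_pole_free char0C (pderivD j) (pderivM j) pderiv_iota
      pderiv_zz inj rf).
    by rewrite -e' a0 fibre_d0.
  have cc0 k : k \in poles a -> c k = 0 by move=> kp; rewrite c'E c0 // rmorph0.
  split=> //.
  have df : pderiv j f = 0.
    by rewrite -fibre_d0 -[in fibre_d 0]a0 e big1 // => k kp; rewrite cc0 ?mulr0.
  have fC : f \in constants j by apply/constantsP.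
  have [u uf] : exists u : C, iota u = f by exists (Sub f fC); exact: SubK.
  have : u \in R0.
    by apply: (pfrac_constant char0C (pderivD j) (pderivM j) pderiv_iota pderiv_zz
      cpuncture_R0); rewrite uf.
  by rewrite -uf.
rewrite (negPf a0) /= in ha.
have V0 : {in poles a, forall k, ('X : {poly C}).[cpuncture k] != 0}.
  move=> k; rewrite /poles (negPf a0) !inE => /andP[kj _].
  rewrite hornerX -(fmorph_eq0 iota) iota_cpuncture /puncture (negPf kj).
  exact: z_neq0.
have c0 : forall k, k \in poles a -> c' k = 0.
  apply: (simple_pole_free (U := (ratr a)%:P) char0C (pderivD j) (pderivM j) pderiv_iota
      pderiv_zz inj V0 rf).
  by rewrite evC evX fmorph_rat.
have cc0 k : k \in poles a -> c k = 0 by move=> kp; rewrite c'E c0 // rmorph0.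
have f0 : f = 0.
  apply: (no_rational_exponential char0C (pderivD j) (pderivM j) pderiv_iota
      pderiv_zz (alpha := ratr a) _ rf).
    by move=> m k; rewrite -(fmorph_eq0 iota) iota_ratr fmorph_eq0 fmorph_eq0 nonint_shift.
  by rewrite fmorph_rat [LHS]e big1 // => k kp; rewrite cc0 ?mulr0.
by split=> //; rewrite f0 rpred0.
Qed.

End Fibre.

(** * Regular forms and the connection *)

Implicit Types (I : {set 'I_n}) (l : 'I_n) (u v x y : E) (a b : weight).

(** Coefficients regular on T(1,S), and only the dz_i with i in T.  The two sets
    differ in intermediate steps: splitting off dz_j leaves forms without dz_j
    whose coefficients still depend on z_j. *)
Definition forms S T : {pred E} :=
  fun u => [forall I, (u I \in regular S) && ((I \subset T) || (u I == 0))].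

Lemma formsP S T u : reflect
  ((forall I, u I \in regular S) /\ (forall I, ~~ (I \subset T) -> u I = 0))
  (u \in forms S T).
Proof.
apply: (iffP forallP) => [h|[h1 h2] I].
  split=> I; first by case/andP: (h I).
  by move=> /negPf IT; case/andP: (h I) => _; rewrite IT => /eqP.
by rewrite h1 /=; case: (boolP (I \subset T)) => //= /h2 ->; rewrite eqxx.
Qed.

Lemma forms_subring S T : subring_closed (forms S T).
Proof.
split=> [|u v /formsP[ru su] /formsP[rv sv]|u v /formsP[ru su] /formsP[rv sv]];
  apply/formsP; split=> I.
- by rewrite ffunE rpred_nat.
- move=> IT; rewrite ffunE (_ : (I == set0) = false) ?mulr0n //.
  by apply: contraNF IT => /eqP ->; exact: sub0set.
- by rewrite ext_addE ext_oppE rpredB.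
- by move=> IT; rewrite ext_addE ext_oppE su // sv // subrr.
- by rewrite wedgeE rpred_sum // => A _; rewrite rpredM // rpredM // rpredX // rpredN1.
- move=> IT; rewrite wedgeE big1 // => A AI.
  have [AT|AT] := boolP (A \subset T); last by rewrite su // mulr0 mul0r.
  rewrite sv ?mulr0 //; apply: contra IT => DT.
  by rewrite -(setID I A) subUset DT andbT (subset_trans _ AT) // subsetIr.
Qed.
HB.instance Definition _ S T := GRing.isSubringClosed.Build E (forms S T) (forms_subring S T).

Lemma forms_scale S T f u : f \in regular S -> u \in forms S T -> f *: u \in forms S T.
Proof.
move=> rf /formsP[ru su]; apply/formsP; split=> I; rewrite ext_scaleE.
  by rewrite rpredM.
by move=> /su ->; rewrite mulr0.
Qed.

Lemma formsS S S' T T' u : S \subset S' -> T \subset T' ->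
  u \in forms S T -> u \in forms S' T'.
Proof.
move=> sS sT /formsP[ru su]; apply/formsP; split=> I; first exact: regularS (ru I).
by move=> IT; apply: su; apply: contra IT => /subset_trans; apply.
Qed.

Lemma forms_dz S T i : i \in T -> dz i \in forms S T.
Proof.
move=> iT; apply/formsP; split=> I; rewrite ffunE ?rpred_nat //.
move=> IT; rewrite (_ : (I == [set i]) = false) ?mulr0n //.
by apply: contraNF IT => /eqP ->; rewrite sub1set.
Qed.

Lemma parityK : involutive (@parity K n).
Proof. by move=> u; apply/ffunP => I; rewrite !parityE signrMK. Qed.

Lemma forms_parity S T u : u \in forms S T -> (parity u : E) \in forms S T.
Proof.
move=> /formsP[ru su]; apply/formsP; split=> I; rewrite parityE.
  by rewrite rpredM // rpredX // rpredN1.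
by move=> /su ->; rewrite mulr0.
Qed.

Lemma form_eq0_double u : u = - u -> u = 0.
Proof.
move=> e; apply/ffunP => I; rewrite ext_zeroE.
have := congr1 (fun v : E => v I) e; rewrite /= ext_oppE => /eqP.
by rewrite -subr_eq0 opprK -mulr2n -mulr_natr mulf_eq0 (negPf (natr_neq0 1)) orbF => /eqP.
Qed.

Lemma sum_antisym (t : 'I_n -> 'I_n -> E) :
  (forall i k, t i k = - t k i) -> \sum_i \sum_k t i k = 0.
Proof.
move=> h; apply: form_eq0_double; rewrite [LHS]exchange_big /= -sumrN.
by apply: eq_bigr => k _; rewrite -sumrN; apply: eq_bigr => i _; rewrite h.
Qed.

Lemma parity_dz i : parity (dz i) = - dz i :> E.
Proof.
apply/ffunP => I; rewrite parityE ext_oppE ffunE; case: eqP => [->|_].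
  by rewrite cards1 expr1 mulr1.
by rewrite mulr0 oppr0.
Qed.

Lemma dzM i x : dz i * x = (parity x : E) * dz i.
Proof. exact: ext_gen_parity. Qed.

Lemma dz_anticomm i k : dz i * dz k = - (dz k * dz i).
Proof. by rewrite dzM parity_dz mulNr. Qed.

(** The connection is the sum of the dz_i times these operators, which commute
    with each other: this is its flatness, and the operator for i = j is the
    connection along the fibre. *)
Definition covariant_d a i u : E := [ffun I => fibre_d i (a i) (u I)].

Lemma covariant_dE a i u I : covariant_d a i u I = fibre_d i (a i) (u I).
Proof. by rewrite ffunE. Qed.

Lemma nablaE a u : nabla a u = \sum_i dz i * covariant_d a i u.
Proof.
rewrite /nabla /ext_d /omega mulr_suml -big_split /=; apply: eq_bigr => i _.
rewrite /dlog -!scalerAl !scalerA scalerAr -mulrDr; congr (_ * _).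
by apply/ffunP => I; rewrite covariant_dE ext_addE ext_scaleE ffunE.
Qed.

Lemma fibre_d_is_zmod_morphism i (c : rat) : zmod_morphism (fibre_d i c).
Proof. by move=> f g; rewrite /fibre_d raddfB mulrBr /= addrACA opprD. Qed.

Lemma pderiv_log_weight i k (c : rat) : i != k -> pderiv i (ratr c / z k) = 0.
Proof.
move=> ik; rewrite pderivM ratr_cst pderiv_cst mul0r add0r pderivV ?z_neq0 //.
by rewrite pderiv_z (negPf ik) mul0r oppr0 mulr0.
Qed.

Lemma fibre_dC i k (c e : rat) f : i != k ->
  fibre_d i c (fibre_d k e f) = fibre_d k e (fibre_d i c f).
Proof.
move=> ik; rewrite /fibre_d; apply: twisted_derivations_commute.
- exact: pderivD.
- exact: pderivD.
- exact: pderivM.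
- exact: pderivM.
- exact: pderiv_log_weight.
- by apply: pderiv_log_weight; rewrite eq_sym.
- exact: pderivC.
Qed.

Lemma covariant_dC a i k u : i != k ->
  covariant_d a i (covariant_d a k u) = covariant_d a k (covariant_d a i u).
Proof. by move=> ik; apply/ffunP => I; rewrite !covariant_dE fibre_dC. Qed.

Lemma fibre_d_sign i (c : rat) m f : fibre_d i c ((-1) ^+ m * f) = (-1) ^+ m * fibre_d i c f.
Proof. by rewrite /fibre_d pderiv_sign [RHS]mulrDr; congr (_ + _); exact: mulrCA. Qed.

Lemma fibre_d_0 i (c : rat) : fibre_d i c 0 = 0.
Proof. by rewrite /fibre_d raddf0 mulr0 addr0. Qed.

Lemma covariant_d_dz a i k u : covariant_d a i (dz k * u) = dz k * covariant_d a i u.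
Proof.
apply/ffunP => I; rewrite covariant_dE !ext_gen_wedge covariant_dE.
by case: ifP => _; rewrite ?fibre_d_sign ?fibre_d_0.
Qed.

Lemma covariant_d_is_zmod_morphism a i : zmod_morphism (covariant_d a i).
Proof.
move=> u v; apply/ffunP => I; rewrite !(covariant_dE, ext_addE, ext_oppE).
exact: fibre_d_is_zmod_morphism.
Qed.
HB.instance Definition _ a i := GRing.isZmodMorphism.Build E E (covariant_d a i)
  (covariant_d_is_zmod_morphism a i).

Lemma nabla_nabla a u : nabla a (nabla a u) = 0.
Proof.
rewrite nablaE.
under eq_bigr => i _ do rewrite nablaE raddf_sum mulr_sumr.
apply: sum_antisym => i k /=.
rewrite !covariant_d_dz !mulrA dz_anticomm mulNr; congr (- (_ * _)).
by have [->//|ik] := eqVneq i k; exact: covariant_dC.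
Qed.

Definition supported a S := forall i, i \notin S -> a i = 0.

Lemma regular_fibre_d S i (c : rat) f : i \in S -> f \in regular S -> fibre_d i c f \in regular S.
Proof.
move=> iS rf; rewrite /fibre_d rpredD ?regular_pderiv // rpredM // rpredM ?regular_ratr //.
exact: regular_zVP.
Qed.

Lemma forms_covariant_d a i u S T : i \in S -> u \in forms S T -> covariant_d a i u \in forms S T.
Proof.
move=> iS /formsP[ru su]; apply/formsP; split=> I; rewrite covariant_dE.
  exact: regular_fibre_d.
by move=> /su ->; exact: fibre_d_0.
Qed.

Lemma covariant_d_notin a i u S T : i \notin S -> a i = 0 -> u \in forms S T -> covariant_d a i u = 0.
Proof.
move=> iS ai /formsP[ru _]; apply/ffunP => I; rewrite covariant_dE ai fibre_d0 ext_zeroE.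
exact: pderiv_notin (ru I).
Qed.

Lemma forms_nabla a u S : supported a S -> u \in forms S S -> nabla a u \in forms S S.
Proof.
move=> aS fu; rewrite nablaE; apply: rpred_sum => i _.
have [iS|iS] := boolP (i \in S).
  by apply: rpredM; [exact: forms_dz|exact: forms_covariant_d].
by rewrite (covariant_d_notin iS (aS i iS) fu) mulr0 rpred0.
Qed.

Lemma form_split S j u : j \in S -> u \in forms S S -> exists u0 u1,
  [/\ u0 \in forms S (S :\ j), u1 \in forms S (S :\ j) & u = u0 + dz j * u1].
Proof.
move=> jS /formsP[ru su].
exists [ffun I : {set 'I_n} => if j \in I then 0 else u I].
exists [ffun I : {set 'I_n} => if j \in I then 0 else (-1) ^+ ninv [set j] I * u (j |: I)].
split.
- apply/formsP; split=> I; rewrite ffunE; first by case: ifP => _; rewrite ?rpred0.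
  rewrite subsetD1; case: (j \in I); rewrite //= andbT; exact: su.
- apply/formsP; split=> I; rewrite ffunE.
    by case: ifP => _; rewrite ?rpred0 // rpredM // rpredX // rpredN1.
  rewrite subsetD1; case: (j \in I); rewrite //= andbT => IS.
  rewrite su ?mulr0 // subUset negb_and IS orbT //.
- apply/ffunP => I; rewrite ext_addE /Defs.dz ext_gen_wedge !ffunE.
  case: (boolP (j \in I)) => jI; last by rewrite addr0.
  by rewrite !inE eqxx /= signrMK add0r setD1K.
Qed.

Lemma form_split_eq0 S S' j u0 u1 : j \notin S' ->
  u0 \in forms S S' -> u1 \in forms S S' -> u0 + dz j * u1 = 0 -> u0 = 0 /\ u1 = 0.
Proof.
move=> jS' /formsP[_ s0] /formsP[_ s1] e.
have z0 : u0 = 0.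
  apply/ffunP => I; rewrite ext_zeroE; have [jI|jI] := boolP (j \in I).
    by apply: s0; apply: contra jS' => /subsetP; apply.
  have := congr1 (fun v : E => v I) e.
  by rewrite /= ext_addE /Defs.dz ext_gen_wedge (negPf jI) addr0 ext_zeroE.
split=> //; apply/ffunP => I; rewrite ext_zeroE; have [jI|jI] := boolP (j \in I).
  by apply: s1; apply: contra jS' => /subsetP; apply.
have := congr1 (fun v : E => v (j |: I)) e.
rewrite /= z0 add0r /Defs.dz ext_gen_wedge setU11 setU1K // ext_zeroE => /eqP.
by rewrite mulf_eq0 signr_eq0 => /eqP.
Qed.

Lemma nabla_split a S j u : j \in S -> supported a S -> u \in forms S (S :\ j) ->
  exists2 v, v \in forms S (S :\ j) & nabla a u = v + dz j * covariant_d a j u.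
Proof.
move=> jS aS fu; exists (\sum_(i | i != j) dz i * covariant_d a i u); last first.
  by rewrite nablaE (bigD1 j) //= addrC.
apply: rpred_sum => i ij; have [iS|iS] := boolP (i \in S).
  by apply: rpredM; [apply: forms_dz; rewrite !inE ij|exact: forms_covariant_d].
by rewrite (covariant_d_notin iS (aS i iS) fu) mulr0 rpred0.
Qed.

Lemma poles_sub S j (c : rat) : {subset poles S j c <= S}.
Proof. by move=> k; rewrite /poles; case: ifP => _ //; rewrite !inE => /andP[]. Qed.

(** A decomposition that exists for every regular function is carried out on all
    coefficients of a form, with 0 decomposed as 0 to keep the support. *)
Lemma form_choice S T (P : K -> ('I_n -> K) -> K -> Prop) u :
  (forall f, f \in regular S -> exists g (c : 'I_n -> K), P g c f) ->
  P 0 (fun=> 0) 0 -> u \in forms S T ->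
  exists v (c : 'I_n -> E), forall I,
    P (v I) (fun k => c k I) (u I) /\
    (~~ (I \subset T) -> v I = 0 /\ forall k, c k I = 0).
Proof.
move=> hP P0 /formsP[ru su].
have /choice[v hv] : forall I, exists g, exists c : 'I_n -> K,
    P g c (u I) /\ (~~ (I \subset T) -> g = 0 /\ forall k, c k = 0).
  move=> I; have [IT|IT] := boolP (I \subset T).
    by have [g [c hc]] := hP _ (ru I); exists g, c.
  by exists 0, (fun=> 0); rewrite (su _ IT).
have [c hc] := choice hv.
exists [ffun I => v I], (fun k => [ffun I => c I k]) => I.
rewrite ffunE; have [h1 h2] := hc I; split.
  by rewrite (_ : (fun k => _) = c I) //; apply/funext => k; rewrite ffunE.
by move=> /h2[-> h]; split=> // k; rewrite ffunE.
Qed.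

(** Write u = u0 + dz_j u1 and decompose the coefficients of u1 modulo the image
    of the connection along the fibre: subtracting a coboundary and a
    combination of the e_k leaves a form r without dz_j.  Its covariant
    derivative along z_j is, because u is a cocycle, the combination of the
    poles with coefficients nabla (c_k).  By independence of the poles, the
    c_k are cocycles and r is constant along the fibre, hence a form on the base,
    which is 0 when the connection along the fibre has no kernel. *)
Lemma leray S j a (e f : 'I_n -> E) (b : 'I_n -> weight) u :
  j \in S -> supported a S -> (a j == 0) || (a j \isn't a Num.int) ->
  (forall k, k \in poles S j (a j) -> [/\ f k \in forms S (S :\ j),
     e k = f k + polar j k *: dz j, supported (b k) (S :\ j) &
     forall v, nabla a (e k * v) = - (e k * nabla (b k) v)]) ->
  u \in forms S S -> nabla a u = 0 ->
  exists r v (c : 'I_n -> E), [/\ r \in forms (S :\ j) (S :\ j), a j != 0 -> r = 0,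
    nabla a r = 0, v \in forms S S &
    (forall k, k \in poles S j (a j) -> c k \in forms (S :\ j) (S :\ j) /\ nabla (b k) (c k) = 0) /\
    u = r + \sum_(k in poles S j (a j)) e k * c k + nabla a v].
Proof.
move=> jS aS aj he fu du; set B := poles S j (a j).
have jS' : j \notin S :\ j by rewrite !inE eqxx.
have S'S : S :\ j \subset S := subsetDl _ _.
have [u0 [u1 [f0 f1 uE]]] := form_split jS fu.
have P0 : [/\ (0 : K) \in regular S, forall k : 'I_n, (0 : K) \in regular (S :\ j) &
    0 = fibre_d j (a j) 0 + \sum_(k in B) polar j k * 0].
  split=> [|k|]; [exact: rpred0|exact: rpred0|].
  by rewrite fibre_d_0 add0r big1 // => k _; rewrite mulr0.
have [eta [c etac]] := form_choice
  (P := fun g c f => [/\ g \in regular S, forall k, c k \in regular (S :\ j) &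
    f = fibre_d j (a j) g + \sum_(k in B) polar j k * c k])
  (fun f rf => fibre_cokernel jS aj rf) P0 f1.
have feta : eta \in forms S (S :\ j).
  by apply/formsP; split=> I; have [[h1 h2 h3] h4] := etac I => // /h4[].
have fc k : c k \in forms (S :\ j) (S :\ j).
  by apply/formsP; split=> I; have [[h1 h2 h3] h4] := etac I => // /h4[].
have fcS k : c k \in forms S (S :\ j) by apply: formsS (fc k).
have u1E : u1 = covariant_d a j eta + \sum_(k in B) polar j k *: c k.
  apply/ffunP => I; rewrite ext_addE covariant_dE sum_ffunE.
  have [[_ _ ->] _] := etac I; congr (_ + _).
  by apply: eq_bigr => k _; rewrite ext_scaleE.
have esum (x : 'I_n -> E) : \sum_(k in B) e k * x k =
    \sum_(k in B) f k * x k + dz j * \sum_(k in B) polar j k *: x k.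
  rewrite mulr_sumr -big_split /=; apply: eq_bigr => k kB.
  by have [_ -> _ _] := he k kB; rewrite mulrDl -scalerAl scalerAr.
have [v fv vE] := nabla_split jS aS feta.
pose r := u0 - v - \sum_(k in B) f k * c k.
have ffc : \sum_(k in B) f k * c k \in forms S (S :\ j).
  by apply: rpred_sum => k kB; apply: rpredM; [have [] := he k kB|exact: fcS].
have fr : r \in forms S (S :\ j) := rpredB (rpredB f0 fv) ffc.
have uE' : u = r + \sum_(k in B) e k * c k + nabla a eta.
  by rewrite uE vE esum u1E mulrDr /r; exact: regroup.
(* u is a cocycle and wedging with e_k intertwines the connections up to sign. *)
have e2 : nabla a r = \sum_(k in B) e k * nabla (b k) (c k).
  have -> : r = u - nabla a eta - \sum_(k in B) e k * c k by rewrite uE' addrK addrK.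
  rewrite raddfB raddfB /= nabla_nabla subr0 du sub0r raddf_sum -sumrN.
  apply: eq_bigr => k kB; have [_ _ _ h] := he k kB.
  exact: etrans (congr1 -%R (h _)) (opprK _).
have fN k : k \in B -> nabla (b k) (c k) \in forms (S :\ j) (S :\ j).
  by move=> kB; apply: forms_nabla (fc k); have [] := he k kB.
have [w fw wE] := nabla_split jS aS fr.
have F0 : w - \sum_(k in B) f k * nabla (b k) (c k) \in forms S (S :\ j).
  apply: rpredB fw _; apply: rpred_sum => k kB; apply: rpredM; first by have [] := he k kB.
  by apply: formsS (fN k kB).
have F1 : covariant_d a j r - \sum_(k in B) polar j k *: nabla (b k) (c k) \in forms S (S :\ j).
  apply: (rpredB (forms_covariant_d a jS fr)).
  apply: rpred_sum => k kB; apply: forms_scale; last by apply: formsS (fN k kB).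
  have kS : k \in S := poles_sub kB.
  exact: regular_polar.
(* Compare the two sides of the last equation in the dz_j-component. *)
have [_ /eqP] : w - \sum_(k in B) f k * nabla (b k) (c k) = 0 /\
    covariant_d a j r - \sum_(k in B) polar j k *: nabla (b k) (c k) = 0.
  apply: form_split_eq0 jS' F0 F1 _.
  by rewrite mulrBr addrACA -opprD -wE -esum e2; exact: subrr.
rewrite subr_eq0 => /eqP rE.
have ker I : [/\ forall k, k \in B -> nabla (b k) (c k) I = 0,
    r I \in regular (S :\ j) & a j != 0 -> r I = 0].
  have [rr _] := formsP _ _ _ fr.
  pose c0 k := if k \in B then nabla (b k) (c k) I else 0.
  have [||h1 h2 h3] := fibre_kernel jS (c := c0) aj (rr I).
  - move=> k; rewrite /c0; case: ifP => [/fN/formsP[]//|_]; exact: rpred0.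
  - have := congr1 (fun v : E => v I) rE; rewrite covariant_dE sum_ffunE => ->.
    by apply: eq_bigr => k kB; rewrite ext_scaleE /c0 kB.
  split; [move=> k kB|exact: h2|exact: h3].
  by have := h1 k kB; rewrite /c0 kB; exact.
have dc k : k \in B -> nabla (b k) (c k) = 0.
  by move=> kB; apply/ffunP => I; rewrite ext_zeroE; have [h _ _] := ker I; exact: h.
have [_ sr] := formsP _ _ _ fr.
exists r, eta, c; split.
- by apply/formsP; split; [move=> I; have [] := ker I|exact: sr].
- by move=> aj0; apply/ffunP => I; rewrite ext_zeroE; have [_ _ h] := ker I; exact: h.
- by rewrite e2; apply: big1 => k kB; rewrite (dc k kB) mulr0.
- exact: formsS feta.
- by split; [move=> k kB; split; [exact: fc|exact: dc]|exact: uE'].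
Qed.

(** * Logarithmic forms and gauge transformations *)

(** One-forms are handled through their anticommutation with all forms. *)
Definition oneform u := exists c : 'I_n -> K, u = \sum_i c i *: dz i.

Lemma sum_dz_delta i : \sum_k (k == i)%:R *: dz k = dz i.
Proof.
rewrite (bigD1 i) //= eqxx scale1r big1 ?addr0 // => k /negPf ->.
by rewrite scale0r.
Qed.

Lemma oneformD u v : oneform u -> oneform v -> oneform (u + v).
Proof.
move=> [c ->] [c' ->]; exists (fun i => c i + c' i); rewrite -big_split /=.
by apply: eq_bigr => i _; rewrite scalerDl.
Qed.

Lemma oneformZ f u : oneform u -> oneform (f *: u).
Proof.
move=> [c ->]; exists (fun i => f * c i); rewrite scaler_sumr.
by apply: eq_bigr => i _; rewrite scalerA.
Qed.

Lemma oneformN u : oneform u -> oneform (- u).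
Proof. by rewrite -scaleN1r; exact: oneformZ. Qed.

Lemma oneform_comm u x : oneform u -> u * x = (parity x : E) * u.
Proof.
move=> [c ->]; rewrite mulr_suml mulr_sumr; apply: eq_bigr => i _.
by rewrite -scalerAl dzM scalerAr.
Qed.

Lemma oneform_parity u : oneform u -> parity u = - u :> E.
Proof.
move=> hu; have := oneform_comm 1 hu; rewrite mulr1 => e.
have [c ->] := hu; apply/ffunP => I; rewrite parityE ext_oppE sum_ffunE mulr_sumr -sumrN.
apply: eq_bigr => i _; rewrite ext_scaleE mulrCA -mulrN -ext_oppE -parity_dz parityE.
by [].
Qed.

Lemma oneform_sqr u : oneform u -> u * u = 0.
Proof.
move=> hu; apply: form_eq0_double.
by rewrite [LHS](oneform_comm u hu) oneform_parity // mulNr.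
Qed.

Lemma form_pderivE i u I : form_pderiv i u I = pderiv i (u I).
Proof. exact: ffunE. Qed.

Lemma form_pderivZ i f u : form_pderiv i (f *: u) = pderiv i f *: u + f *: form_pderiv i u.
Proof.
apply/ffunP => I.
rewrite [LHS]form_pderivE [RHS]ext_addE [in LHS]ext_scaleE.
rewrite [in X in _ = X + _]ext_scaleE [in X in _ = _ + X]ext_scaleE.
rewrite [form_pderiv i u I]form_pderivE.
exact: pderivM.
Qed.

Lemma form_pderiv_dz i k : form_pderiv i (dz k) = 0.
Proof.
apply/ffunP => I; rewrite form_pderivE /Defs.dz ffunE ext_zeroE.
by case: (I == _); [exact: pderiv1|exact: raddf0].
Qed.

Definition dlogf f : E := \sum_i (f^-1 * pderiv i f) *: dz i.

Lemma oneform_dlogf f : oneform (dlogf f).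
Proof. by exists (fun i => f^-1 * pderiv i f). Qed.

(** The matrix of second logarithmic derivatives of f is symmetric. *)
Lemma ext_d_dlogf f : f != 0 -> ext_d (dlogf f) = 0.
Proof.
move=> f0; rewrite /Defs.ext_d /dlogf.
have step i k : dz i * form_pderiv i ((f^-1 * pderiv k f) *: dz k) =
    pderiv i (f^-1 * pderiv k f) *: (dz i * dz k).
  by rewrite form_pderivZ form_pderiv_dz scaler0 addr0 -scalerAr.
transitivity (\sum_i \sum_k pderiv i (f^-1 * pderiv k f) *: (dz i * dz k)).
  apply: eq_bigr => i _; rewrite raddf_sum /= mulr_sumr.
  by apply: eq_bigr => k _; exact: step.
have sym i k : pderiv i (f^-1 * pderiv k f) = pderiv k (f^-1 * pderiv i f).
  rewrite [LHS]pderivM [RHS]pderivM (pderivC i k) (pderivV i f0) (pderivV k f0).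
  by rewrite [X in X + _ = _]log_derivative_sym.
apply: (@sum_antisym (fun i k => pderiv i (f^-1 * pderiv k f) *: (dz i * dz k))) => i k.
by rewrite (sym i k) (dz_anticomm i k) scalerN.
Qed.

Lemma dlogfE i : dlogf (z i) = dlog i.
Proof.
rewrite /dlogf /Defs.dlog -[dz i]sum_dz_delta scaler_sumr; apply: eq_bigr => l _.
by rewrite scalerA pderiv_z.
Qed.

Lemma dlogf2E i k : dlogf (z i - z k) = dlog2 i k.
Proof.
rewrite /dlogf /Defs.dlog2 -[dz i]sum_dz_delta -[dz k]sum_dz_delta -sumrB scaler_sumr.
by apply: eq_bigr => l _; rewrite -scalerBl scalerA raddfB /= !pderiv_z.
Qed.

Lemma oneform_dlog i : oneform (dlog i).
Proof. by rewrite -dlogfE; exact: oneform_dlogf. Qed.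

Lemma oneform_dlog2 i k : oneform (dlog2 i k).
Proof. by rewrite -dlogf2E; exact: oneform_dlogf. Qed.

Lemma ext_d_dlog i : ext_d (dlog i) = 0.
Proof. by rewrite -dlogfE ext_d_dlogf // z_neq0. Qed.

Lemma ext_d_dlog2 i k : i != k -> ext_d (dlog2 i k) = 0.
Proof. by move=> ik; rewrite -dlogf2E ext_d_dlogf // zB_neq0. Qed.

(** A closed one-form u is a morphism of complexes, up to sign, between
    the connections with weights b and a as soon as u kills the difference of
    their connection forms. *)
Lemma nabla_oneformM a b u : oneform u -> ext_d u = 0 -> u * omega a = u * omega b ->
  forall v, nabla a (u * v) = - (u * nabla b v).
Proof.
move=> hu du e v; rewrite nablaM du mul0r add0r (oneform_parity hu).
exact: oneform_connection_change.
Qed.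

(** Multiplication by z_i ^ m is an isomorphism between the connections whose
    weights at i differ by m. *)
Definition shift a i (m : int) : weight := fun l => if l == i then a l + m%:~R else a l.

Lemma ratrD (c e : rat) : ratr (c + e) = ratr c + ratr e :> K.
Proof. by rewrite !ratr_cst rmorphD /= rmorphD. Qed.

Lemma ratr_intK (m : int) : ratr (m%:~R) = m%:~R :> K.
Proof. by rewrite ratr_cst ratr_int rmorph_int. Qed.

Lemma pderiv_zX l i (m : int) :
  pderiv l (z i ^ m) = (if l == i then m%:~R / z i else 0) * z i ^ m.
Proof.
rewrite (derivation_exprz m (pderivM l) (z_neq0 i)) pderiv_z.
by case: (l == i); [rewrite mulr1|rewrite mulr0].
Qed.

Lemma fibre_d_gauge a i (m : int) l f :
  fibre_d l (a l) (z i ^ m * f) = z i ^ m * fibre_d l (shift a i m l) f.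
Proof.
rewrite /fibre_d pderivM pderiv_zX; apply: etrans (gauge_derivation _ _ _ _ _) _.
rewrite /shift; case: eqVneq => [->|li]; last by rewrite addr0.
by rewrite ratrD ratr_intK [(_ + _) / z i]mulrDl.
Qed.

Lemma nabla_gauge a i (m : int) u : nabla a (z i ^ m *: u) = z i ^ m *: nabla (shift a i m) u.
Proof.
have h l : covariant_d a l (z i ^ m *: u) = z i ^ m *: covariant_d (shift a i m) l u.
  apply/ffunP => I; rewrite [LHS]covariant_dE [RHS]ext_scaleE [in RHS]covariant_dE.
  by rewrite [in LHS]ext_scaleE; exact: fibre_d_gauge.
rewrite !nablaE scaler_sumr; apply: eq_bigr => l _.
by rewrite h; exact: esym (scalerAr _ _ _).
Qed.

(** The weights after contraction of an edge from j to k. *)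
Definition move a j k : weight :=
  fun i => if i == j then 0 else if i == k then a k + a j else a i.

Lemma dlog2_dlogE j k : j != k ->
  dlog2 j k - dlog k = z j *: ((z j - z k)^-1 *: (dlog j - dlog k)).
Proof. by move=> jk; apply: dlog_difference; rewrite ?z_neq0 // zB_neq0. Qed.

Lemma omega_move a j k : j != k ->
  omega a = omega (move a j k) + ratr (a j) *: (dlog j - dlog k).
Proof.
move=> jk; apply: (@sum_move_coefficient K E _ (fun i => ratr (a i)) (fun i => ratr (move a j k i))
  dlog j k jk) => [||i ij ik]; rewrite /move.
- by rewrite eqxx [ratr _](ratr_intK 0).
- by rewrite eqxx eq_sym (negPf jk) ratrD.
- by rewrite (negPf ij) (negPf ik).
Qed.

(** The connection forms for a and for [move a j k] differ by a multiple of
    omega_j - omega_k, whose square is 0. *)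
Lemma omega_move_oneform a j k (c : K) u : j != k -> u = c *: (dlog j - dlog k) ->
  u * omega a = u * omega (move a j k).
Proof.
move=> jk uE.
have h : oneform (dlog j - dlog k) by apply/oneformD/oneformN; exact: oneform_dlog.
rewrite (omega_move a jk) uE; apply: square_zero_absorb.
exact: oneform_sqr.
Qed.

(** Both descriptions of this form matter: as omega_{j,k} - omega_k it is
    closed with polar part dz_j / (z_j - z_k), and by [dlog2_dlogE] it is
    a multiple of omega_j - omega_k. *)
Definition joining j k : E := dlog2 j k - dlog k.

Lemma oneform_joining j k : oneform (joining j k).
Proof. by apply/oneformD/oneformN; [exact: oneform_dlog2|exact: oneform_dlog]. Qed.

Lemma nabla_joining a j k u : j != k ->
  nabla a (joining j k * u) = - (joining j k * nabla (move a j k) u).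
Proof.
move=> jk; apply: nabla_oneformM; first exact: oneform_joining.
  have e : ext_d (joining j k) = ext_d (dlog2 j k) - ext_d (dlog k).
    exact: ext_d_is_zmod_morphism.
  exact: etrans e (etrans (congr2 (fun v w : E => v - w) (ext_d_dlog2 jk) (ext_d_dlog k)) (subrr 0)).
apply: (omega_move_oneform a jk (c := z j / (z j - z k))).
exact: etrans (dlog2_dlogE jk) (scalerA _ _ _).
Qed.

Lemma nabla_closed_oneform a v u : oneform v -> ext_d v = 0 ->
  nabla a (v * u) = - (v * nabla a u).
Proof. by move=> hv dv; apply: nabla_oneformM. Qed.

(** * Generation by cocycles *)

Lemma forms_dlog S i : i \in S -> dlog i \in forms S S.
Proof. by move=> iS; apply: forms_scale; [exact: regular_zVP|exact: forms_dz]. Qed.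

Lemma forms_dlog2 S i k : i \in S -> k \in S -> dlog2 i k \in forms S S.
Proof.
move=> iS kS; apply: forms_scale; first exact: regular_zBVP.
by apply: rpredB; exact: forms_dz.
Qed.

Lemma forms_joining S j k : j \in S -> k \in S -> joining j k \in forms S S.
Proof. by move=> jS kS; apply: rpredB; [exact: forms_dlog2|exact: forms_dlog]. Qed.

Lemma parity0 : parity (0 : E) = 0 :> E.
Proof. by apply/ffunP => I; rewrite parityE ext_zeroE mulr0. Qed.

Definition closed_form S u := u \in forms S S /\ ext_d u = 0.

(** That v is a regular cocycle is a separate condition, so that X can be given
    by a formula only. *)
Definition generator S a (X : E -> Prop) v := [/\ X v, v \in forms S S & nabla a v = 0].

Definition generated_over S a (X : E -> Prop) :=
  generated (closed_form S) (generator S a X) (fun v => v \in forms S S) (nabla a).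

Lemma closed_parity S u : closed_form S u -> closed_form S (parity u).
Proof.
move=> [fu du]; split; first exact: forms_parity.
have := ext_d_parity u; rewrite du parity0 => h.
by apply: etrans h _; exact: oppr0.
Qed.

Lemma closed_mul S u v : closed_form S u -> closed_form S v -> closed_form S (u * v).
Proof.
move=> [fu du] [fv dv]; split; first exact: (rpredM fu fv).
by apply: etrans (ext_dM u v) _; rewrite du dv; exact: mul0_add_mul0.
Qed.

Lemma generated_gauge S a j (m : int) X Y u : j \in S ->
  (forall v, Y v -> X (z j ^ m *: v)) -> generated_over S (shift a j m) Y u -> generated_over S a X (z j ^ m *: u).
Proof.
move=> jS YX; apply: (@generated_map E _ _ _ _ _ _ _ _ (fun v : E => z j ^ m *: v)).
- by move=> v w; exact: scalerDr.
- by move=> c Zc; exists c => // v; exact: scalerAr.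
- move=> v [Yv fv dv]; split; [exact: YX|by apply: forms_scale fv; exact: regular_zX|].
  by apply: etrans (nabla_gauge _ _ _ _) _; rewrite dv; exact: scaler0.
- move=> v fv; exists (z j ^ m *: v); first by apply: forms_scale fv; exact: regular_zX.
  exact: esym (nabla_gauge _ _ _ _).
Qed.

(** A closed scalar c passes to the other side of the one-form e as its
    parity transform, which is closed again. *)
Lemma generated_oneform_mul S S' a b e X Y u : S' \subset S -> oneform e -> e \in forms S S ->
  (forall v, nabla a (e * v) = - (e * nabla b v)) ->
  (forall v, Y v -> X (e * v)) -> generated_over S' b Y u -> generated_over S a X (e * u).
Proof.
move=> sS he fe de YX; apply: (@generated_map E _ _ _ _ _ _ _ _ (fun v : E => e * v)).
- by move=> v w; exact: mulrDr.
- move=> c [fc dc]; exists (parity c).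
    by have [h1 h2] := closed_parity (conj fc dc); split; [exact: formsS h1|exact: h2].
  by move=> v; apply: mulr_swap; exact: oneform_comm.
- move=> v [Yv fv dv]; split; first exact: YX.
    by apply: (rpredM fe); exact: formsS fv.
  by apply: etrans (de v) _; rewrite dv mulr0; exact: oppr0.
- move=> v fv; exists (- (e * v)).
    by rewrite rpredN; apply: (rpredM fe); exact: formsS fv.
  apply: etrans _ (esym (raddfN (nabla a : {additive E -> E}) _)).
  by rewrite /= de; exact: esym (opprK _).
Qed.

Lemma generated_over_subset S S' a X u : S' \subset S -> generated_over S' a X u -> generated_over S a X u.
Proof.
move=> sS; apply: (@generated_map E _ _ _ _ _ _ _ _ id).
- by [].
- by move=> c [fc dc]; exists c; [split; [exact: formsS fc|exact: dc]|].
- by move=> v [Xv fv dv]; split; [exact: Xv|exact: formsS fv|exact: dv].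
- by move=> v fv; exists v; [exact: formsS fv|].
Qed.

Lemma generated_over_closed_mul S a X c u : closed_form S c -> generated_over S a X u -> generated_over S a X (c * u).
Proof.
move=> Zc; apply: generated_closed_mul => [c' Zc'|v fv]; first exact: closed_mul.
have [fp dp] := closed_parity Zc; exists (parity c * v); first exact: (rpredM fp fv).
apply: esym; apply: etrans (nablaM a (parity c) v) _.
by rewrite dp (parityK c); exact: mul0_add.
Qed.

Lemma generated_over_sum S a X (B : {set 'I_n}) (u : 'I_n -> E) :
  (forall k, k \in B -> generated_over S a X (u k)) -> generated_over S a X (\sum_(k in B) u k).
Proof.
apply: generated_sum; first exact: rpred0.
exact: (raddf0 (nabla a : {additive E -> E})).
Qed.

Definition forget a j : weight := fun i => if i == j then 0 else a i.

Lemma supported_forget S a j : supported a S -> supported (forget a j) (S :\ j).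
Proof.
move=> aS i; rewrite !inE negb_and negbK /forget; case: (i == j) => //=; exact: aS.
Qed.

Lemma supported_shift S a j m : j \in S -> supported a S -> supported (shift a j m) S.
Proof.
move=> jS aS i iS; rewrite /shift (_ : (i == j) = false) ?aS //.
by apply: contraNF iS => /eqP ->.
Qed.

Lemma supported_move S a j k : k \in S :\ j -> supported a S -> supported (move a j k) (S :\ j).
Proof.
rewrite !inE => /andP[kj kS] aS i; rewrite !inE negb_and negbK /move.
case: (eqVneq i j) => //= _ iS; rewrite (_ : (i == k) = false) ?aS //.
by apply: contraNF iS => /eqP ->.
Qed.

Lemma scale_zXK i (m : int) u : z i ^ (- m) *: (z i ^ m *: u) = u.
Proof.
have h : z i ^ (- m) * z i ^ m = 1 by rewrite -expfzDr ?z_neq0 // addNr expr0z.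
by apply: etrans (scalerA _ _ _) _; rewrite h; exact: scale1r.
Qed.

Lemma polar_self j : polar j j = (z j)^-1.
Proof. by rewrite /polar /puncture eqxx subr0. Qed.

Lemma polar_neq j k : k != j -> polar j k = (z j - z k)^-1.
Proof. by move=> kj; rewrite /polar /puncture (negPf kj). Qed.

(** After the gauge transformation that makes the weight of j vanish, the
    one-forms supplied to [leray] are closed forms on T(1,S), that is scalars
    of the module.  So they do not create new generators. *)
Lemma generated_forget_integral S j a (m : int) X Y u :
  j \in S -> supported a S -> a j = m%:~R ->
  (forall v, v \in forms (S :\ j) (S :\ j) -> nabla (forget a j) v = 0 ->
     generated_over (S :\ j) (forget a j) Y v) ->
  (forall v, Y v -> X (z j ^ (- m) *: v)) ->
  u \in forms S S -> nabla a u = 0 -> generated_over S a X u.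
Proof.
move=> jS aS aj hY hX fu du; pose a0 := forget a j.
have shift_a0 : shift a0 j m = a.
  by apply/funext => i; rewrite /shift /a0 /forget; case: eqVneq => // ->; rewrite add0r aj.
have shift_a : shift a j (- m) = a0.
  apply/funext => i; rewrite /shift /a0 /forget; case: eqVneq => // ->.
  by rewrite aj rmorphN subrr.
rewrite -[u](scale_zXK j m); apply: (generated_gauge jS hX); rewrite shift_a.
set u' := z j ^ m *: u.
have fu' : u' \in forms S S by apply: forms_scale fu; exact: regular_zX.
have du' : nabla a0 u' = 0.
  by apply: etrans (nabla_gauge _ _ _ _) _; rewrite shift_a0 du; exact: scaler0.
have a0j : a0 j = 0 by rewrite /a0 /forget eqxx.
have polesE : poles S j (a0 j) = S by rewrite /poles a0j eqxx.
have a0S : supported a0 (S :\ j) by exact: supported_forget.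
have a0SS : supported a0 S.
  by move=> i iS; apply: a0S; rewrite !inE negb_and iS orbT.
pose e k := if k == j then dlog j else dlog2 j k.
pose f k : E := if k == j then 0 else - (polar j k *: dz k).
have oe k : oneform (e k).
  by rewrite /e; case: ifP => _; [exact: oneform_dlog|exact: oneform_dlog2].
have ce k : k \in S -> closed_form S (e k).
  rewrite /e; case: eqVneq => [_|kj] kS; split.
  - exact: forms_dlog.
  - exact: ext_d_dlog.
  - exact: forms_dlog2.
  - by apply: ext_d_dlog2; rewrite eq_sym.
have [||r [v [c [fr _ dr fv [hc u'E]]]]] := leray (e := e) (f := f) (b := fun=> a0) jS a0SS _ _ fu' du'.
- by rewrite a0j eqxx.
- rewrite polesE => k kS; split.
  + rewrite /f; case: eqVneq => [_|kj]; first exact: rpred0.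
    rewrite rpredN; apply: forms_scale; first exact: regular_polar.
    by apply: forms_dz; rewrite !inE kj.
  + rewrite /e /f; case: eqVneq => [->|kj].
      by rewrite polar_self add0r.
    rewrite (polar_neq kj); apply: etrans (scalerBr _ _ _) _; exact: addrC.
  + exact: a0S.
  + by move=> w; apply: nabla_closed_oneform (oe k) _ => //; have [] := ce k kS.
have genc w : w \in forms (S :\ j) (S :\ j) -> nabla a0 w = 0 -> generated_over S a0 Y w.
  move=> fw dw; apply: (generated_over_subset (S' := S :\ j)); [exact: subsetDl|exact: hY].
rewrite u'E; apply: generated_add; last exact: generated_boundary.
apply: generated_add; first exact: genc.
rewrite polesE in hc *; apply: generated_over_sum => k kS; have [fck dck] := hc k kS.
by apply: generated_over_closed_mul; [exact: ce|exact: genc].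
Qed.

(** Here the forms supplied to [leray] are not scalars that preserve the
    weights, and they become part of the generators.  The power m is arbitrary:
    the weight of j is first lowered by m, and after it has been moved to k the
    gauge transformation at k raises it again, so that the weights of the
    remaining vertices are exactly [move a j k]. *)
Lemma generated_join_nonintegral S j a (m : int) X (Y : 'I_n -> E -> Prop) u :
  j \in S -> supported a S -> a j \isn't a Num.int ->
  (forall k v, k \in S :\ j -> v \in forms (S :\ j) (S :\ j) -> nabla (move a j k) v = 0 ->
     generated_over (S :\ j) (move a j k) (Y k) v) ->
  (forall k v, k \in S :\ j -> Y k v -> X (z j ^ (- m) *: (joining j k * (z k ^ m *: v)))) ->
  u \in forms S S -> nabla a u = 0 -> generated_over S a X u.
Proof.
move=> jS aS aj hY hX fu du; pose a1 := shift a j (- m).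
have shift_a1 : shift a1 j m = a.
  apply/funext => i; rewrite /a1 /shift; case: eqVneq => // ->.
  by rewrite rmorphN /= subrK.
pose X1 v := X (z j ^ (- m) *: v).
rewrite -[u](scale_zXK j m); apply: (generated_gauge (Y := X1) jS) => //; rewrite -/a1.
set u' := z j ^ m *: u.
have fu' : u' \in forms S S by apply: forms_scale fu; exact: regular_zX.
have du' : nabla a1 u' = 0.
  by apply: etrans (nabla_gauge _ _ _ _) _; rewrite shift_a1 du; exact: scaler0.
have a1j : a1 j \isn't a Num.int.
  rewrite /a1 /shift eqxx; apply: contra aj => h.
  by rewrite -[a j](subrK m%:~R) rpredD // ?rpred_int // -rmorphN.
have a1j0 : a1 j != 0 by apply: contraNneq a1j => ->; exact: rpred0.
have a1S : supported a1 S by exact: supported_shift.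
have polesE : poles S j (a1 j) = S :\ j by rewrite /poles (negPf a1j0).
pose f k : E := - (polar j k *: dz k) - dlog k.
have [||r [v [c [_ r0 _ fv [hc u'E]]]]] := leray (e := joining j) (f := f) (b := move a1 j) jS a1S _ _ fu' du'.
- by rewrite a1j orbT.
- rewrite polesE => k kS'; have := kS'; rewrite !inE => /andP[kj kS]; split.
  + apply: rpredB.
      rewrite rpredN; apply: forms_scale; first exact: regular_polar.
      exact: forms_dz.
    by apply: forms_scale; [exact: regular_zVP|exact: forms_dz].
  + by rewrite /joining /f (polar_neq kj); exact: joining_split.
  + exact: supported_move.
  + by move=> w; apply: nabla_joining; rewrite eq_sym.
rewrite u'E (r0 a1j0) polesE in hc *; apply: generated_add; last exact: generated_boundary.
rewrite add0r; apply: generated_over_sum => k kS'; have := kS'; rewrite !inE => /andP[kj kS].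
have [fck dck] := hc k kS'.
have jk : j != k by rewrite eq_sym.
have moveE : shift (move a1 j k) k m = move a j k.
  apply/funext => i; rewrite /shift /move /a1 /shift.
  have [->|ik] := eqVneq i k; last by case: eqVneq => // ij; rewrite (negPf ij).
  by rewrite (negPf kj) eqxx rmorphN /= addrA subrK.
have moveE' : shift (move a j k) k (- m) = move a1 j k.
  apply/funext => i; rewrite -moveE /shift; case: eqVneq => // _.
  by rewrite rmorphN /= addrK.
apply: (generated_oneform_mul (S' := S :\ j) (b := move a1 j k) (Y := fun w => X1 (joining j k * w))).
- exact: subsetDl.
- exact: oneform_joining.
- exact: forms_joining.
- by move=> w; exact: nabla_joining.
- by [].
have -> : c k = z k ^ m *: (z k ^ (- m) *: c k) by rewrite -[in LHS](scale_zXK k (- m) (c k)) opprK.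
apply: (generated_gauge (Y := Y k)) => //; first by move=> w; exact: hX.
rewrite moveE; apply: hY; [exact: kS'|by apply: forms_scale fck; exact: regular_zX|].
by apply: etrans (nabla_gauge _ _ _ _) _; rewrite moveE' dck; exact: scaler0.
Qed.

(** The forms without coordinates are the constants. *)
Lemma generated_no_vertex a X u : supported a set0 -> X 1 -> u \in forms set0 set0 -> generated_over set0 a X u.
Proof.
move=> a0 X1 fu.
have nabla0 b w : supported b set0 -> w \in forms set0 set0 -> nabla b w = 0.
  move=> b0 fw; rewrite nablaE; apply: big1 => i _.
  have -> : covariant_d b i w = 0; last by rewrite mulr0.
  by apply: covariant_d_notin fw; [rewrite inE|apply: b0; rewrite inE].
rewrite -[u]mulr1; apply: generated_mul.
  split; first exact: fu.
  by rewrite -Defs.nabla0; apply: nabla0.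
by split; [exact: X1|exact: rpred1|apply: nabla0 a0 _; exact: rpred1].
Qed.

Lemma regular_formE u : (u \in @regular_form R n) = (u \in forms [set: 'I_n] [set: 'I_n]).
Proof.
apply/regular_formP/formsP => [h|[h _] I]; last by rewrite regular_funE.
split=> I; first by rewrite -regular_funE.
by rewrite subsetT.
Qed.

Lemma cocycle_forms a u : u \in forms [set: 'I_n] [set: 'I_n] -> nabla a u = 0 ->
  is_cocycle a u.
Proof. by move=> fu du; rewrite /is_cocycle regular_formE fu du; exact/eqP. Qed.

Lemma closed_cocycle u : closed_form [set: 'I_n] u -> is_cocycle (@a_triv n) u.
Proof. by case=> fu du; apply: cocycle_forms fu _; rewrite nabla0. Qed.

Lemma generated_over_cocycle a X u : generated_over [set: 'I_n] a X u -> is_cocycle a u.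
Proof.
elim=> {u} [c v hc [_ fv dv]|u v _ hu _ hv|v fv].
- exact: (cocycle_wedge_subproof (Cocycle (closed_cocycle hc)) (Cocycle (cocycle_forms fv dv))).
- exact: rpredD.
- apply: cocycle_forms; last exact: nabla_nabla.
  by apply: forms_nabla fv => i; rewrite inE.
Qed.

(** Passage from cocycles to classes: the derivation that a cocycle is
    generated is translated into a linear combination of classes. *)
Lemma generates_of_generated_over a (X : E -> Prop) (P : cohomology R a -> Prop) :
  (forall u, u \in forms [set: 'I_n] [set: 'I_n] -> nabla a u = 0 -> generated_over [set: 'I_n] a X u) ->
  (forall c : cocycle R a, X (val c) -> P (cocycle_class c)) ->
  generates P.
Proof.
move=> hgen hP; elim/cocycle_classW => c.
have /andP[rc /eqP dc] := valP c; rewrite regular_formE in rc.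
have step u : generated_over [set: 'I_n] a X u -> forall c : cocycle R a, val c = u ->
    exists s : seq (cohomology_ring R n * cohomology R a),
      (forall w, w \in s -> P w.2) /\ cocycle_class c = \sum_(w <- s) w.1 *: w.2.
  elim=> {c rc dc u} [e v he [Xv fv dv]|u v hu ihu hv ihv|v fv] c cE.
  - pose e' := Cocycle (closed_cocycle he); pose v' := Cocycle (cocycle_forms fv dv).
    exists [:: (cocycle_class e', cocycle_class v')]; split.
      by move=> w; rewrite inE => /eqP ->; exact: hP.
    rewrite big_seq1; apply: etrans _ (esym (cupE e' v')).
    by congr cocycle_class; apply: val_inj.
  - pose u' := Cocycle (generated_over_cocycle hu); pose v' := Cocycle (generated_over_cocycle hv).
    have [s [hs us]] := ihu u' erefl; have [t [ht vt]] := ihv v' erefl.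
    exists (s ++ t); split.
      by move=> w; rewrite mem_cat => /orP[/hs|/ht].
    rewrite big_cat /= -us -vt; apply: etrans _ (cocycle_classD u' v').
    by congr cocycle_class; apply: val_inj.
  - exists [::]; split; first by [].
    rewrite big_nil.
    have -> : (0 : cohomology R a) = cocycle_class (0 : cocycle R a).
      by rewrite -(subrr (cocycle_class (0 : cocycle R a))) -cocycle_classB subrr.
    apply/eqP/cocycle_class_eq; exists v; first by rewrite regular_formE.
    have -> : val (0 : cocycle R a) = 0 := raddf0 (val : {additive cocycle R a -> E}).
    by rewrite cE; exact: subr0.
exact: step (hgen _ rc dc) c erefl.
Qed.

(** * Uniform weights *)

Lemma homogeneous_scale p f u : homogeneous p u -> homogeneous p (f *: u).
Proof. by move=> h I Ip; rewrite ext_scaleE (h I Ip) mulr0. Qed.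

Lemma homogeneous_oneform p u v : oneform u -> homogeneous p v -> homogeneous p.+1 (u * v).
Proof.
move=> [c ->] h I Ip; rewrite mulr_suml sum_ffunE; apply: big1 => i _.
rewrite -scalerAl ext_scaleE /Defs.dz ext_gen_wedge; case: ifP => iI; last exact: mulr0.
rewrite h ?mulr0 //; apply: contra Ip => /eqP <-.
by rewrite (cardsD1 i I) iI.
Qed.

Lemma homogeneous1 : homogeneous 0 (1 : E).
Proof. by move=> I I0; rewrite ffunE -cards_eq0 (negPf I0). Qed.

(** All vertices of S have weight q, except that t - 1 vertices already removed
    have given their weight to j. *)
Definition uniform_weight (q : rat) S j (t : nat) : weight :=
  fun i => if i == j then t%:R * q else if i \in S then q else 0.

Lemma supported_uniform q S j t : j \in S -> supported (uniform_weight q S j t) S.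
Proof.
move=> jS i iS; rewrite /uniform_weight (negPf iS).
by rewrite (_ : (i == j) = false) //; apply: contraNF iS => /eqP ->.
Qed.

Lemma forget_uniform q S j t k : k \in S :\ j ->
  forget (uniform_weight q S j t) j = uniform_weight q (S :\ j) k 1.
Proof.
rewrite !inE => /andP[kj kS]; apply/funext => i; rewrite /forget /uniform_weight !inE.
case: (eqVneq i j) => [->|ij]; first by rewrite eq_sym (negPf kj).
by case: eqVneq => [->|_]; rewrite //= kS mul1r.
Qed.

Lemma move_uniform q S j t k : k \in S :\ j ->
  move (uniform_weight q S j t) j k = uniform_weight q (S :\ j) k t.+1.
Proof.
rewrite !inE => /andP[kj kS]; apply/funext => i; rewrite /move /uniform_weight !inE.
case: (eqVneq i j) => [->|ij]; first by rewrite eq_sym (negPf kj).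
case: eqVneq => [_|_] //=.
by rewrite (negPf kj) kS eqxx -[t.+1%:R]natr1 mulrDl mul1r addrC.
Qed.

(** The vertex j is removed next.  If its weight t q is integral, that is t = d,
    a path is complete: the degree is unchanged and a new path starts at any
    other vertex.  Otherwise an edge is added, which raises the degree by one.
    With N other vertices left, (N + t) / d paths will be completed,
    out of N + 1 vertices. *)
Lemma generated_uniform_weight (q : rat) (d : nat) : (0 < d)%N ->
  (forall t : nat, (t%:R * q \is a Num.int) = (d %| t)%N) ->
  forall N S j t u, #|S| = N.+1 -> j \in S -> (0 < t <= d)%N ->
  u \in forms S S -> nabla (uniform_weight q S j t) u = 0 ->
  generated_over S (uniform_weight q S j t) (homogeneous (N.+1 - (N + t) %/ d)%N) u.
Proof.
move=> d0 qP; elim=> [|N IH] S j t u cS jS /andP[t0 td] fu du.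
all: have aS := supported_uniform q t jS.
all: have aj : uniform_weight q S j t j = t%:R * q by rewrite /uniform_weight eqxx.
all: have cS' : #|S :\ j|.+1 = #|S| by rewrite (cardsD1 j S) jS.
all: have [tdE|td'] := eqVneq t d.
- have : (t%:R * q) \is a Num.int by rewrite qP tdE.
  case/intrP => m tq; have S'0 : S :\ j = set0 by apply/eqP; rewrite -cards_eq0 -eqSS cS' cS.
  rewrite tdE add0n divnn d0 subnn -tdE.
  apply: (generated_forget_integral (m := m) (Y := fun v => v = 1) jS aS _ _ _ fu du).
  + by rewrite aj.
  + move=> v fv dv; have := supported_forget (j := j) aS.
    by rewrite S'0 in fv *; move=> a0; apply: generated_no_vertex.
  + by move=> v ->; apply: homogeneous_scale; exact: homogeneous1.
(* A last vertex of nonintegral weight has no vertex to be joined to, so that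
   there are no generators and the degree is immaterial. *)
- have S'0 : S :\ j = set0 by apply/eqP; rewrite -cards_eq0 -eqSS cS' cS.
  apply: (generated_join_nonintegral (m := 0) (Y := fun _ => homogeneous 0) jS aS _ _ _ fu du).
  + by rewrite aj qP gtnNdvd // ltn_neqAle td' td.
  + by move=> k v; rewrite S'0 inE.
  + by move=> k v; rewrite S'0 inE.
- have : (t%:R * q) \is a Num.int by rewrite qP tdE.
  case/intrP => m tq.
  have [k kS'] : exists k, k \in S :\ j by apply/set0Pn; rewrite -cards_eq0 -lt0n -ltnS cS' cS.
  have pE : (N.+2 - (N.+1 + t) %/ d = N.+1 - (N + 1) %/ d)%N.
    by rewrite tdE divnDr // divnn d0 !addn1 subSS.
  rewrite pE; apply: (generated_forget_integral (m := m) (Y := homogeneous (N.+1 - (N + 1) %/ d)) jS aS _ _ _ fu du).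
  + by rewrite aj.
  + move=> v fv; rewrite (forget_uniform q t kS') => dv; apply: IH => //.
    by apply/eqP; rewrite -eqSS cS' cS.
  + by move=> v; exact: homogeneous_scale.
- have td1 : (t < d)%N by rewrite ltn_neqAle td' td.
  have pE : (N.+2 - (N.+1 + t) %/ d = (N.+1 - (N + t.+1) %/ d).+1)%N.
    rewrite -addSnnS subSn // -ltnS ltn_divLR //; nia.
  rewrite pE; apply: (generated_join_nonintegral (m := 0)
    (Y := fun _ => homogeneous (N.+1 - (N + t.+1) %/ d)) jS aS _ _ _ fu du).
  + by rewrite aj qP gtnNdvd.
  + move=> k v kS' fv; rewrite (move_uniform q t kS') => dv; apply: IH => //.
    by apply/eqP; rewrite -eqSS cS' cS.
  + move=> k v kS' hv; apply: homogeneous_scale; apply: homogeneous_oneform; first exact: oneform_joining.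
    exact: homogeneous_scale.
Qed.

Lemma generated_by_lowest_degree (s : int) : (0 < n)%N ->
  generates (@cohomology_deg R n (fun _ => s%:~R / n%:R) (n - gcdn `|s|%N n)).
Proof.
move=> n0; pose g := gcdn `|s| n; pose d := (n %/ g)%N.
have g0 : (0 < g)%N by rewrite gcdn_gt0 n0 orbT.
have d0 : (0 < d)%N by rewrite divn_gt0 // dvdn_leq // dvdn_gcdr.
pose j := Ordinal n0.
have wE : (fun _ : 'I_n => s%:~R / n%:R) = uniform_weight (s%:~R / n%:R) [set: 'I_n] j 1.
  by apply/funext => i; rewrite /uniform_weight inE mul1r if_same.
have pE : (n - g = n.-1.+1 - (n.-1 + 1) %/ d)%N.
  rewrite addn1 prednK //; congr (_ - _)%N.
  by rewrite /d divnA ?dvdn_gcdr // mulKn.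
apply: (generates_of_generated_over (X := homogeneous (n - g))).
  move=> u fu; rewrite wE pE => du; apply: (generated_uniform_weight d0) => //.
  - by move=> t; exact: multiple_integral.
  - by rewrite cardsT card_ord prednK.
  - by rewrite inE.
by move=> c hc; exists (val c) => //; exists c.
Qed.

(** * The forms of a forest *)

Definition par_factor (par : 'I_n -> option 'I_n) i : E :=
  if par i is Some j then (z i - z j)^-1 *: (dlog i - dlog j) else 1.

(** The form of the statement without the scalars at the roots. *)
Definition par_form par (sigma : 'I_n -> rat) : E :=
  (\prod_(j < n) z j ^ par_bexp par sigma j) *: \prod_(i < n) par_factor par i.

Definition forest_form a m v :=
  exists par sigma, admissible a par sigma m /\ v = par_form par sigma.

(** The vertices below j contribute the factor 1, so the factor of j is the
    first of the product, where the one-form of [generated_join_nonintegral]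
    stands. *)
Lemma par_form_attach a par sigma j o q : admissible a par sigma j.+1 ->
  par_form (attach par j o) (relabel sigma j q) =
  ((z j ^ (- Num.floor q) * (if o is Some k then z k ^ Num.ceil q else 1))
     * \prod_(l < n) z l ^ par_bexp par sigma l) *:
  ((if o is Some k then (z j - z k)^-1 *: (dlog j - dlog k) else 1)
     * \prod_(i < n) par_factor par i).
Proof.
move=> adm; have triv := admissible_trivial adm; rewrite /par_form.
rewrite (prod_exprz_update z_neq0 (fun i => par_bexp_attach o q i adm (ltnSn j))).
have h : \prod_(i < n) par_factor (attach par j o) i =
    par_factor (attach par j o) j * \prod_(i < n) par_factor par i.
  apply: prod_ord_first => i ij; rewrite /par_factor.
  - have [-> _] : attach par j o i = None /\ True; last by [].
    split; last by [].
    rewrite /attach (_ : (i == j) = false); first by have [] := triv i (ltnW ij).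
    by apply/negbTE; rewrite -val_eqE /= neq_ltn ij.
  - by have [-> _] := triv i ij.
  - rewrite /attach (_ : (i == j) = false) //.
    by apply/negbTE; rewrite -val_eqE /= neq_ltn ij orbT.
by rewrite h /par_factor {1}/attach eqxx.
Qed.

Definition vertices_from m : {set 'I_n} := [set i : 'I_n | (m <= i)%N].

(** The vertices are removed in increasing order: at the smallest remaining
    vertex m, joining it to any other vertex creates an increasing edge. *)
Lemma generated_by_forest_forms m : (m <= n)%N -> forall a u,
  supported a (vertices_from m) -> u \in forms (vertices_from m) (vertices_from m) ->
  nabla a u = 0 -> generated_over (vertices_from m) a (forest_form a m) u.
Proof.
move=> mn; have [d dE] : exists d : nat, d = (n - m)%N by exists (n - m)%N.
elim: d m mn dE => [|d IH] m mn dE a u.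
  have mE : m = n by lia.
  have -> : vertices_from m = set0.
    by apply/setP => i; rewrite !inE mE leqNgt ltn_ord.
  move=> aS fu du; apply: generated_no_vertex => //; exists (fun=> None), (fun=> 0); split.
    have -> : a = (fun=> 0) by apply/funext => i; apply: aS; rewrite inE.
    by rewrite mE; exact: admissible_empty.
  rewrite /par_form big1 ?scale1r ?big1 // => j _.
  by rewrite /par_bexp floor0 oppr0 add0r big1.
have mn' : (m < n)%N by lia.
pose j := Ordinal mn'; set S := vertices_from m => aS fu du.
have S'E : S :\ j = vertices_from m.+1.
  by apply/setP => i; rewrite !inE -val_eqE /=; lia.
have jS : j \in S by rewrite inE.
have a0 i : (i < j)%N -> a i = 0 by move=> ij; apply: aS; rewrite inE -ltnNge.
have IH' b v : supported b (S :\ j) -> v \in forms (S :\ j) (S :\ j) -> nabla b v = 0 ->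
    generated_over (S :\ j) b (forest_form b j.+1) v.
  by rewrite S'E => bS fv dv; apply: IH => //; lia.
have [aj|aj] := boolP (a j \is a Num.int).
  apply: (generated_forget_integral (m := Num.floor (a j)) (Y := forest_form (forget a j) j.+1) jS aS _ _ _ fu du).
  - by rewrite floorK.
  - by move=> v fv dv; apply: IH' => //; exact: supported_forget.
  - move=> v [par [sigma [adm ->]]]; exists (attach par j None), (relabel sigma j (a j)); split.
      apply: (admissible_attach adm) => // i.
      by rewrite /forget addr0.
    rewrite (par_form_attach None _ adm) mulr1 mul1r; exact: scalerA.
apply: (generated_join_nonintegral (m := Num.ceil (a j)) (Y := fun k => forest_form (move a j k) j.+1) jS aS aj _ _ fu du).
- by move=> l v lS fv dv; apply: IH' => //; exact: supported_move.
- move=> l v lS [par [sigma [adm ->]]]; exists (attach par j (Some l)), (relabel sigma j (a j)).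
  have jl : (j < l)%N by move: lS; rewrite S'E inE.
  have jl' : j != l by rewrite -val_eqE /= neq_ltn jl.
  split.
    apply: (admissible_attach adm) => //.
    - by move=> i [<-].
    - by rewrite (negPf aj).
    - move=> i; rewrite /move; case: eqVneq => // ij; rewrite (inj_eq Some_inj) eq_sym.
      by case: eqVneq => [->|_] //; rewrite addr0.
  (* For nonintegral weights the ceiling is the floor plus one, and the missing
     factor z j is the one in the proportionality of [joining j l]. *)
  have h : z j ^ (- Num.floor (a j)) = z j ^ (- Num.ceil (a j)) * z j.
    by rewrite -[X in _ = _ * X](expr1z (z j)) -expfzDr ?z_neq0 // ceil_floor aj opprD subrK.
  have hj : joining j l = z j *: ((z j - z l)^-1 *: (dlog j - dlog l)) := dlog2_dlogE jl'.
  apply: etrans _ (esym (par_form_attach (Some l) (a j) adm)).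
  rewrite h hj; exact: scale_collect.
Qed.

Lemma ext_d_cst c u : ext_d (cst c *: u) = cst c *: ext_d u.
Proof.
rewrite /Defs.ext_d scaler_sumr; apply: eq_bigr => i _.
rewrite form_pderivZ pderiv_cst scale0r add0r; exact: esym (scalerAr _ _ _).
Qed.

Lemma nabla_cst a c u : nabla a (cst c *: u) = cst c *: nabla a u.
Proof.
apply: etrans (congr1 (fun t : E => t + omega a * (cst c *: u)) (ext_d_cst c u)) _.
exact: scale_connection.
Qed.

Lemma generated_rescale S a (X Y : E -> Prop) u :
  (forall v, X v -> exists2 c, c != 0 & Y (cst c *: v)) -> generated_over S a X u -> generated_over S a Y u.
Proof.
move=> XY; elim=> {u} [w v [fw dw] [Xv fv dv]|u v _ hu _ hv|v fv].
- have [c c0 Yv] := XY v Xv.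
  have -> : w * v = (cst c^-1 *: w) * (cst c *: v).
    by apply: rescale_product; rewrite -rmorphM mulVf // rmorph1.
  apply: generated_mul.
    split; first by apply: forms_scale fw; exact: regular_cstP.
    by apply: etrans (ext_d_cst _ _) _; rewrite dw; exact: scaler0.
  split; [exact: Yv|by apply: forms_scale fv; exact: regular_cstP|].
  by apply: etrans (nabla_cst _ _ _) _; rewrite dv; exact: scaler0.
- exact: generated_add.
- exact: generated_boundary.
Qed.

Section BetaForm.
Variables (a : weight) (par : 'I_n -> option 'I_n) (sigma : 'I_n -> rat) (r : nat).
Hypotheses (adm : admissible a par sigma 0) (r0 : (0 < r)%N).
Local Notation F := (par_forest (admissible_increasing adm)).

(** The signs and factors r at the open roots: they do not change the module
    generated, since they are invertible constants. *)
Definition root_scalar i : R[i] :=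
  if par i is Some _ then 1
  else (-1) ^+ (i - #|[set k in open_roots F | (k < i)%N]|) * r%:R.

Lemma root_scalar_neq0 i : root_scalar i != 0.
Proof.
rewrite /root_scalar; case: (par i) => [_|]; first exact: oner_neq0.
by rewrite mulf_neq0 ?signr_eq0 // pnatr_eq0 -lt0n.
Qed.

Lemma beta_factor_par i : beta_factor a R r F i = cst (root_scalar i) *: par_factor par i.
Proof.
rewrite /beta_factor /root_scalar /par_factor.
case: pickP => [j /eqP ij|noj].
  rewrite ij (admissible_down_sum adm) (admissible_integral adm) ij /=.
  by rewrite rmorph1 scale1r.
have pi : par i = None.
  by case E : (par i) => [j|] //; have := noj j; rewrite /= /par_edge E eqxx.
rewrite pi /= inE pi eqxx rmorphM rmorph_sign rmorph_nat.
exact: scale_sign_nat.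
Qed.

Lemma beta_form_par :
  beta_form a R r F = cst (\prod_i root_scalar i) *: par_form par sigma.
Proof.
rewrite /beta_form /par_form (eq_bigr (fun j => z j ^ par_bexp par sigma j)); last first.
  by move=> j _; rewrite (admissible_bexp adm).
rewrite (eq_bigr (fun i => cst (root_scalar i) *: par_factor par i)); last first.
  by move=> i _; exact: beta_factor_par.
by rewrite scaler_prod rmorph_prod; exact: scale_scaleC.
Qed.

End BetaForm.

Lemma generated_by_unbreakable_forests a (r : nat) : (0 < r)%N ->
  generates (fun x : cohomology R a =>
    exists F : forest n,
      [/\ integral_forest a F, rectified F, closed_roots F = set0,
          (forall i j, ~ breakable a F i j)
        & has_class (beta_form a R r F) x]).
Proof.
move=> r0; pose X v := exists F : forest n,
  [/\ integral_forest a F, rectified F, closed_roots F = set0,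
    (forall i j, ~ breakable a F i j) & v = beta_form a R r F].
apply: (generates_of_generated_over (X := X)) => [u fu du|c [F [h1 h2 h3 h4 cE]]]; last first.
  by exists F; split=> //; exists c.
apply: (generated_rescale (X := forest_form a 0)).
  move=> v [par [sigma [adm ->]]]; exists (\prod_i root_scalar r adm i).
    by apply/prodf_neq0 => i _; exact: root_scalar_neq0.
  exists (par_forest (admissible_increasing adm)); split.
  - exact: admissible_integral_forest.
  - exact: admissible_rectified.
  - exact: par_forest_closed_roots.
  - exact: admissible_unbreakable adm.
  - exact: esym (beta_form_par r adm).
have ST : [set: 'I_n] = vertices_from 0 by apply/setP => i; rewrite !inE.
rewrite ST in fu *; apply: generated_by_forest_forms fu du => // i.
by rewrite inE.
Qed.

End TwistedForms.

Theorem corollary4p10 (R : realType) (n : nat) (hn : (1 <= n)%N) :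
  (forall (a : 'I_n -> rat) (r : nat) (hr : (0 < r)%N)
          (hra : forall i, r%:R * a i \is a Num.int),
     generates (fun x : cohomology R a =>
       exists F : forest n,
         [/\ integral_forest a F, rectified F, closed_roots F = set0,
             (forall i j, ~ breakable a F i j)
           & has_class (beta_form a R r F) x]))
  /\
  (forall s : int,
     generates (@cohomology_deg R n (fun _ => s%:~R / n%:R)
                  (n - gcdn `|s|%N n))).
Proof.
split=> [a r hr _|s]; first exact: generated_by_unbreakable_forests.
exact: generated_by_lowest_degree.
Qed.
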